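(* The monodromy of the Chazy solutions $y(x;\nu)$ of PVI$_\mu$ with $\mu=-\frac12$ is described by the action of the group $\Gamma(2)$ on the parameter $\nu$, for a fixed basis $\omega_1,\omega_2$; i.e. given a branch $y(x;\nu)$, all the other branches of the same solution are of the form $y(x;\tilde\nu)$ with all $\tilde\nu$ such that $$\tilde\nu=\frac{a\nu+b}{c\nu+d}\quad\text{for}\quad\begin{pmatrix}a&b\\c&d\end{pmatrix}\in\Gamma(2).$$
   Context: PVI$_\mu$ is the equation $$y''=\tfrac12\Big(\tfrac1y+\tfrac1{y-1}+\tfrac1{y-x}\Big)(y')^2-\Big(\tfrac1x+\tfrac1{x-1}+\tfrac1{y-x}\Big)y'+\tfrac12\frac{y(y-1)(y-x)}{x^2(x-1)^2}\Big[(2\mu-1)^2+\frac{x(x-1)}{(y-x)^2}\Big].$$ Let $\omega_1(x),\omega_2(x)$ be two linearly independent solutions of the hypergeometric equation $x(1-x)\omega''+(1-2x)\omega'-\frac14\omega=0$. For $\nu\in\mathbb{C}$ put $W=\omega_1+\nu\omega_2$; the Chazy solution of PVI$_{\mu=-1/2}$ with parameter $\nu$ is $$y(x;\nu)=\frac{\frac18\{[W+2xW']^2-4x(W')^2\}^2}{W\,W'\,[2(x-1)W'+W]\,[W+2xW']}.$$ A branch of it is specified by a branch of $\omega_1,\omega_2$ with respect to the cuts $[-\infty,0]$ and $[1,+\infty]$ on the real axis; for example, near $x=0$ one can take $\omega_1=\frac\pi2F(\frac12,\frac12,1,x)$, $\omega_2=-\frac i2g(\frac12,\frac12,1,x)$,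 where $F$ is the Gauss hypergeometric series and, with $\psi$ the digamma function, $g(a,b,1,z)=\sum_{k\ge0}\frac{(a)_k(b)_k}{(k!)^2}z^k[\ln z+\psi(a+k)+\psi(b+k)-2\psi(k+1)]$. Other branches are obtained by analytic continuation along loops in $\overline{\mathbb{C}}\setminus\{0,1,\infty\}$. $\Gamma(2)$ is the group of matrices in $SL(2,\mathbb{Z})$ congruent to the identity modulo $2$.
   Formalization: The fixed basis is taken to be the normalised pair (π/2)F, −(i/2)g near 0, or any common branch of it; for arbitrary independent solutions, e.g. ω1, πω2, the monodromy acts by a conjugate of Γ(2) and the claim fails. Infinite ν̃ is read as W = ω2. *)

(* Defs.v *)
From Stdlib Require Import Reals ZArith.
From Coquelicot Require Import Coquelicot.
Open Scope R_scope.

Definition Gamma (x : R) : R :=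
  RInt_gen (fun t => Rpower t (x - 1) * exp (- t))
    (at_right 0) (Rbar_locally p_infty).

Definition digamma (x : R) : R := Derive Gamma x / Gamma x.

Fixpoint pochhammer (a : R) (k : nat) : R :=
  match k with
  | O => 1
  | S j => pochhammer a j * (a + INR j)
  end.

Definition CSeries (u : nat -> C) : C :=
  (Series (fun k => Re (u k)), Series (fun k => Im (u k))).

(* Principal logarithm off the cut (-oo, 0]: for -PI < theta < PI,
   tan (theta / 2) = sin theta / (1 + cos theta). *)
Definition Clog (z : C) : C :=
  (ln (Cmod z), 2 * atan (Im z / (Cmod z + Re z))).

Definition hyperF (a b c : R) (x : C) : C :=
  CSeries (fun k =>
    RtoC (pochhammer a k * pochhammer b k
          / (pochhammer c k * INR (fact k))) * x ^ k)%C.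

Definition hyperg (a b : R) (x : C) : C :=
  CSeries (fun k =>
    RtoC (pochhammer a k * pochhammer b k / (INR (fact k)) ^ 2) * x ^ k
    * (Clog x
       + RtoC (digamma (a + INR k) + digamma (b + INR k)
               - 2 * digamma (INR k + 1))))%C.

(* Near x = 0; meaningful for 0 < |x| < 1, x off (-1, 0). *)
Definition omega1_0 (x : C) : C :=
  (RtoC (PI / 2) * hyperF (1/2) (1/2) 1 x)%C.
Definition omega2_0 (x : C) : C :=
  (- (Ci / 2) * hyperg (1/2) (1/2) x)%C.

Definition analytic_at (f : C -> C) (z0 : C) : Prop :=
  exists a : nat -> C,
    locally z0 (fun z : C => is_pseries a (z - z0)%C (f z)).

(* Values at the centre are irrelevant here and in [germ_eq]: Rocq functions
   are total, and [x / 0] carries no meaning at a pole. *)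
Definition meromorphic_at (f : C -> C) (z0 : C) : Prop :=
  exists (n : nat) (g : C -> C),
    analytic_at g z0 /\
    locally' z0 (fun z : C => ((z - z0) ^ n * f z)%C = g z).

Definition germ_eq (z0 : C) (f g : C -> C) : Prop :=
  locally' z0 (fun z : C => f z = g z).

Definition unit_itv (t : R) : Prop := 0 <= t <= 1.

Definition loop (x0 : C) (gamma : R -> C) : Prop :=
  (forall t, unit_itv t ->
     filterlim gamma (within unit_itv (locally t)) (locally (gamma t))) /\
  (forall t, unit_itv t -> gamma t <> RtoC 0 /\ gamma t <> RtoC 1) /\
  gamma 0 = x0 /\ gamma 1 = x0.

(* [f t] represents the meromorphic germ at [gamma t]. *)
Definition continuation (gamma : R -> C) (f : R -> C -> C) : Prop :=
  forall t, unit_itv t ->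
    meromorphic_at (f t) (gamma t) /\
    within unit_itv (locally t) (fun s => germ_eq (gamma s) (f s) (f t)).

Definition cut_plane (x : C) : Prop :=
  Im x <> 0 \/ 0 < Re x < 1.

(* Functions on the cut plane, up to their values on a discrete set. *)
Definition meromorphic_on_cut_plane (f : C -> C) : Prop :=
  forall x, cut_plane x -> meromorphic_at f x.
Definition eq_on_cut_plane (f g : C -> C) : Prop :=
  forall x, cut_plane x -> germ_eq x f g.

(* [h], on the cut plane, is a branch of the multivalued function one of whose
   branches is [y]. *)
Definition is_branch (y h : C -> C) : Prop :=
  meromorphic_on_cut_plane h /\
  exists (x0 : C) (gamma : R -> C) (f : R -> C -> C),
    cut_plane x0 /\ loop x0 gamma /\ continuation gamma f /\
    germ_eq x0 (f 0) y /\ germ_eq x0 (f 1) h.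

Definition solves_hypergeometric (w : C -> C) : Prop :=
  forall x, cut_plane x ->
    (x * (1 - x) * C_derive (C_derive w) x + (1 - 2 * x) * C_derive w x
     - w x / 4)%C = RtoC 0.

Definition linearly_independent (w1 w2 : C -> C) : Prop :=
  forall p q : C,
    (forall x, cut_plane x -> (p * w1 x + q * w2 x)%C = RtoC 0) ->
    p = RtoC 0 /\ q = RtoC 0.

Record solution_basis (w1 w2 : C -> C) : Prop := {
  basis_analytic1 : forall x, cut_plane x -> analytic_at w1 x;
  basis_analytic2 : forall x, cut_plane x -> analytic_at w2 x;
  basis_solves1 : solves_hypergeometric w1;
  basis_solves2 : solves_hypergeometric w2;
  basis_independent : linearly_independent w1 w2
}.

(* Both functions are continued along the same loop, from the pair
   (omega1_0, omega2_0) at a point of its domain.  A constant loop gives the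
   principal branch.  The normalisation matters: in an arbitrary basis the
   monodromy acts by a conjugate of Gamma(2). *)
Definition standard_branch (w1 w2 : C -> C) : Prop :=
  exists (x0 : C) (gamma : R -> C) (f1 f2 : R -> C -> C),
    cut_plane x0 /\ Cmod x0 < 1 /\ loop x0 gamma /\
    continuation gamma f1 /\ continuation gamma f2 /\
    germ_eq x0 (f1 0) omega1_0 /\ germ_eq x0 (f2 0) omega2_0 /\
    germ_eq x0 (f1 1) w1 /\ germ_eq x0 (f2 1) w2.

(* The parameter lives on the projective line: a Moebius map with
   c * nu + d = 0 sends nu to infinity, and the formula for y, homogeneous of
   degree 0 in W, gives y(x; infinity) with W = omega_2. *)
Inductive P1 : Type :=
  | Fin (nu : C)
  | Infinity.

Definition chazy_W (w1 w2 : C -> C) (nu : P1) (x : C) : C :=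
  match nu with
  | Fin n => (w1 x + n * w2 x)%C
  | Infinity => w2 x
  end.

Definition chazy_formula (W : C -> C) (x : C) : C :=
  let w := W x in
  let w' := C_derive W x in
  (1 / 8 * (((w + 2 * x * w') ^ 2 - 4 * x * w' ^ 2) ^ 2)
   / (w * w' * (2 * (x - 1) * w' + w) * (w + 2 * x * w')))%C.

Definition chazy (w1 w2 : C -> C) (nu : P1) : C -> C :=
  chazy_formula (chazy_W w1 w2 nu).

Definition Gamma2 (a b c d : Z) : Prop :=
  (a * d - b * c = 1 /\
   (2 | a - 1) /\ (2 | b) /\ (2 | c) /\ (2 | d - 1))%Z.

Definition moebius (a b c d : Z) (nu : C) : P1 :=
  let A := RtoC (IZR a) in let B := RtoC (IZR b) in
  let G := RtoC (IZR c) in let D := RtoC (IZR d) in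
  if Ceq_dec (G * nu + D)%C (RtoC 0) then Infinity
  else Fin ((A * nu + B) / (G * nu + D))%C.

(* Main.v *)
(* Write omega_1 = K and omega_2 = i K' for the normalised basis on the cut
   plane.  The Chazy formula is homogeneous of degree 0 in W, so the statement is
   about the action of the monodromy group on rows (p, q), with
   W = p omega_1 + q omega_2.

   Three slit planes cover C minus {0, 1}: the cut plane, the plane without
   [0, +oo) and the plane without (-oo, 1].  The second carries a basis by Pfaff's
   transformation x -> x / (x - 1), the third by x -> 1 - x, and any two of the
   planes meet in the upper and lower half planes only.  On the half planes the
   three bases differ by 1, (1 0; 2 1) or (1 -2; 0 1): the first matrix is read off
   the logarithm in omega_2 at x = 0, the second follows by x -> 1 - x from the
   connection formula omega_1 (1 - x) = - i omega_2 (x).  Continuation along any loop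
   is a chain of such changes of chart, hence given by an element of Gamma(2);
   conversely circles about 0 and 1 realise generators of Gamma(2) up to sign, and
   the sign does not affect the Chazy solution.

   In the connection formula the coefficients a, b of F(1 - x) = a F + b g are real
   asymptotic data.  Landen's identity F(4k / (1 + k)^2) = (1 + k) F(k^2) holds on
   both sides and forces a = 0, provided g is normalised by
   psi(1/2) - psi(1) = - 2 ln 2; Wallis' product gives b = - 1 / pi.

   Analyticity of all functions comes from Cauchy's formula, and continuations are
   compared by the identity theorem for meromorphic germs. *)

Require Import Defs.
From Stdlib Require Import Reals ZArith Lra Lia Classical.
From Coquelicot Require Import Coquelicot.
Open Scope R_scope.

(** * Complex differentiation *)

(** The basis of the statement is only some continuation of the normalised one, hence differs from
    it by a matrix M of Gamma(2). Conjugation by M preserves Gamma(2), so the parameters reached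
    from nu are the same for every such basis. Rows are multiplied on the right: the Moebius map of
    (a b; c d) turns (1, nu) into (c nu + d, a nu + b), the product of (1, nu) with (d b; c a),
    which lies in Gamma(2) together with (a b; c d).

    Two obstacles shape the analysis. The denominator of the Chazy formula must not vanish
    identically anywhere along a path; the differential equation excludes this for each of its four
    factors unless W = 0. And the normalisation of g refers to digamma, the logarithmic derivative
    of an improper integral: differentiability and values both come from log-convexity and the
    functional equation, which squeeze the difference quotients of ln Gamma at x + n.

    The series give the normalised pair in a slit disc only. There the given basis is a combination
    of that pair, and inverting the matrix of coefficients extends the pair to the cut plane. *)

Lemma locally_Cmod (z : C) (P : C -> Prop) :
  locally z P <-> exists r, 0 < r /\ forall y, Cmod (y - z) < r -> P y.
Proof.
split.
- intros [e He]. exists e. split; [apply e|]. intros y Hy. apply He.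
  apply C_NormedModule_mixin_compat1. exact Hy.
- intros [r [Hr H]].
  assert (Hs : 0 < r / sqrt 2) by (apply Rdiv_lt_0_compat; [lra | apply Rlt_sqrt2_0]).
  exists (mkposreal _ Hs). intros y Hy. apply H.
  apply C_NormedModule_mixin_compat2 in Hy. simpl in Hy.
  replace r with (sqrt 2 * (r / sqrt 2)).
  exact Hy. field. generalize Rlt_sqrt2_0; lra.
Qed.

Lemma locally'_Cmod (z : C) (P : C -> Prop) :
  locally' z P <-> exists r, 0 < r /\ forall y, y <> z -> Cmod (y - z) < r -> P y.
Proof.
unfold locally', within. rewrite locally_Cmod. split; intros [r [Hr H]]; exists r; split; auto.
Qed.

Lemma locally_imp (z : C) (P Q : C -> Prop) :
  (forall y : C, P y -> Q y) -> locally z P -> locally z Q.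
Proof. intros H. now apply filter_imp. Qed.

Lemma locally_and (z : C) (P Q : C -> Prop) :
  locally z P -> locally z Q -> locally z (fun y : C => P y /\ Q y).
Proof. apply filter_and. Qed.

Lemma locally_all (z : C) (P : C -> Prop) : (forall y : C, P y) -> locally z P.
Proof. apply filter_forall. Qed.

Lemma Cmod_sub_sym (x y : C) : Cmod (x - y) = Cmod (y - x).
Proof. rewrite <- Cmod_opp. f_equal. ring. Qed.

Lemma Cmod_tri_sub (x y z : C) : Cmod (x - z) <= Cmod (x - y) + Cmod (y - z).
Proof. replace (x - z)%C with ((x - y) + (y - z))%C by ring. apply Cmod_triangle. Qed.

Lemma Cmod_sub_0 (x : C) : Cmod (x - x) = 0.
Proof. replace (x - x)%C with (RtoC 0) by ring. apply Cmod_0. Qed.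

Lemma Cmod_sub_pos (x y : C) : x <> y -> 0 < Cmod (x - y).
Proof. intros H. apply Cmod_gt_0. apply Cminus_eq_contra, H. Qed.

Lemma locally_Cball (z : C) (r : R) : 0 < r -> locally z (fun y => Cmod (y - z) < r).
Proof. intros H. apply locally_Cmod. exists r. auto. Qed.

Lemma locally_open_ball (z0 z : C) (r : R) :
  Cmod (z - z0) < r -> locally z (fun y => Cmod (y - z0) < r).
Proof.
intros H. apply locally_Cmod. exists (r - Cmod (z - z0)). split; [lra|].
intros y Hy. generalize (Cmod_tri_sub y z z0). lra.
Qed.

(** Continuity measured by [Cmod]. The balls of [C] as a product of uniform spaces are squares;
    [locally_Cmod] passes between the two. *)
Definition ccont (f : C -> C) (z : C) : Prop :=
  forall eps, 0 < eps -> locally z (fun y => Cmod (f y - f z) < eps).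

Lemma ccont_continuous (f : C -> C) (z : C) : ccont f z <-> continuous f z.
Proof.
split.
- intros H P HP. apply locally_Cmod in HP. destruct HP as [r [Hr HP]].
  generalize (H r Hr). unfold filtermap. apply locally_imp. intros y; apply HP.
- intros H e He. apply (H (fun u => Cmod (u - f z) < e)). apply locally_Cball, He.
Qed.

Lemma ccont_const (c z : C) : ccont (fun _ => c) z.
Proof. intros e He. apply locally_all. intros y. rewrite Cmod_sub_0. exact He. Qed.

Lemma ccont_id (z : C) : ccont (fun y => y) z.
Proof. intros e He. apply locally_Cball, He. Qed.

Lemma ccont_plus f g z : ccont f z -> ccont g z -> ccont (fun y => f y + g y)%C z.
Proof.
intros Hf Hg e He. assert (He2 : 0 < e / 2) by lra.
generalize (locally_and _ _ _ (Hf _ He2) (Hg _ He2)). apply locally_imp.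
intros y [H1 H2]. replace (f y + g y - (f z + g z))%C with ((f y - f z) + (g y - g z))%C by ring.
eapply Rle_lt_trans; [apply Cmod_triangle|]. lra.
Qed.

Lemma ccont_opp f z : ccont f z -> ccont (fun y => - f y)%C z.
Proof.
intros Hf e He. generalize (Hf _ He). apply locally_imp. intros y H.
replace (- f y - - f z)%C with (- (f y - f z))%C by ring. now rewrite Cmod_opp.
Qed.

Lemma ccont_mult f g z : ccont f z -> ccont g z -> ccont (fun y => f y * g y)%C z.
Proof.
intros Hf Hg e He.
set (A := Cmod (f z)). set (B := Cmod (g z)).
assert (HA : 0 <= A) by apply Cmod_ge_0. assert (HB : 0 <= B) by apply Cmod_ge_0.
set (d := Rmin 1 (e / (2 * (A + B + 1)))).
assert (Hd0 : 0 < e / (2 * (A + B + 1))) by (apply Rdiv_lt_0_compat; lra).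
assert (Hd : 0 < d) by (apply Rmin_pos; lra).
assert (Hd1 : d <= 1) by apply Rmin_l.
assert (Hd2 : d * (A + B + 1) <= e / 2).
{ apply Rle_trans with (e / (2 * (A + B + 1)) * (A + B + 1)).
  apply Rmult_le_compat_r; [lra | apply Rmin_r]. right; field; lra. }
generalize (locally_and _ _ _ (Hf _ Hd) (Hg _ Hd)). apply locally_imp.
intros y [H1 H2].
replace (f y * g y - f z * g z)%C with
  ((f y - f z) * (g y - g z) + ((f y - f z) * g z + f z * (g y - g z)))%C by ring.
eapply Rle_lt_trans; [apply Cmod_triangle|].
eapply Rle_lt_trans; [apply Rplus_le_compat_l, Cmod_triangle|].
rewrite !Cmod_mult. fold A B.
generalize (Cmod_ge_0 (f y - f z)) (Cmod_ge_0 (g y - g z)).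
intros P1 P2.
assert (Cmod (f y - f z) * Cmod (g y - g z) <= d * 1) by (apply Rmult_le_compat; lra).
assert (Cmod (f y - f z) * B <= d * B) by (apply Rmult_le_compat_r; lra).
assert (A * Cmod (g y - g z) <= A * d) by (apply Rmult_le_compat_l; lra).
nra.
Qed.

Lemma ccont_nz f z : ccont f z -> f z <> RtoC 0 -> locally z (fun y => f y <> RtoC 0).
Proof.
intros Hf Hz. apply Cmod_gt_0 in Hz. generalize (Hf _ Hz). apply locally_imp.
intros y Hy E. rewrite E in Hy. replace (RtoC 0 - f z)%C with (- f z)%C in Hy by ring.
rewrite Cmod_opp in Hy. lra.
Qed.

Lemma ccont_ext_loc f g z : locally z (fun y => f y = g y) -> ccont f z -> ccont g z.
Proof.
intros H Hf e He. generalize (locally_and _ _ _ H (Hf e He)). apply locally_imp.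
rewrite (locally_singleton _ _ H).
intros y [<- H2]. exact H2.
Qed.

Lemma ccont_inv f z : ccont f z -> f z <> RtoC 0 -> ccont (fun y => / f y)%C z.
Proof.
intros Hf Hz e He.
set (A := Cmod (f z)). assert (HA : 0 < A) by now apply Cmod_gt_0.
set (d := Rmin (A / 2) (e * (A * A / 4))).
assert (He' : 0 < e * (A * A / 4)) by (apply Rmult_lt_0_compat; nra).
assert (Hd : 0 < d) by (apply Rmin_pos; lra).
assert (Hd1 : d <= A / 2) by apply Rmin_l.
assert (Hd2 : d <= e * (A * A / 4)) by apply Rmin_r.
generalize (locally_and _ _ _ (Hf _ Hd) (ccont_nz _ _ Hf Hz)). apply locally_imp.
intros y [H1 H2].
replace (/ f y - / f z)%C with (- (f y - f z) / (f y * f z))%C by (field; auto).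
rewrite Cmod_div, Cmod_opp, Cmod_mult by now apply Cmult_neq_0. fold A.
assert (H3 : A / 2 < Cmod (f y)).
{ generalize (Cmod_triangle (f y) (f z - f y)).
  replace (f y + (f z - f y))%C with (f z) by ring. fold A.
  rewrite (Cmod_sub_sym (f z)). lra. }
apply Rlt_div_l; [nra|].
assert (A * A / 2 < Cmod (f y) * A) by nra. nra.
Qed.

Lemma ccont_comp f g z : ccont f (g z) -> ccont g z -> ccont (fun y => f (g y)) z.
Proof.
intros Hf Hg e He. destruct (proj1 (locally_Cmod _ _) (Hf e He)) as [r [Hr H]].
generalize (Hg r Hr). apply locally_imp. intros y; apply H.
Qed.

(* Caratheodory's form of differentiability turns the rules of calculus into
   algebraic identities. *)
Definition cderiv (f : C -> C) (z l : C) : Prop :=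
  exists phi, ccont phi z /\ phi z = l /\
    locally z (fun y => f y = f z + phi y * (y - z))%C.

Lemma cderiv_ccont f z l : cderiv f z l -> ccont f z.
Proof.
intros [phi [H1 [H2 H3]]].
apply ccont_ext_loc with (fun y => f z + phi y * (y + - z))%C.
- generalize H3. apply locally_imp. intros y E. rewrite E. ring.
- apply ccont_plus; [apply ccont_const|]. apply ccont_mult; [exact H1|].
  apply ccont_plus; [apply ccont_id | apply ccont_const].
Qed.

Lemma C_derive_unique f z l : cderiv f z l -> C_derive f z = l.
Proof.
intros [phi [H1 [H2 H3]]]. unfold C_derive. apply is_C_lim_unique.
intros P HP. rewrite <- H2 in HP.
assert (HQ : locally z (fun y => P (phi y))).
{ apply ccont_continuous in H1. exact (H1 _ HP). }
generalize (locally_and _ _ _ HQ H3). unfold filtermap, locally', within. apply locally_imp.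
intros y [Hy E] Hn. rewrite E.
replace ((f z + phi y * (y - z) - f z) / (y - z))%C with (phi y); [exact Hy|].
field. now apply Cminus_eq_contra.
Qed.

Lemma cderiv_ext_loc f g z l : locally z (fun y => f y = g y) -> cderiv f z l -> cderiv g z l.
Proof.
intros H [phi [H1 [H2 H3]]]. exists phi. split; [|split]; auto.
rewrite <- (locally_singleton _ _ H).
generalize (locally_and _ _ _ H H3). apply locally_imp. intros y [<- E]. exact E.
Qed.

Lemma C_derive_ext f g z l : locally z (fun y => f y = g y) -> cderiv f z l ->
  C_derive g z = C_derive f z.
Proof.
intros H F. rewrite (C_derive_unique _ _ _ F).
apply C_derive_unique. now apply cderiv_ext_loc with f.
Qed.

Lemma cderiv_const c z : cderiv (fun _ => c) z 0.
Proof.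
exists (fun _ => RtoC 0). split; [apply ccont_const|split]; auto.
apply locally_all. intros y. ring.
Qed.

Lemma cderiv_id z : cderiv (fun y => y) z 1.
Proof.
exists (fun _ => RtoC 1). split; [apply ccont_const|split]; auto.
apply locally_all. intros y. ring.
Qed.

Lemma cderiv_plus f g z a b : cderiv f z a -> cderiv g z b ->
  cderiv (fun y => f y + g y)%C z (a + b).
Proof.
intros [p [P1 [P2 P3]]] [q [Q1 [Q2 Q3]]].
exists (fun y => p y + q y)%C. split; [now apply ccont_plus|split]; [congruence|].
generalize (locally_and _ _ _ P3 Q3). apply locally_imp. intros y [-> ->]. ring.
Qed.

Lemma cderiv_mult f g z a b : cderiv f z a -> cderiv g z b ->
  cderiv (fun y => f y * g y)%C z (a * g z + f z * b).
Proof.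
intros F G. pose proof (cderiv_ccont _ _ _ G) as Gc.
destruct F as [p [P1 [P2 P3]]], G as [q [Q1 [Q2 Q3]]].
exists (fun y => p y * g y + f z * q y)%C. split; [|split].
- apply ccont_plus; apply ccont_mult; auto. apply ccont_const.
- congruence.
- generalize (locally_and _ _ _ P3 Q3). apply locally_imp. intros y [-> ->]. ring.
Qed.

Lemma cderiv_comp f g z a b : cderiv f (g z) a -> cderiv g z b ->
  cderiv (fun y => f (g y)) z (a * b).
Proof.
intros F G. pose proof (cderiv_ccont _ _ _ G) as Gc.
destruct F as [p [P1 [P2 P3]]], G as [q [Q1 [Q2 Q3]]].
exists (fun y => p (g y) * q y)%C. split; [|split].
- apply ccont_mult; auto. now apply ccont_comp.
- congruence.
- apply locally_Cmod in P3. destruct P3 as [r [Hr P3]].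
  generalize (locally_and _ _ _ Q3 (Gc r Hr)). apply locally_imp. intros y [E L].
  rewrite (P3 _ L), E. ring.
Qed.

Lemma cderiv_inv f z a : cderiv f z a -> f z <> RtoC 0 ->
  cderiv (fun y => / f y)%C z (- a / (f z * f z)).
Proof.
intros F N. pose proof (cderiv_ccont _ _ _ F) as Fc.
destruct F as [p [P1 [P2 P3]]].
exists (fun y => - p y * / (f y * f z))%C. split; [|split].
- apply ccont_mult. now apply ccont_opp. apply (ccont_inv (fun y => f y * f z)%C).
  apply ccont_mult; auto; apply ccont_const. now apply Cmult_neq_0.
- subst a. reflexivity.
- generalize (locally_and _ _ _ P3 (ccont_nz _ _ Fc N)). apply locally_imp. intros y [E L].
  assert (p y * (y - z) = f y - f z)%C by (rewrite E; ring).
  transitivity (/ f z + - (p y * (y - z)) / (f y * f z))%C; [rewrite H|]; field; auto.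
Qed.

Lemma cderiv_eq f z a b : cderiv f z a -> a = b -> cderiv f z b.
Proof. now intros H <-. Qed.

Lemma cderiv_opp f z a : cderiv f z a -> cderiv (fun y => - f y)%C z (- a).
Proof.
intros H. apply cderiv_ext_loc with (fun y => (- (1)) * f y)%C.
apply locally_all. intros; ring.
eapply cderiv_eq. apply (cderiv_mult (fun _ => (- (1))%C) f). apply cderiv_const. exact H. ring.
Qed.

Lemma cderiv_minus f g z a b : cderiv f z a -> cderiv g z b ->
  cderiv (fun y => f y - g y)%C z (a - b).
Proof. intros F G. apply (cderiv_plus f (fun y => - g y)%C); auto. now apply cderiv_opp. Qed.

Lemma cderiv_div f g z a b : cderiv f z a -> cderiv g z b -> g z <> RtoC 0 ->
  cderiv (fun y => f y / g y)%C z ((a * g z - f z * b) / (g z * g z)).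
Proof.
intros F G N. eapply cderiv_eq.
apply (cderiv_mult f (fun y => / g y)%C). exact F. apply cderiv_inv; eauto.
field. auto.
Qed.

Lemma cderiv_pow f z a n : cderiv f z a ->
  cderiv (fun y => f y ^ n)%C z (INR n * f z ^ pred n * a).
Proof.
intros F. induction n as [|n IH].
- simpl. eapply cderiv_eq. apply cderiv_const. simpl. ring.
- eapply cderiv_eq. simpl. apply (cderiv_mult f (fun y => f y ^ n)%C _ _ _ F IH).
  rewrite S_INR, RtoC_plus. destruct n; simpl; ring.
Qed.

(** * Complex power series *)

Lemma pow_n_Cpow (x : C) k : pow_n (K := C_Ring) x k = (x ^ k)%C.
Proof. induction k as [|k IH]; simpl; [reflexivity|]. now rewrite IH. Qed.

Lemma sum_n_Re (u : nat -> C) n : Re (sum_n u n) = sum_n (fun k => Re (u k)) n.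
Proof. induction n as [|n IH]; [now rewrite !sum_O|]. rewrite !sum_Sn, <- IH. reflexivity. Qed.

Lemma sum_n_Im (u : nat -> C) n : Im (sum_n u n) = sum_n (fun k => Im (u k)) n.
Proof. induction n as [|n IH]; [now rewrite !sum_O|]. rewrite !sum_Sn, <- IH. reflexivity. Qed.

Lemma im_le_Cmod (c : C) : Rabs (Im c) <= Cmod c.
Proof. eapply Rle_trans; [|apply Rmax_Cmod]. apply Rmax_r. Qed.

Lemma Cmod_le_Re_Im (c : C) : Cmod c <= Rabs (Re c) + Rabs (Im c).
Proof.
replace c with (RtoC (Re c) + Ci * RtoC (Im c))%C at 1.
eapply Rle_trans; [apply Cmod_triangle|].
rewrite Cmod_mult, Cmod_Ci, !Cmod_R. lra.
destruct c as [a b]; unfold Re, Im, Ci, RtoC, Cplus, Cmult; simpl. f_equal; ring.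
Qed.

Lemma is_series_C (u : nat -> C) (l : C) :
  is_series (V := C_NormedModule) u l <->
  is_series (fun k => Re (u k)) (Re l) /\ is_series (fun k => Im (u k)) (Im l).
Proof.
unfold is_series. split.
- intros H. split; intros P [e HP].
  + assert (Q : locally l (fun y : C => P (Re y))).
    { apply locally_Cmod. exists e. split; [apply e|]. intros y Hy. apply HP.
      eapply Rle_lt_trans; [|exact Hy]. apply (re_le_Cmod (y - l)). }
    generalize (H _ Q). unfold filtermap. apply filter_imp. intros n. now rewrite sum_n_Re.
  + assert (Q : locally l (fun y : C => P (Im y))).
    { apply locally_Cmod. exists e. split; [apply e|]. intros y Hy. apply HP.
      eapply Rle_lt_trans; [|exact Hy]. apply (im_le_Cmod (y - l)). }
    generalize (H _ Q). unfold filtermap. apply filter_imp. intros n. now rewrite sum_n_Im.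
- intros [H1 H2] P HP. apply locally_Cmod in HP. destruct HP as [r [Hr HP]].
  assert (Hr2 : 0 < r / 2) by lra.
  assert (Q1 := H1 _ (locally_ball (Re l) (mkposreal _ Hr2))).
  assert (Q2 := H2 _ (locally_ball (Im l) (mkposreal _ Hr2))).
  destruct Q1 as [N1 Q1], Q2 as [N2 Q2]. exists (max N1 N2). intros n Hn.
  assert (B1 := Q1 n (Nat.le_trans _ _ _ (Nat.le_max_l _ _) Hn)).
  assert (B2 := Q2 n (Nat.le_trans _ _ _ (Nat.le_max_r _ _) Hn)). apply HP. eapply Rle_lt_trans; [apply Cmod_le_Re_Im|].
  rewrite <- sum_n_Re in B1. rewrite <- sum_n_Im in B2.
  change (Rabs (Re (sum_n u n) - Re l) < r / 2) in B1.
  change (Rabs (Im (sum_n u n) - Im l) < r / 2) in B2.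
  change (Re (sum_n u n - l)) with (Re (sum_n u n) - Re l).
  change (Im (sum_n u n - l)) with (Im (sum_n u n) - Im l). lra.
Qed.

Lemma CSeries_unique (u : nat -> C) (l : C) :
  is_series (V := C_NormedModule) u l -> CSeries u = l.
Proof.
intros H. apply is_series_C in H. destruct H as [H1 H2].
unfold CSeries. rewrite (is_series_unique _ _ H1), (is_series_unique _ _ H2).
now destruct l.
Qed.

Definition csummable (u : nat -> C) := ex_series (fun k => Cmod (u k)).

Lemma csummable_Re u : csummable u -> ex_series (fun k => Re (u k)).
Proof.
intros H. apply (ex_series_le (K := R_AbsRing) (V := R_CompleteNormedModule) _ (fun k => Cmod (u k))); auto.
intros n. apply re_le_Cmod.
Qed.

Lemma csummable_Im u : csummable u -> ex_series (fun k => Im (u k)).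
Proof.
intros H. apply (ex_series_le (K := R_AbsRing) (V := R_CompleteNormedModule) _ (fun k => Cmod (u k))); auto.
intros n. apply im_le_Cmod.
Qed.

Lemma csummable_is_series u : csummable u -> is_series (V := C_NormedModule) u (CSeries u).
Proof.
intros H. apply is_series_C. unfold CSeries; simpl. split; apply Series_correct.
now apply csummable_Re. now apply csummable_Im.
Qed.

Lemma csummable_le u b : (forall k, Cmod (u k) <= b k) -> ex_series b -> csummable u.
Proof.
intros H Hb. apply (ex_series_le (K := R_AbsRing) (V := R_CompleteNormedModule) _ b); auto.
intros n. unfold norm; simpl. unfold abs; simpl. rewrite Rabs_pos_eq; [apply H | apply Cmod_ge_0].
Qed.

Lemma CSeries_ext u v : (forall k, u k = v k) -> CSeries u = CSeries v.
Proof. intros H. unfold CSeries. f_equal; apply Series_ext; intros n; now rewrite H. Qed.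

Lemma CSeries_plus u v : csummable u -> csummable v ->
  CSeries (fun k => u k + v k)%C = (CSeries u + CSeries v)%C.
Proof.
intros Hu Hv. unfold CSeries, Cplus; simpl. f_equal; rewrite <- Series_plus;
  try (apply csummable_Re); try (apply csummable_Im); auto.
Qed.

Lemma CSeries_scal c u : csummable u -> CSeries (fun k => c * u k)%C = (c * CSeries u)%C.
Proof.
intros Hu. pose proof (csummable_Re _ Hu) as H1. pose proof (csummable_Im _ Hu) as H2.
unfold CSeries, Cmult; simpl. f_equal.
- rewrite <- !Series_scal_l, <- Series_minus. reflexivity.
  now apply (ex_series_scal (V := R_NormedModule)). now apply (ex_series_scal (V := R_NormedModule)).
- rewrite <- !Series_scal_l, <- Series_plus. reflexivity.
  now apply (ex_series_scal (V := R_NormedModule)). now apply (ex_series_scal (V := R_NormedModule)).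
Qed.

Lemma csummable_plus u v : csummable u -> csummable v -> csummable (fun k => u k + v k)%C.
Proof.
intros Hu Hv. apply csummable_le with (fun k => Cmod (u k) + Cmod (v k)).
intros k; apply Cmod_triangle. now apply (ex_series_plus (V := R_NormedModule)).
Qed.

Lemma csummable_scal c u : csummable u -> csummable (fun k => c * u k)%C.
Proof.
intros Hu. apply csummable_le with (fun k => Cmod c * Cmod (u k)).
intros k; rewrite Cmod_mult; lra. now apply (ex_series_scal (V := R_NormedModule)).
Qed.

Lemma CSeries_shift u : csummable u -> CSeries u = (u O + CSeries (fun k => u (S k)))%C.
Proof.
intros H. unfold CSeries, Cplus; simpl. f_equal; rewrite Series_incr_1; auto.
now apply csummable_Re. now apply csummable_Im.
Qed.

Lemma csummable_shift u : csummable (fun k => u (S k)) <-> csummable u.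
Proof. unfold csummable. now rewrite (ex_series_incr_1 (fun k => Cmod (u k))). Qed.

(** The factor 2 comes from bounding the real and the imaginary series separately; the value of the
    constant is irrelevant for differentiability. *)
Lemma CSeries_bound u b : (forall k, Cmod (u k) <= b k) -> ex_series b ->
  Cmod (CSeries u) <= 2 * Series b.
Proof.
intros H Hb. eapply Rle_trans; [apply Cmod_le_Re_Im|]. unfold CSeries; simpl.
assert (forall (f : C -> R), (forall c, Rabs (f c) <= Cmod c) ->
  Rabs (Series (fun k => f (u k))) <= Series b).
{ intros f Hf. assert (ex_series (fun k => Rabs (f (u k)))).
  { apply (ex_series_le (K := R_AbsRing) (V := R_CompleteNormedModule) _ b); auto.
    intros n. unfold norm; simpl. unfold abs; simpl. rewrite Rabs_Rabsolu.
    eapply Rle_trans; [apply Hf | apply H]. }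
  eapply Rle_trans; [apply Series_Rabs; auto|].
  apply Series_le; auto. intros n. split; [apply Rabs_pos|].
  eapply Rle_trans; [apply Hf | apply H]. }
generalize (H0 _ re_le_Cmod) (H0 _ im_le_Cmod). lra.
Qed.

(* [r] is only a lower bound of the radius of convergence. *)
Definition cradius (a : nat -> C) (r : R) : Prop :=
  exists M, forall k, Cmod (a k) * r ^ k <= M.

Definition PS (a : nat -> C) (z : C) : C := CSeries (fun k => a k * z ^ k)%C.

Lemma geom_bound a r s : 0 <= s < r -> cradius a r ->
  exists M, 0 <= M /\ forall k, Cmod (a k) * s ^ k <= M * (s / r) ^ k.
Proof.
intros Hs [M HM]. exists M. split.
- eapply Rle_trans; [|apply (HM O)]. simpl. rewrite Rmult_1_r. apply Cmod_ge_0.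
- intros k. unfold Rdiv. rewrite Rpow_mult_distr, pow_inv.
  assert (0 < r ^ k) by (apply pow_lt; lra).
  apply Rle_trans with ((Cmod (a k) * r ^ k) * (s ^ k * / r ^ k)).
  right; field; lra. apply Rmult_le_compat_r; [|apply HM].
  apply Rmult_le_pos. apply pow_le; lra. left; now apply Rinv_0_lt_compat.
Qed.

Lemma ratio_lt_1 s r : 0 <= s < r -> Rabs (s / r) < 1.
Proof.
intros H. rewrite Rabs_pos_eq. apply Rlt_div_l; lra.
apply Rmult_le_pos; [lra|]. left; apply Rinv_0_lt_compat; lra.
Qed.

Lemma cradius_ex_series a r s : 0 <= s < r -> cradius a r -> ex_series (fun k => Cmod (a k) * s ^ k).
Proof.
intros Hs H. destruct (geom_bound _ _ _ Hs H) as [M [HM B]].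
apply (ex_series_le (K := R_AbsRing) (V := R_CompleteNormedModule) _ (fun k => M * (s / r) ^ k)).
- intros n. unfold norm; simpl. unfold abs; simpl. rewrite Rabs_pos_eq. apply B.
  apply Rmult_le_pos. apply Cmod_ge_0. apply pow_le; lra.
- apply (ex_series_scal (V := R_NormedModule) M). eexists. apply is_series_geom. now apply ratio_lt_1.
Qed.

Lemma cradius_summable a r z : Cmod z < r -> cradius a r -> csummable (fun k => a k * z ^ k)%C.
Proof.
intros Hz H. eapply csummable_le; [|apply (cradius_ex_series a r (Cmod z)); auto].
intros k. rewrite Cmod_mult, Cmod_pow. lra. split; auto. apply Cmod_ge_0.
Qed.

(** Each of the n terms of 1 + s + ... + s^(n-1) is at least s^n, and the sum is (1 - s^n) / (1 -
    s). *)
Lemma n_pow_bound (s : R) n : 0 <= s < 1 -> INR n * s ^ n <= / (1 - s).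
Proof.
intros Hs.
assert (H : INR n * s ^ n * (1 - s) <= 1 - s ^ n).
{ induction n as [|n IH]. simpl; lra. rewrite S_INR. simpl.
  assert (0 <= s ^ n) by (apply pow_le; lra).
  assert (s ^ n <= 1) by (rewrite <- (pow1 n); apply pow_incr; lra).
  assert (0 <= INR n) by apply pos_INR.
  assert (s * (INR n * s ^ n * (1 - s)) <= s * (1 - s ^ n)) by (apply Rmult_le_compat_l; lra).
  assert (s * s ^ n * (1 - s) <= 1 * (1 - s)).
  { apply Rmult_le_compat_r; nra. }
  nra. }
apply Rmult_le_reg_r with (1 - s); [lra|]. rewrite Rinv_l by lra.
assert (0 <= s ^ n) by (apply pow_le; lra). lra.
Qed.

(** A bound on the terms does not survive a factor k, so the radius has to shrink. Every
    differentiation of a series pays this price. *)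
Lemma cradius_weight a r s : 0 <= s < r -> cradius a r -> cradius (fun k => INR k * a k)%C s.
Proof.
intros Hs H. destruct (geom_bound _ _ _ Hs H) as [M [HM B]].
pose proof (ratio_lt_1 _ _ Hs) as L.
assert (Hq : 0 <= s / r) by (apply Rmult_le_pos; [lra|]; left; apply Rinv_0_lt_compat; lra).
rewrite Rabs_pos_eq in L by auto.
exists (M * / (1 - s / r)). intros k. rewrite Cmod_mult, Cmod_R, Rabs_pos_eq by apply pos_INR.
rewrite Rmult_assoc.
eapply Rle_trans; [apply Rmult_le_compat_l; [apply pos_INR | apply B]|].
replace (INR k * (M * (s / r) ^ k)) with (M * (INR k * (s / r) ^ k)) by ring.
apply Rmult_le_compat_l; auto. apply n_pow_bound. lra.
Qed.

Lemma cradius_shift a r : 0 < r -> cradius a r -> cradius (fun k => a (S k)) r.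
Proof.
intros Hr [M HM]. exists (M / r). intros k. specialize (HM (S k)). simpl in HM.
apply Rmult_le_reg_r with r; [exact Hr|]. replace (M / r * r) with M by (field; lra). lra.
Qed.

Definition PS_d (a : nat -> C) (k : nat) : C := (INR (S k) * a (S k))%C.

Lemma cradius_d a r s : 0 < s < r -> cradius a r -> cradius (PS_d a) s.
Proof.
intros Hs H. apply (cradius_shift (fun k => INR k * a k)%C). lra.
apply cradius_weight with r; auto. lra.
Qed.

Lemma cderiv_quadratic f z l K r : 0 < r ->
  (forall y, Cmod (y - z) < r -> Cmod (f y - f z - l * (y - z)) <= K * (Cmod (y - z)) ^ 2) ->
  cderiv f z l.
Proof.
intros Hr H.
exists (fun y => if Ceq_dec y z then l else (f y - f z) / (y - z))%C.
split; [|split].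
- intros e He. destruct (Ceq_dec z z) as [_|N]; [|easy].
  apply locally_Cmod. exists (Rmin r (e / (Rabs K + 1))).
  assert (HK : 0 <= Rabs K) by apply Rabs_pos.
  split. { apply Rmin_pos; auto. apply Rdiv_lt_0_compat; lra. }
  intros y Hy. destruct (Ceq_dec y z) as [->|N].
  { now rewrite Cmod_sub_0. }
  assert (N' : (y - z)%C <> RtoC 0) by now apply Cminus_eq_contra.
  assert (Hp : 0 < Cmod (y - z)) by now apply Cmod_gt_0.
  replace ((f y - f z) / (y - z) - l)%C with ((f y - f z - l * (y - z)) / (y - z))%C by (field; auto).
  rewrite Cmod_div by auto. apply Rlt_div_l; auto.
  eapply Rle_lt_trans. apply H. eapply Rlt_le_trans; [apply Hy | apply Rmin_l].
  assert (Cmod (y - z) < e / (Rabs K + 1)) by (eapply Rlt_le_trans; [apply Hy | apply Rmin_r]).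
  assert (Cmod (y - z) * (Rabs K + 1) < e) by (apply Rlt_div_r; lra).
  assert (K <= Rabs K) by apply Rle_abs. nra.
- now destruct (Ceq_dec z z).
- apply locally_all. intros y. destruct (Ceq_dec y z) as [->|N]; [ring|].
  field. now apply Cminus_eq_contra.
Qed.

(** The Taylor remainders satisfy E_(k+1) = y E_k + (y - z)^2 k z^(k-1). The factor rho^2 on the
    left stands for the exponent k - 2, which natural numbers do not allow for small k. *)
Lemma pow_taylor (y z : C) rho k : Cmod y <= rho -> Cmod z <= rho -> 0 < rho ->
  rho ^ 2 * Cmod (y ^ k - z ^ k - INR k * z ^ pred k * (y - z)) <=
  INR k * INR k * rho ^ k * Cmod (y - z) ^ 2.
Proof.
intros Hy Hz Hr. induction k as [|k IH].
- simpl. replace (1 - 1 - 0 * 1 * (y - z))%C with (RtoC 0) by ring. rewrite Cmod_0. lra.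
- replace (y ^ S k - z ^ S k - INR (S k) * z ^ pred (S k) * (y - z))%C with
   (y * (y ^ k - z ^ k - INR k * z ^ pred k * (y - z)) + (y - z) ^ 2 * (INR k * z ^ pred k))%C.
  2:{ rewrite S_INR, RtoC_plus. destruct k; simpl; ring. }
  set (E := (y ^ k - z ^ k - INR k * z ^ pred k * (y - z))%C) in *.
  assert (H1 : Cmod (y * E + (y - z) ^ 2 * (INR k * z ^ pred k)) <=
    rho * Cmod E + Cmod (y - z) ^ 2 * (INR k * Cmod z ^ pred k)).
  { eapply Rle_trans; [apply Cmod_triangle|].
    rewrite !Cmod_mult, !Cmod_pow, Cmod_R, (Rabs_pos_eq (INR k)) by apply pos_INR.
    apply Rplus_le_compat_r. apply Rmult_le_compat_r; auto. apply Cmod_ge_0. }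
  assert (H2 : rho ^ 2 * (INR k * Cmod z ^ pred k) <= INR k * rho ^ S k).
  { destruct k as [|k]. simpl; lra.
    assert (Cmod z ^ pred (S k) <= rho ^ k) by (apply pow_incr; split; [apply Cmod_ge_0 | auto]).
    replace (INR (S k) * rho ^ S (S k)) with (rho ^ 2 * (INR (S k) * rho ^ k)) by (simpl; ring).
    apply Rmult_le_compat_l. nra. apply Rmult_le_compat_l; auto. apply pos_INR. }
  set (d := Cmod (y - z)) in *. assert (0 <= d) by apply Cmod_ge_0.
  set (Z := Cmod z ^ pred k) in *.
  apply Rle_trans with (rho * (rho ^ 2 * Cmod E) + d ^ 2 * (rho ^ 2 * (INR k * Z))).
  { apply Rle_trans with (rho ^ 2 * (rho * Cmod E + d ^ 2 * (INR k * Z))).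
    apply Rmult_le_compat_l; [nra|auto]. right; ring. }
  assert (0 <= d ^ 2) by nra.
  assert (rho * (rho ^ 2 * Cmod E) <= rho * (INR k * INR k * rho ^ k * d ^ 2)) by (apply Rmult_le_compat_l; lra).
  assert (d ^ 2 * (rho ^ 2 * (INR k * Z)) <= d ^ 2 * (INR k * rho ^ S k)) by (apply Rmult_le_compat_l; lra).
  rewrite S_INR. simpl (rho ^ S k) in *.
  assert (0 <= INR k) by apply pos_INR. assert (0 < rho ^ k) by (apply pow_lt; lra).
  assert (0 <= rho * rho ^ k * d ^ 2) by (apply Rmult_le_pos; nra). nra.
Qed.

(** Differentiation term by term: with m midway between |z| and r, the remainder of the k-th term is
    at most k^2 |a_k| m^(k-2) |y - z|^2, which is summable in k. *)
Lemma PS_cderiv a r z : Cmod z < r -> cradius a r -> cderiv (PS a) z (PS (PS_d a) z).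
Proof.
intros Hz Ha.
set (m := (Cmod z + r) / 2). pose proof (Cmod_ge_0 z) as Z0.
assert (Hm : Cmod z < m < r) by (unfold m; lra).
set (b := fun k => INR k * INR k * Cmod (a k) * m ^ k).
assert (Hb : ex_series b).
{ eapply ex_series_ext with (fun k => Cmod (INR k * (INR k * a k)) * m ^ k).
  { intros k. unfold b. rewrite !Cmod_mult, !Cmod_R, !Rabs_pos_eq by apply pos_INR. simpl; ring. }
  apply (cradius_ex_series (fun k => INR k * (INR k * a k))%C ((2 * m + r) / 3)); [lra|].
  apply (cradius_weight (fun k => INR k * a k)%C ((m + 2 * r) / 3)); [lra|].
  apply (cradius_weight a r); auto; lra. }
apply cderiv_quadratic with (2 * Series b / m ^ 2) (m - Cmod z); [lra|].
intros y Hy.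
assert (Hym : Cmod y < m).
{ replace y with (z + (y - z))%C by ring. eapply Rle_lt_trans; [apply Cmod_triangle|]. lra. }
assert (Sy : csummable (fun k => a k * y ^ k)%C) by (apply cradius_summable with r; auto; lra).
assert (Sz : csummable (fun k => a k * z ^ k)%C) by (apply cradius_summable with r; auto; lra).
assert (Sd : csummable (fun k => PS_d a k * z ^ k)%C).
{ apply cradius_summable with m; [lra|]. apply cradius_d with r; auto. lra. }
assert (Sd' : csummable (fun k => INR k * a k * z ^ pred k)%C).
{ apply csummable_shift. exact Sd. }
assert (E : PS (PS_d a) z = CSeries (fun k => INR k * a k * z ^ pred k)%C).
{ rewrite (CSeries_shift (fun k => INR k * a k * z ^ pred k)%C) by auto. simpl INR.
  unfold PS. rewrite Cmult_0_l, Cmult_0_l, Cplus_0_l. reflexivity. }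
rewrite E. unfold PS.
replace (CSeries (fun k => a k * y ^ k) - CSeries (fun k => a k * z ^ k) -
   CSeries (fun k => INR k * a k * z ^ pred k) * (y - z))%C with
  (CSeries (fun k => a k * (y ^ k - z ^ k - INR k * z ^ pred k * (y - z)))%C).
2:{ transitivity (CSeries (fun k => a k * y ^ k) + ((- (1)) * CSeries (fun k => a k * z ^ k) +
   (- (y - z)) * CSeries (fun k => INR k * a k * z ^ pred k)))%C; [|ring].
  rewrite <- !CSeries_scal by auto.
  rewrite <- !CSeries_plus; auto using csummable_plus, csummable_scal.
  apply CSeries_ext. intros k. ring. }
replace (2 * Series b / m ^ 2 * Cmod (y - z) ^ 2) with (2 * Series (fun k => (Cmod (y - z) ^ 2 / m ^ 2) * b k)).
2:{ rewrite Series_scal_l. field. lra. }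
apply CSeries_bound; [|apply (ex_series_scal (V := R_NormedModule)); auto].
intros k. rewrite Cmod_mult.
assert (T := pow_taylor y z m k).
assert (0 < m ^ 2) by nra.
apply Rle_trans with (Cmod (a k) * (INR k * INR k * m ^ k * Cmod (y - z) ^ 2 / m ^ 2)).
- apply Rmult_le_compat_l; [apply Cmod_ge_0|]. apply (proj1 (Rle_div_r _ _ _ H)).
  rewrite Rmult_comm. apply T; lra.
- unfold b. right. field. lra.
Qed.

Lemma csummable_0 u : (forall k, u k = RtoC 0) -> csummable u.
Proof.
intros H. apply csummable_le with (fun k => 0 * 0 ^ k).
intros k. rewrite H, Cmod_0. lra.
apply (ex_series_scal (V := R_NormedModule) 0). eexists. apply is_series_geom. rewrite Rabs_R0; lra.
Qed.

Lemma CSeries_0 u : (forall k, u k = RtoC 0) -> CSeries u = RtoC 0.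
Proof.
intros H. rewrite (CSeries_ext u (fun k => 0 * u k)%C).
rewrite CSeries_scal by now apply csummable_0. ring. intros k. rewrite H. ring.
Qed.

Lemma PS_0 a : PS a 0 = a O.
Proof.
assert (Z : forall k, (a (S k) * 0 ^ S k)%C = RtoC 0) by (intros k; simpl; ring).
unfold PS. rewrite CSeries_shift.
- rewrite CSeries_0 by exact Z. simpl. ring.
- apply csummable_shift. now apply csummable_0.
Qed.

(** Convergence at the single point z0 + r/2 bounds the terms there, and this bound on the
    coefficients is all that the calculus of [PS] uses. *)
Lemma analytic_at_PS (f : C -> C) (z0 : C) : analytic_at f z0 <->
  exists a r, 0 < r /\ cradius a r /\ forall z, Cmod (z - z0) < r -> f z = PS a (z - z0).
Proof.
split.
- intros [a H]. apply locally_Cmod in H. destruct H as [r [Hr H]].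
  assert (Q : forall z, Cmod (z - z0) < r ->
    is_series (V := C_NormedModule) (fun k => a k * (z - z0) ^ k)%C (f z)).
  { intros z Hz. generalize (H z Hz). unfold is_pseries. apply is_series_ext.
    intros n. rewrite pow_n_Cpow. apply Cmult_comm. }
  exists a, (r / 2). split; [lra|]. split.
  + specialize (Q (z0 + RtoC (r / 2))%C).
    replace (z0 + RtoC (r / 2) - z0)%C with (RtoC (r / 2)) in Q by ring.
    assert (K : Cmod (RtoC (r / 2)) < r) by (rewrite Cmod_R, Rabs_pos_eq; lra). specialize (Q K).
    apply is_series_C in Q. destruct Q as [Q1 Q2].
    assert (B : forall u : nat -> R, ex_series u -> exists M, forall n, Rabs (u n) <= M).
    { intros u Hu. apply ex_series_lim_0 in Hu.
      apply is_lim_seq_Reals in Hu. destruct (maj_by_pos u) as [M [_ HM]].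
      now exists 0. now exists M. }
    destruct (B _ (ex_intro _ _ Q1)) as [M1 HM1]. destruct (B _ (ex_intro _ _ Q2)) as [M2 HM2].
    exists (M1 + M2). intros k. specialize (HM1 k). specialize (HM2 k).
    replace (Cmod (a k) * (r / 2) ^ k) with (Cmod (a k * RtoC (r / 2) ^ k)).
    2:{ rewrite Cmod_mult, Cmod_pow, Cmod_R, Rabs_pos_eq; lra. }
    eapply Rle_trans; [apply Cmod_le_Re_Im|]. lra.
  + intros z Hz. symmetry. apply CSeries_unique, Q. lra.
- intros [a [r [Hr [Ha H]]]]. exists a. apply locally_Cmod. exists r. split; auto.
  intros z Hz. unfold is_pseries.
  apply (is_series_ext (fun k => a k * (z - z0) ^ k)%C).
  { intros n. rewrite <- pow_n_Cpow. apply Cmult_comm. }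
  rewrite H by auto. apply csummable_is_series. now apply cradius_summable with r.
Qed.

(** * Integrals along circles *)

Lemma continuous_Re_Im {T : UniformSpace} (f : T -> C) (x : T) :
  continuous (U := C_UniformSpace) f x <->
  continuous (fun t => Re (f t)) x /\ continuous (fun t => Im (f t)) x.
Proof.
split.
- intros H. split.
  apply (continuous_comp (V := C_UniformSpace) f (fun c : C => Re c)); auto. destruct (f x). apply continuous_fst.
  apply (continuous_comp (V := C_UniformSpace) f (fun c : C => Im c)); auto. destruct (f x). apply continuous_snd.
- intros [H1 H2] P [e HP]. unfold filtermap.
  assert (Q1 : locally x (fun t => ball (Re (f x)) e (Re (f t)))) by exact (H1 _ (locally_ball _ e)).
  assert (Q2 : locally x (fun t => ball (Im (f x)) e (Im (f t)))) by exact (H2 _ (locally_ball _ e)).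
  generalize (filter_and _ _ Q1 Q2). apply filter_imp. intros t [B1 B2]. apply HP. split; assumption.
Qed.

Lemma continuous_Cmult {T : UniformSpace} (f g : T -> C) (x : T) :
  continuous (U := C_UniformSpace) f x -> continuous (U := C_UniformSpace) g x ->
  continuous (U := C_UniformSpace) (fun t => f t * g t)%C x.
Proof.
rewrite !continuous_Re_Im. intros [F1 F2] [G1 G2]. split.
- apply continuous_ext with (fun t => Re (f t) * Re (g t) - Im (f t) * Im (g t)). reflexivity.
  apply (continuous_minus (V := R_NormedModule)); apply (continuous_mult (K := R_AbsRing)); auto.
- apply continuous_ext with (fun t => Re (f t) * Im (g t) + Im (f t) * Re (g t)). reflexivity.
  apply (continuous_plus (V := R_NormedModule)); apply (continuous_mult (K := R_AbsRing)); auto.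
Qed.

Lemma continuous_Cplus {T : UniformSpace} (f g : T -> C) (x : T) :
  continuous (U := C_UniformSpace) f x -> continuous (U := C_UniformSpace) g x ->
  continuous (U := C_UniformSpace) (fun t => f t + g t)%C x.
Proof.
rewrite !continuous_Re_Im. intros [F1 F2] [G1 G2]. split.
- apply (continuous_plus (V := R_NormedModule) (fun t => Re (f t)) (fun t => Re (g t))); auto.
- apply (continuous_plus (V := R_NormedModule) (fun t => Im (f t)) (fun t => Im (g t))); auto.
Qed.

Lemma continuous_RtoC {T : UniformSpace} (f : T -> R) (x : T) :
  continuous f x -> continuous (U := C_UniformSpace) (fun t => RtoC (f t)) x.
Proof. intros H. apply continuous_Re_Im. split; [exact H | apply continuous_const]. Qed.

Lemma continuous_ccont_comp {T : UniformSpace} (f : C -> C) (g : T -> C) (x : T) :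
  continuous (U := C_UniformSpace) g x -> ccont f (g x) ->
  continuous (U := C_UniformSpace) (fun t => f (g t)) x.
Proof.
intros G F. apply (continuous_comp (V := C_UniformSpace) g f); auto. now apply ccont_continuous.
Qed.

Lemma continuous_Cinv {T : UniformSpace} (f : T -> C) (x : T) :
  continuous (U := C_UniformSpace) f x -> f x <> RtoC 0 ->
  continuous (U := C_UniformSpace) (fun t => / f t)%C x.
Proof.
intros H N. apply (continuous_ccont_comp (fun z => / z)%C); auto.
apply (ccont_inv (fun z => z)); auto. apply ccont_id.
Qed.

Lemma Rlocally_imp (t : R) (P Q : R -> Prop) :
  (forall u : R, P u -> Q u) -> locally t P -> locally t Q.
Proof. intros H. now apply filter_imp. Qed.

Lemma is_derive_caratheodory (h psi : R -> R) (t : R) :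
  continuous psi t -> locally t (fun u => h u = h t + psi u * (u - t)) ->
  is_derive h t (psi t).
Proof.
intros Hc [d Hd]. apply is_derive_Reals. intros e He.
destruct (Hc _ (locally_ball (psi t) (mkposreal e He))) as [d' Hd'].
assert (Hm : 0 < Rmin d d') by (apply Rmin_pos; [apply d | apply d']).
exists (mkposreal _ Hm). intros k Hk Hk'. simpl in Hk'.
assert (B : forall r : posreal, Rabs k < r -> ball t r (t + k)).
{ intros r Hr. change (Rabs (t + k - t) < r). now replace (t + k - t) with k by ring. }
rewrite (Hd (t + k)) by (apply B; eapply Rlt_le_trans; [apply Hk' | apply Rmin_l]).
replace ((h t + psi (t + k) * (t + k - t) - h t) / k - psi t) with (psi (t + k) - psi t) by (field; auto).
apply Hd', B. eapply Rlt_le_trans; [apply Hk' | apply Rmin_r].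
Qed.

Lemma is_derive_caratheodory_inv (h : R -> R) (t l : R) : is_derive h t l ->
  exists psi : R -> R, continuous psi t /\ psi t = l /\ forall u : R, h u = h t + psi u * (u - t).
Proof.
intros H. apply is_derive_Reals in H.
exists (fun u => if Req_dec_T u t then l else (h u - h t) / (u - t)). split; [|split].
- intros P [e HP]. destruct (H e (cond_pos e)) as [d Hd].
  assert (K : forall u : R, Rabs (u - t) < d ->
    Rabs ((if Req_dec_T u t then l else (h u - h t) / (u - t)) -
          (if Req_dec_T t t then l else (h t - h t) / (t - t))) < e).
  { intros u Hu. destruct (Req_dec_T t t) as [_|]; [|easy].
    destruct (Req_dec_T u t) as [_|N]. rewrite Rminus_diag, Rabs_R0. apply cond_pos.
    specialize (Hd (u - t)). replace (t + (u - t)) with u in Hd by ring.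
    apply Hd; auto. lra. }
  exists d. intros u Hu. apply HP. exact (K u Hu).
- now destruct (Req_dec_T t t).
- intros u. destruct (Req_dec_T u t) as [->|N]. ring. field. lra.
Qed.

Definition rderiv (g : R -> C) (t : R) (l : C) : Prop :=
  is_derive (fun u => Re (g u)) t (Re l) /\ is_derive (fun u => Im (g u)) t (Im l).

Lemma rderiv_continuous g t l : rderiv g t l -> continuous (U := C_UniformSpace) g t.
Proof.
intros [H1 H2]. apply continuous_Re_Im. split.
- apply (ex_derive_continuous (K := R_AbsRing) (V := R_NormedModule)). eexists; exact H1.
- apply (ex_derive_continuous (K := R_AbsRing) (V := R_NormedModule)). eexists; exact H2.
Qed.

(** With Caratheodory slopes the chain rule is a product: [phi] along the path times the pair of
    real slopes of the path is a slope of the composite. *)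
Lemma cderiv_rderiv (f : C -> C) (g : R -> C) t l m :
  cderiv f (g t) l -> rderiv g t m -> rderiv (fun u => f (g u)) t (l * m).
Proof.
intros [phi [F1 [F2 F3]]] G. pose proof (rderiv_continuous _ _ _ G) as Gc.
destruct G as [G1 G2].
destruct (is_derive_caratheodory_inv _ _ _ G1) as [p [P1 [P2 P3]]].
destruct (is_derive_caratheodory_inv _ _ _ G2) as [q [Q1 [Q2 Q3]]].
set (chi := fun u => (phi (g u) * (p u, q u))%C).
assert (Hchi : continuous (U := C_UniformSpace) chi t).
{ apply continuous_Cmult. now apply continuous_ccont_comp. apply continuous_Re_Im. split; auto. }
assert (E : chi t = (l * m)%C).
{ unfold chi. rewrite F2, P2, Q2. now destruct m. }
rewrite <- E. apply continuous_Re_Im in Hchi. destruct Hchi as [C1 C2].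
assert (L : locally t (fun u => f (g u) = f (g t) + chi u * RtoC (u - t))%C).
{ generalize (Gc _ F3). apply Rlocally_imp. intros u Hu. rewrite Hu. unfold chi.
  rewrite <- Cmult_assoc. f_equal. f_equal.
  specialize (P3 u). specialize (Q3 u).
  apply injective_projections; simpl in *; unfold Re, Im in *; lra. }
split; [apply (is_derive_caratheodory _ (fun u => Re (chi u)) t C1)
  | apply (is_derive_caratheodory _ (fun u => Im (chi u)) t C2)]; generalize L; apply Rlocally_imp;
  intros u ->; rewrite ?re_plus, ?im_plus, ?re_scal_r, ?im_scal_r; reflexivity.
Qed.

Definition cis (t : R) : C := (cos t, sin t).

Lemma cis_rderiv t : rderiv cis t (Ci * cis t).
Proof. split; simpl; auto_derive; auto; ring. Qed.

Lemma Cmod_cis t : Cmod (cis t) = 1.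
Proof.
unfold Cmod, cis. cbn [fst snd]. replace (cos t ^ 2 + sin t ^ 2) with 1. apply sqrt_1.
generalize (sin2_cos2 t). unfold Rsqr. simpl. lra.
Qed.

Lemma rderiv_affine (a b : C) (g : R -> C) t m : rderiv g t m ->
  rderiv (fun u => a + b * g u)%C t (b * m).
Proof.
intros H. apply (cderiv_rderiv (fun z => a + b * z)%C); auto.
eapply cderiv_eq. apply (cderiv_plus (fun _ => a) (fun z => b * z)%C).
apply cderiv_const. apply (cderiv_mult (fun _ => b) (fun z => z)). apply cderiv_const. apply cderiv_id.
ring.
Qed.

Lemma rderiv_line (a b : C) t : rderiv (fun u => a + b * RtoC u)%C t b.
Proof.
assert (H := rderiv_affine a b RtoC t 1). rewrite Cmult_1_r in H. apply H. split; simpl. apply (is_derive_id (K := R_AbsRing)).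
apply (is_derive_const (K := R_AbsRing) (V := R_NormedModule)).
Qed.

(** Integration over the angle instead of dz. Since dz = i z dt on a circle, Cauchy's kernel dz / (z
    - w) appears below as z / (z - w). *)
Definition CI (phi : R -> C) : C :=
  (RInt (fun t => Re (phi t)) 0 (2 * PI), RInt (fun t => Im (phi t)) 0 (2 * PI)).

Definition ccontR (phi : R -> C) := forall t : R, continuous (U := C_UniformSpace) phi t.

Lemma ccontR_ex phi : ccontR phi ->
  ex_RInt (fun t => Re (phi t)) 0 (2 * PI) /\ ex_RInt (fun t => Im (phi t)) 0 (2 * PI).
Proof.
intros H. split; apply (ex_RInt_continuous (V := R_CompleteNormedModule)); intros t _;
specialize (H t); apply continuous_Re_Im in H; tauto.
Qed.

Lemma CI_ext f g : (forall t, f t = g t) -> CI f = CI g.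
Proof. intros H. unfold CI. f_equal; apply RInt_ext; intros t _; now rewrite H. Qed.

Lemma RInt_Rplus (f g : R -> R) a b : ex_RInt f a b -> ex_RInt g a b ->
  RInt (fun x => f x + g x) a b = RInt f a b + RInt g a b.
Proof. exact (RInt_plus (V := R_CompleteNormedModule) f g a b). Qed.

Lemma RInt_Rminus (f g : R -> R) a b : ex_RInt f a b -> ex_RInt g a b ->
  RInt (fun x => f x - g x) a b = RInt f a b - RInt g a b.
Proof. exact (RInt_minus (V := R_CompleteNormedModule) f g a b). Qed.

Lemma RInt_Rscal (f : R -> R) a b k : ex_RInt f a b ->
  RInt (fun x => k * f x) a b = k * RInt f a b.
Proof. exact (RInt_scal (V := R_CompleteNormedModule) f a b k). Qed.

Lemma ex_RInt_Rscal (f : R -> R) a b k : ex_RInt f a b -> ex_RInt (fun x => k * f x) a b.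
Proof. exact (ex_RInt_scal (V := R_NormedModule) f a b k). Qed.

Lemma CI_plus f g : ccontR f -> ccontR g -> CI (fun t => f t + g t)%C = (CI f + CI g)%C.
Proof.
intros Hf Hg. destruct (ccontR_ex _ Hf), (ccontR_ex _ Hg). unfold CI, Cplus. cbn [fst snd].
rewrite <- !RInt_Rplus by assumption. reflexivity.
Qed.

Lemma CI_scal c f : ccontR f -> CI (fun t => c * f t)%C = (c * CI f)%C.
Proof.
intros Hf. destruct (ccontR_ex _ Hf) as [H1 H2]. unfold CI, Cmult. cbn [fst snd].
rewrite <- !RInt_Rscal by assumption.
rewrite <- RInt_Rplus, <- RInt_Rminus by now apply ex_RInt_Rscal. reflexivity.
Qed.

Lemma CI_bound f M : ccontR f -> (forall t, 0 <= t <= 2 * PI -> Cmod (f t) <= M) -> Cmod (CI f) <= 4 * PI * M.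
Proof.
intros Hf HM. destruct (ccontR_ex _ Hf) as [H1 H2].
eapply Rle_trans; [apply Cmod_le_Re_Im|]. unfold CI; simpl.
assert (0 <= 2 * PI) by (generalize PI_RGT_0; lra).
assert (A := abs_RInt_le_const _ _ _ M H H1 (fun t Ht => Rle_trans _ _ _ (re_le_Cmod (f t)) (HM t Ht))).
assert (B := abs_RInt_le_const _ _ _ M H H2 (fun t Ht => Rle_trans _ _ _ (im_le_Cmod (f t)) (HM t Ht))).
unfold Re, Im in *. lra.
Qed.

Lemma CI_derive f f' : (forall t, rderiv f t (f' t)) -> ccontR f' -> f 0 = f (2 * PI) -> CI f' = 0.
Proof.
intros H Hc E. unfold CI.
assert (A : is_RInt (fun t => Re (f' t)) 0 (2 * PI) (Re (f (2 * PI)) - Re (f 0))).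
{ apply (is_RInt_derive (V := R_CompleteNormedModule) (fun t => Re (f t))). intros t _; apply H.
  intros t _. specialize (Hc t). apply continuous_Re_Im in Hc. tauto. }
assert (B : is_RInt (fun t => Im (f' t)) 0 (2 * PI) (Im (f (2 * PI)) - Im (f 0))).
{ apply (is_RInt_derive (V := R_CompleteNormedModule) (fun t => Im (f t))). intros t _; apply H.
  intros t _. specialize (Hc t). apply continuous_Re_Im in Hc. tauto. }
apply (is_RInt_unique (V := R_CompleteNormedModule)) in A.
apply (is_RInt_unique (V := R_CompleteNormedModule)) in B. rewrite A, B, E.
unfold RtoC. f_equal; ring.
Qed.

Lemma CI_const c : CI (fun _ => c) = (RtoC (2 * PI) * c)%C.
Proof.
unfold CI. rewrite !RInt_const. unfold scal; simpl; unfold mult; simpl.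
apply injective_projections; simpl; unfold Re, Im; ring.
Qed.

Lemma cis_2PI : cis 0 = cis (2 * PI).
Proof. unfold cis. now rewrite cos_0, sin_0, cos_2PI, sin_2PI. Qed.

Lemma ccontR_bounded phi : ccontR phi ->
  exists M, forall t, 0 <= t <= 2 * PI -> Cmod (phi t) <= M.
Proof.
intros H.
destruct (bounded_continuity (V := R_NormedModule) (fun t => Re (phi t)) 0 (2 * PI)) as [A HA].
{ intros t _. specialize (H t). apply continuous_Re_Im in H. apply H. }
destruct (bounded_continuity (V := R_NormedModule) (fun t => Im (phi t)) 0 (2 * PI)) as [B HB].
{ intros t _. specialize (H t). apply continuous_Re_Im in H. apply H. }
exists (A + B). intros t Ht. eapply Rle_trans; [apply Cmod_le_Re_Im|].
specialize (HA t Ht). specialize (HB t Ht). unfold norm in *; simpl in *; unfold abs in *; simpl in *. lra.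
Qed.

Lemma is_series_geom_error (u : nat -> C) (L : C) (B q : R) : 0 <= q < 1 ->
  (forall n, Cmod (sum_n u n - L) <= B * q ^ n) -> is_series (V := C_NormedModule) u L.
Proof.
intros Hq H P HP. apply locally_Cmod in HP. destruct HP as [r [Hr HP]].
assert (G : is_lim_seq (fun n => (Rabs B + 1) * q ^ n) 0).
{ replace (Finite 0) with (Rbar_mult (Rabs B + 1) 0).
  apply is_lim_seq_scal_l. apply is_lim_seq_geom. rewrite Rabs_pos_eq; lra.
  simpl. f_equal. ring. }
apply is_lim_seq_Reals in G. destruct (G r Hr) as [N HN]. exists N. intros n Hn. apply HP.
eapply Rle_lt_trans; [apply H|]. specialize (HN n Hn). unfold Rdist in HN.
assert (0 <= q ^ n) by (apply pow_le; lra).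
assert (B <= Rabs B) by apply Rle_abs. assert (0 <= Rabs B) by apply Rabs_pos.
rewrite Rminus_0_r, Rabs_pos_eq in HN by nra. nra.
Qed.

Lemma cis_continuous t : continuous (U := C_UniformSpace) cis t.
Proof. eapply rderiv_continuous, cis_rderiv. Qed.

Lemma circle_continuous (r : R) t : continuous (U := C_UniformSpace) (fun t => RtoC r * cis t)%C t.
Proof. apply continuous_Cmult. apply (continuous_const (U := R_UniformSpace) (V := C_UniformSpace)). apply cis_continuous. Qed.

Lemma circle_mod (r : R) t : 0 < r -> Cmod (RtoC r * cis t) = r.
Proof. intros H. rewrite Cmod_mult, Cmod_cis, Cmod_R, Rabs_pos_eq; lra. Qed.

Lemma circle_nz (r : R) t : 0 < r -> (RtoC r * cis t)%C <> RtoC 0.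
Proof. intros H. apply Cmod_gt_0. rewrite circle_mod; lra. Qed.

Lemma circle_sub (r : R) t w : 0 < r -> r - Cmod w <= Cmod (RtoC r * cis t - w).
Proof.
intros H. generalize (Cmod_triangle (RtoC r * cis t - w) w).
replace (RtoC r * cis t - w + w)%C with (RtoC r * cis t)%C by ring.
rewrite circle_mod; lra.
Qed.

Lemma circle_sub_nz (r : R) t w : Cmod w < r -> (RtoC r * cis t - w)%C <> RtoC 0.
Proof.
intros H. generalize (Cmod_ge_0 w). intros. apply Cmod_gt_0. generalize (circle_sub r t w). lra.
Qed.

Lemma continuous_Cpow {T : UniformSpace} (f : T -> C) (x : T) n :
  continuous (U := C_UniformSpace) f x -> continuous (U := C_UniformSpace) (fun t => f t ^ n)%C x.
Proof.
intros H. induction n as [|n IH]; simpl. apply continuous_const. now apply continuous_Cmult.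
Qed.

(** If phi is the restriction of an analytic function to the circle of radius r, this is 2 pi times
    its n-th Taylor coefficient. *)
Definition cauchy_coef (r : R) (phi : R -> C) (n : nat) : C :=
  CI (fun t => phi t * / (RtoC r * cis t) ^ n)%C.

(** Expansion of the kernel z / (z - w) in powers of w / z. The density phi is only continuous: its
    Cauchy transform is a power series whether or not phi comes from an analytic function. *)
Lemma cauchy_series (phi : R -> C) (r : R) : 0 < r -> ccontR phi ->
  cradius (cauchy_coef r phi) r /\
  forall w, Cmod w < r ->
    PS (cauchy_coef r phi) w = CI (fun t => phi t * (RtoC r * cis t / (RtoC r * cis t - w)))%C.
Proof.
intros Hr Hphi. destruct (ccontR_bounded _ Hphi) as [M HM].
assert (M0 : 0 <= M).
{ eapply Rle_trans; [|apply (HM 0)]. apply Cmod_ge_0. generalize PI_RGT_0; lra. }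
assert (Cn : forall n, ccontR (fun t => phi t * / (RtoC r * cis t) ^ n)%C).
{ intros n t. apply continuous_Cmult; [apply Hphi|]. apply continuous_Cinv.
  apply continuous_Cpow, circle_continuous. now apply Cpow_nz, circle_nz. }
split.
- exists (4 * PI * M). intros n.
  assert (P : 0 < r ^ n) by now apply pow_lt.
  assert (B : Cmod (cauchy_coef r phi n) <= 4 * PI * (M * / r ^ n)).
  { apply CI_bound; [apply Cn|]. intros t Ht.
    rewrite Cmod_mult, Cmod_inv, Cmod_pow, circle_mod by (auto using Cpow_nz, circle_nz).
    apply Rmult_le_compat_r; auto. left; now apply Rinv_0_lt_compat. }
  apply Rle_trans with (4 * PI * (M * / r ^ n) * r ^ n).
  apply Rmult_le_compat_r; lra. right; field; lra.
- intros w Hw. pose proof (Cmod_ge_0 w) as W0.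
  set (K := fun t => (RtoC r * cis t / (RtoC r * cis t - w))%C).
  assert (CK : ccontR K).
  { intros t. apply continuous_Cmult; [apply circle_continuous|]. apply continuous_Cinv.
    apply continuous_Cplus; [apply circle_continuous | apply (continuous_const (U := R_UniformSpace) (V := C_UniformSpace))].
    now apply circle_sub_nz. }
  (* The remainder of the geometric expansion after n terms, with the factor w^n taken out. *)
  set (rem := fun n t => (phi t * / (RtoC r * cis t) ^ n * K t)%C).
  assert (CR : forall n, ccontR (rem n)).
  { intros n t. apply continuous_Cmult; [apply Cn | apply CK]. }
  assert (Hn : forall n, CI (rem O) = (sum_n (fun k => cauchy_coef r phi k * w ^ k) n + w ^ S n * CI (rem (S n)))%C).
  { assert (St : forall n, (w ^ n * CI (rem n))%C = (cauchy_coef r phi n * w ^ n + w ^ S n * CI (rem (S n)))%C).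
    { intros n. unfold cauchy_coef. rewrite (Cmult_comm (CI _)), <- !CI_scal by auto.
      rewrite <- CI_plus.
      - apply CI_ext. intros t. unfold rem, K. simpl Cpow.
        assert (Z1 := circle_nz r t Hr). assert (Z2 := circle_sub_nz r t w Hw).
        assert (Z3 := Cpow_nz _ n Z1).
        set (z := (RtoC r * cis t)%C) in *. clearbody z. field. auto.
      - intros t. apply continuous_Cmult; [apply continuous_const | apply Cn].
      - intros t. apply continuous_Cmult; [apply continuous_const | apply CR]. }
    induction n as [|n IH].
    - rewrite sum_O. rewrite <- St. simpl. ring.
    - rewrite sum_Sn, IH, St. change plus with Cplus. ring. }
  transitivity (CI (rem O)).
  2:{ apply CI_ext. intros t. unfold rem. fold (K t). change ((RtoC r * cis t) ^ 0)%C with (RtoC 1).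
    set (k := K t). clearbody k. field. }
  apply CSeries_unique.
  set (q := Cmod w / r).
  assert (Hq : 0 <= q < 1).
  { split. apply Rmult_le_pos; auto. left; now apply Rinv_0_lt_compat.
    unfold q. apply Rlt_div_l; lra. }
  apply (is_series_geom_error _ _ (4 * PI * (M * (r / (r - Cmod w)))) q Hq).
  intros n. rewrite (Hn n).
  match goal with |- Cmod ?x <= _ => replace x with (- (w ^ S n * CI (rem (S n))))%C end.
  2:{ ring. }
  rewrite Cmod_opp, Cmod_mult, Cmod_pow.
  assert (B : Cmod (CI (rem (S n))) <= 4 * PI * (M * / r ^ S n * (r / (r - Cmod w)))).
  { apply CI_bound; [apply CR|]. intros t Ht. unfold rem, K.
    rewrite !Cmod_mult, Cmod_div, Cmod_inv, Cmod_pow, circle_mod by (auto using Cpow_nz, circle_nz, circle_sub_nz).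
    assert (0 < r ^ S n) by now apply pow_lt.
    apply Rmult_le_compat.
    - apply Rmult_le_pos. apply Cmod_ge_0. left; now apply Rinv_0_lt_compat.
    - left. apply Rdiv_lt_0_compat; auto. apply Cmod_gt_0. now apply circle_sub_nz.
    - apply Rmult_le_compat_r; auto. left; now apply Rinv_0_lt_compat.
    - apply Rmult_le_compat_l; [lra|]. apply Rinv_le_contravar; [lra|]. now apply circle_sub. }
  assert (P : 0 < r ^ S n) by now apply pow_lt.
  apply Rle_trans with (Cmod w ^ S n * (4 * PI * (M * / r ^ S n * (r / (r - Cmod w))))).
  apply Rmult_le_compat_l; auto. now apply pow_le.
  replace (Cmod w ^ S n * (4 * PI * (M * / r ^ S n * (r / (r - Cmod w))))) with
     (4 * PI * (M * (r / (r - Cmod w))) * q ^ S n).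
  2:{ unfold q, Rdiv. rewrite Rpow_mult_distr, pow_inv. field. split; lra. }
  apply Rmult_le_compat_l.
  { apply Rmult_le_pos. generalize PI_RGT_0; lra. apply Rmult_le_pos; auto.
    left; apply Rdiv_lt_0_compat; lra. }
  simpl. assert (0 <= q ^ n) by (apply pow_le; lra). nra.
Qed.

(** * Cauchy's formula *)

Lemma rderiv_ext (f g : R -> C) t l : (forall u, f u = g u) -> rderiv f t l -> rderiv g t l.
Proof.
intros H [H1 H2]. split.
- eapply is_derive_ext; [|exact H1]. intros u; simpl; now rewrite H.
- eapply is_derive_ext; [|exact H2]. intros u; simpl; now rewrite H.
Qed.

Lemma rderiv_eq (f : R -> C) t l m : rderiv f t l -> l = m -> rderiv f t m.
Proof. now intros H <-. Qed.

Lemma rderiv_zero_const (f : R -> C) a b : a <= b ->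
  (forall t, a < t < b -> rderiv f t 0) ->
  (forall t, a <= t <= b -> continuous (U := C_UniformSpace) f t) -> f b = f a.
Proof.
intros Hab H Hc.
assert (E : forall g : R -> R, (forall t, a < t < b -> is_derive g t 0) ->
  (forall t, a <= t <= b -> continuous g t) -> g b = g a).
{ intros g G1 G2. destruct (MVT_gen g a b (fun _ => 0)) as [c [_ Hc2]].
  - intros x. rewrite Rmin_left, Rmax_right by auto. apply G1.
  - intros x. rewrite Rmin_left, Rmax_right by auto. intros Hx. apply continuity_pt_filterlim. now apply G2.
  - lra. }
apply injective_projections.
- apply (E (fun t => Re (f t))). intros t Ht; apply (H t Ht).
  intros t Ht. specialize (Hc t Ht). apply continuous_Re_Im in Hc. apply Hc.
- apply (E (fun t => Im (f t))). intros t Ht; apply (H t Ht).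
  intros t Ht. specialize (Hc t Ht). apply continuous_Re_Im in Hc. apply Hc.
Qed.

Lemma rderiv_CI (F F' : R -> R -> C) (s : R) (d : posreal) :
  (forall u t, Rabs (u - s) < d -> rderiv (fun u => F u t) u (F' u t)) ->
  (forall t, continuous (U := C_UniformSpace) (fun p : R * R => F' (fst p) (snd p)) (s, t)) ->
  (forall u, Rabs (u - s) < d -> ccontR (F u)) ->
  rderiv (fun u => CI (F u)) s (CI (F' s)).
Proof.
intros H1 H2 H3.
(* Real and imaginary part are differentiated under the integral at once, as a projection [p]
   compatible with derivatives and continuity. *)
assert (E : forall (p : C -> R) (pr : forall (f : R -> C) t l, rderiv f t l -> is_derive (fun u => p (f u)) t (p l))
  (pc : forall (T : UniformSpace) (f : T -> C) x, continuous (U := C_UniformSpace) f x -> continuous (fun u : T => p (f u)) x),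
  is_derive (fun u => RInt (fun t => p (F u t)) 0 (2 * PI)) s (RInt (fun t => p (F' s t)) 0 (2 * PI))).
{ intros p pr pc.
  assert (HD : forall u t, Rabs (u - s) < d -> Derive (fun z => p (F z t)) u = p (F' u t)).
  { intros u t Hu. apply is_derive_unique. apply (pr (fun z => F z t)). now apply H1. }
  rewrite (RInt_ext (fun t => p (F' s t)) (fun t => Derive (fun u => p (F u t)) s)).
  2:{ intros t _. symmetry. apply HD. rewrite Rminus_diag, Rabs_R0. apply cond_pos. }
  apply (is_derive_RInt_param (fun u t => p (F u t)) 0 (2 * PI) s).
  - exists d. intros u Hu t _. eexists. apply (pr (fun z => F z t)). apply H1. exact Hu.
  - intros t _.
    apply (continuity_2d_pt_ext_loc (fun u v => p (F' u v))).
    + exists d. intros u v Hu Hv. symmetry. now apply HD.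
    + apply continuity_2d_pt_filterlim.
      apply (pc _ (fun q : R * R => F' (fst q) (snd q))). apply H2.
  - exists d. intros u Hu. apply (ex_RInt_continuous (V := R_CompleteNormedModule)).
    intros t _. apply (pc R_UniformSpace (F u)). now apply H3. }
split.
- apply (E Re). intros f t l H; apply H. intros T f x Hc. apply continuous_Re_Im in Hc. apply Hc.
- apply (E Im). intros f t l H; apply H. intros T f x Hc. apply continuous_Re_Im in Hc. apply Hc.
Qed.

(* Contracting the circle to [z] keeps the integral of [f] against the Cauchy
   kernel constant: the derivative of the integrand along the contraction is
   a derivative in the angle. *)
Lemma cauchy_contraction (f f' : C -> C) (z0 z : C) (r R0 : R) :
  0 < r < R0 -> Cmod (z - z0) < r ->
  (forall y, Cmod (y - z0) < R0 -> cderiv f y (f' y) /\ ccont f' y) ->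
  CI (fun t => f (z0 + RtoC r * cis t) * (RtoC r * cis t / (RtoC r * cis t - (z - z0))))%C =
  CI (fun t => f z * (RtoC r * cis t / (RtoC r * cis t - (z - z0))))%C.
Proof.
intros Hr Hz Hf. pose proof (Cmod_ge_0 (z - z0)) as W0.
set (w := (z - z0)%C) in *.
set (P := fun s t => (z + RtoC s * (RtoC r * cis t - w))%C).
set (K := fun t => (RtoC r * cis t / (RtoC r * cis t - w))%C).
(* The margin keeps the contracted circle inside the domain for s slightly outside [0, 1], so that
   derivatives in s are two-sided at both ends; r (1 + 2 del) = R0. *)
set (del := (R0 - r) / (2 * r)).
assert (Hdel : 0 < del) by (apply Rdiv_lt_0_compat; lra).
assert (Hdel2 : 2 * (r * del) = R0 - r) by (unfold del; field; lra).
assert (HP : forall s t, - del < s < 1 + del -> Cmod (P s t - z0) < R0).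
{ intros s t Hs. replace (P s t - z0)%C with (RtoC (1 - s) * w + RtoC s * (RtoC r * cis t))%C.
  2:{ unfold P, w. rewrite RtoC_minus. ring. }
  eapply Rle_lt_trans; [apply Cmod_triangle|].
  rewrite !Cmod_mult, !Cmod_R, Cmod_cis, (Rabs_pos_eq r), Rmult_1_r by lra.
  unfold Rabs; destruct (Rcase_abs (1 - s)), (Rcase_abs s); nra. }
assert (HK : ccontR K).
{ intros t. apply continuous_Cmult; [apply circle_continuous|]. apply continuous_Cinv.
  apply continuous_Cplus; [apply circle_continuous | apply (continuous_const (U := R_UniformSpace) (V := C_UniformSpace))].
  now apply circle_sub_nz. }
set (F := fun s t => (f (P s t) * K t)%C).
set (F' := fun s t => (f' (P s t) * (RtoC r * cis t))%C).
assert (D1 : forall s t, - del < s < 1 + del -> rderiv (fun u => F u t) s (F' s t)).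
{ intros s t Hs. unfold F.
  eapply rderiv_eq.
  - apply (rderiv_ext (fun u => 0 + K t * f (P u t))%C); [intros u; ring|].
    apply (rderiv_affine 0 (K t)). apply (cderiv_rderiv f (fun u => P u t)).
    apply Hf, HP, Hs. unfold P.
    apply (rderiv_ext (fun u => z + (RtoC r * cis t - w) * RtoC u)%C); [intros u; ring|].
    apply rderiv_line.
  - unfold F', K. field. now apply circle_sub_nz. }
assert (Cont : forall (T : UniformSpace) (x : T) (a b : T -> R), continuous a x -> continuous b x ->
   continuous (U := C_UniformSpace) (fun y => P (a y) (b y)) x).
{ intros T x a b Ha Hb. unfold P.
  apply continuous_Cplus; [apply continuous_const|]. apply continuous_Cmult; [now apply continuous_RtoC|].
  apply continuous_Cplus; [|apply continuous_const].
  apply continuous_Cmult; [apply continuous_const|].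
  apply (continuous_comp b cis); auto. apply cis_continuous. }
assert (D2 : forall s, 0 <= s <= 1 -> rderiv (fun u => CI (F u)) s (CI (F' s))).
{ intros s Hs. apply (rderiv_CI F F' s (mkposreal _ Hdel)); simpl.
  - intros u t Hu. apply D1. apply Rabs_def2 in Hu. lra.
  - intros t. apply continuous_Cmult.
    + apply (continuous_ccont_comp f').
      apply (Cont (prod_UniformSpace R_UniformSpace R_UniformSpace)). apply continuous_fst. apply continuous_snd.
      apply Hf, HP. simpl; lra.
    + apply continuous_Cmult; [apply continuous_const|].
      apply (continuous_comp (U := prod_UniformSpace R_UniformSpace R_UniformSpace) (fun p : R * R => snd p) cis).
      apply continuous_snd. apply cis_continuous.
  - intros u Hu t. apply Rabs_def2 in Hu. apply continuous_Cmult; [|apply HK].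
    apply (continuous_ccont_comp f (fun t => P u t)). 
    apply (Cont R_UniformSpace t (fun _ => u) (fun t => t)). apply continuous_const. apply continuous_id.
    eapply cderiv_ccont. apply Hf, HP. lra. }
(* The derivative in s equals 1 / (i s) times the angular derivative of f (P s t), which is periodic
   in t. The end s = 0 is reached by continuity. *)
assert (Z : forall s, 0 < s < 1 -> CI (F' s) = 0).
{ intros s Hs. assert (Hs0 : RtoC s <> 0) by (intros E; apply RtoC_inj in E; lra).
  apply (CI_derive (fun t => 0 + / (RtoC s * Ci) * f (P s t))%C).
  - intros t. eapply rderiv_eq.
    + apply rderiv_affine. apply (cderiv_rderiv f (fun u => P s u)). apply Hf, HP. lra.
      apply (rderiv_ext (fun u => (z - RtoC s * w) + (RtoC s * RtoC r) * cis u)%C).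
      intros u; unfold P; ring. apply rderiv_affine, cis_rderiv.
    + unfold F'. field. split; auto. apply Ci_nz.
  - intros t. apply continuous_Cmult; [|apply circle_continuous].
    apply (continuous_ccont_comp f' (fun t => P s t)).
    apply (Cont R_UniformSpace t (fun _ => s) (fun t => t)). apply continuous_const. apply continuous_id.
    apply Hf, HP. lra.
  - unfold P. now rewrite cis_2PI. }
transitivity (CI (F 1)).
{ apply CI_ext. intros t. unfold F, K, P. do 2 f_equal. unfold w. ring. }
rewrite (rderiv_zero_const (fun u => CI (F u)) 0 1); [|lra| |].
- apply CI_ext. intros t. unfold F, K, P. do 2 f_equal. ring.
- intros t Ht. rewrite <- (Z t Ht). apply D2. lra.
- intros t Ht. eapply rderiv_continuous. apply D2, Ht.
Qed.

(** Cauchy's series for the constant 1: the higher coefficients vanish because z^(-n), n >= 1, is a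
    constant multiple of its own angular derivative. *)
Lemma cauchy_kernel_integral (r : R) (w : C) : Cmod w < r ->
  CI (fun t => 1 * (RtoC r * cis t / (RtoC r * cis t - w)))%C = RtoC (2 * PI).
Proof.
intros Hw. assert (Hr : 0 < r) by (generalize (Cmod_ge_0 w); lra).
assert (C1 : ccontR (fun _ => RtoC 1)).
{ intros t. apply (continuous_const (U := R_UniformSpace) (V := C_UniformSpace)). }
destruct (cauchy_series (fun _ => RtoC 1) r Hr C1) as [Ha Hb].
rewrite <- (Hb w Hw). unfold PS. rewrite CSeries_shift by now apply cradius_summable with r.
rewrite CSeries_0.
- unfold cauchy_coef. rewrite (CI_ext _ (fun _ => RtoC 1)). rewrite CI_const. simpl. ring.
  intros t. simpl. field.
- intros n. replace (cauchy_coef r (fun _ => RtoC 1) (S n)) with (RtoC 0). ring.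
  symmetry. unfold cauchy_coef.
  set (g := fun t => (/ (RtoC r * cis t) ^ S n)%C).
  set (c := (- (INR (S n) * Ci))%C).
  assert (Hc : c <> 0).
  { unfold c. intros E. assert (E2 : (INR (S n) * Ci)%C = 0) by (rewrite <- (Cmult_1_l (INR (S n) * Ci)); transitivity ((- (1)) * 0)%C; [rewrite <- E|]; ring).
    revert E2. apply Cmult_neq_0; [|apply Ci_nz]. intros E2. apply RtoC_inj in E2. generalize (lt_0_INR (S n)). intros Q. lapply Q; [lra | lia]. }
  assert (Dg : forall t, rderiv g t (c * g t)).
  { intros t. eapply rderiv_eq.
    - apply (rderiv_ext (fun t => / (0 + RtoC r * cis t) ^ S n)%C).
      { intros u. unfold g. now rewrite Cplus_0_l. }
      apply (cderiv_rderiv (fun y => / y ^ S n)%C (fun t => 0 + RtoC r * cis t)%C).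
      apply cderiv_inv. apply cderiv_pow, cderiv_id. apply Cpow_nz. rewrite Cplus_0_l. now apply circle_nz.
      apply rderiv_affine, cis_rderiv.
    - unfold g, c. rewrite Cplus_0_l. simpl pred. simpl Cpow.
      assert (Z1 := circle_nz r t Hr). assert (Z3 := Cpow_nz _ n Z1).
      replace (RtoC r * (Ci * cis t))%C with (Ci * (RtoC r * cis t))%C by ring.
      set (y := (RtoC r * cis t)%C) in *. clearbody y. field. auto. }
  rewrite (CI_ext _ (fun t => / c * (c * g t))%C).
  2:{ intros t. unfold g. field. split; auto. apply Cpow_nz. now apply circle_nz. }
  assert (Cg : ccontR (fun t => c * g t)%C).
  { intros t. apply continuous_Cmult. apply (continuous_const (U := R_UniformSpace) (V := C_UniformSpace)).
    eapply rderiv_continuous, Dg. }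
  rewrite CI_scal by exact Cg. rewrite (CI_derive g) by (auto; unfold g; now rewrite cis_2PI). ring.
Qed.

(** Contracting the circle of radius R0 / 2 reduces the Cauchy integral of f to f z times that of
    the constant 1. Continuity of the derivative is what differentiation under the integral uses. *)
Theorem holomorphic_analytic (f f' : C -> C) (z0 : C) (R0 : R) : 0 < R0 ->
  (forall y, Cmod (y - z0) < R0 -> cderiv f y (f' y) /\ ccont f' y) -> analytic_at f z0.
Proof.
intros HR Hf. set (r := R0 / 2). assert (Hr : 0 < r < R0) by (unfold r; lra).
set (phi := fun t => f (z0 + RtoC r * cis t)%C).
assert (Cphi : ccontR phi).
{ intros t. apply (continuous_ccont_comp f (fun t => z0 + RtoC r * cis t)%C).
  apply continuous_Cplus; [apply (continuous_const (U := R_UniformSpace) (V := C_UniformSpace)) | apply circle_continuous].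
  eapply cderiv_ccont, Hf. replace (z0 + RtoC r * cis t - z0)%C with (RtoC r * cis t)%C by ring.
  rewrite circle_mod; lra. }
destruct (cauchy_series phi r (proj1 Hr) Cphi) as [[M Ha] Hb].
assert (P2 : RtoC (2 * PI) <> 0) by (intros E; apply RtoC_inj in E; generalize PI_RGT_0; lra).
apply analytic_at_PS. exists (fun n => / RtoC (2 * PI) * cauchy_coef r phi n)%C, r.
split; [lra|]. split.
- exists (Cmod (/ RtoC (2 * PI)) * M). intros k. rewrite Cmod_mult, Rmult_assoc.
  apply Rmult_le_compat_l; [apply Cmod_ge_0 | apply Ha].
- intros z Hz. unfold PS.
  rewrite (CSeries_ext _ (fun k => / RtoC (2 * PI) * (cauchy_coef r phi k * (z - z0) ^ k))%C) by (intros; ring).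
  rewrite CSeries_scal by (apply cradius_summable with r; auto; now exists M).
  fold (PS (cauchy_coef r phi) (z - z0)). rewrite Hb by auto.
  unfold phi. rewrite (cauchy_contraction f f' z0 z r R0 Hr Hz Hf).
  rewrite (CI_ext _ (fun t => f z * (1 * (RtoC r * cis t / (RtoC r * cis t - (z - z0)))))%C).
  2:{ intros t. now rewrite Cmult_1_l. }
  rewrite CI_scal.
  + rewrite cauchy_kernel_integral by auto. field. auto.
  + intros t. apply continuous_Cmult. apply (continuous_const (U := R_UniformSpace) (V := C_UniformSpace)).
    apply continuous_Cmult; [apply circle_continuous|]. apply continuous_Cinv.
    apply continuous_Cplus; [apply circle_continuous | apply (continuous_const (U := R_UniformSpace) (V := C_UniformSpace))].
    now apply circle_sub_nz.
Qed.

(** * Analytic and meromorphic germs *)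

Lemma cderiv_shift f z z0 l : cderiv f (z - z0) l -> cderiv (fun y => f (y - z0)%C) z l.
Proof.
intros H. eapply cderiv_eq. apply (cderiv_comp f (fun y => y - z0)%C). exact H.
apply cderiv_minus. apply cderiv_id. apply cderiv_const. ring.
Qed.

Lemma analytic_PS_derive f z0 a r : 0 < r -> cradius a r ->
  (forall z, Cmod (z - z0) < r -> f z = PS a (z - z0)) ->
  forall z, Cmod (z - z0) < r -> cderiv f z (PS (PS_d a) (z - z0)).
Proof.
intros Hr Ha H z Hz. apply cderiv_ext_loc with (fun y => PS a (y - z0)%C).
- generalize (locally_open_ball z0 z r Hz). apply locally_imp. intros y Hy. symmetry. now apply H.
- apply cderiv_shift. now apply PS_cderiv with r.
Qed.

Lemma analytic_derive f z0 : analytic_at f z0 -> analytic_at (C_derive f) z0.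
Proof.
intros H. apply analytic_at_PS in H. destruct H as [a [r [Hr [Ha H]]]].
apply analytic_at_PS. exists (PS_d a), (r / 2). split; [lra|]. split.
- apply cradius_d with r; auto. lra.
- intros z Hz. apply C_derive_unique. apply analytic_PS_derive with r; auto. lra.
Qed.

Lemma analytic_cderiv f z0 : analytic_at f z0 -> cderiv f z0 (C_derive f z0).
Proof.
intros H. apply analytic_at_PS in H. destruct H as [a [r [Hr [Ha H]]]].
assert (D := analytic_PS_derive f z0 a r Hr Ha H z0 ltac:(now rewrite Cmod_sub_0)).
now rewrite (C_derive_unique _ _ _ D).
Qed.

Lemma analytic_ccont f z0 : analytic_at f z0 -> ccont f z0.
Proof. intros H. eapply cderiv_ccont, analytic_cderiv, H. Qed.

(** Through this criterion every closure property of analytic functions below becomes a rule of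
    differentiation; no products or compositions of power series are formed. *)
Lemma analytic_intro f f' z0 :
  locally z0 (fun y => cderiv f y (f' y) /\ ccont f' y) -> analytic_at f z0.
Proof.
intros H. apply locally_Cmod in H. destruct H as [r [Hr H]].
now apply (holomorphic_analytic f f' z0 r).
Qed.

(** The series is not re-expanded at nearby points: the function is continuously differentiable on
    the disc, and Cauchy's formula applies at each of them. *)
Lemma analytic_locally f z0 : analytic_at f z0 -> locally z0 (analytic_at f).
Proof.
intros H. pose proof (analytic_derive _ _ H) as H'.
apply analytic_at_PS in H. destruct H as [a [r [Hr [Ha H]]]].
apply analytic_at_PS in H'. destruct H' as [b [r' [Hr' [Hb H']]]].
assert (L : forall z, Cmod (z - z0) < Rmin r r' -> cderiv f z (C_derive f z) /\ ccont (C_derive f) z).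
{ intros z Hz. assert (H1 : Cmod (z - z0) < r) by (eapply Rlt_le_trans; [exact Hz | apply Rmin_l]).
  assert (H2 : Cmod (z - z0) < r') by (eapply Rlt_le_trans; [exact Hz | apply Rmin_r]).
  assert (D := analytic_PS_derive f z0 a r Hr Ha H z H1).
  split. now rewrite (C_derive_unique _ _ _ D).
  eapply cderiv_ccont. now apply (analytic_PS_derive (C_derive f) z0 b r' Hr' Hb H'). }
apply locally_Cmod. exists (Rmin r r'). split; [now apply Rmin_pos|].
intros z Hz. apply analytic_intro with (C_derive f).
generalize (locally_open_ball z0 z _ Hz). apply locally_imp. exact L.
Qed.

Lemma analytic_ext_loc f g z0 : locally z0 (fun y => f y = g y) -> analytic_at f z0 -> analytic_at g z0.
Proof.
intros E [a H]. exists a. generalize (locally_and _ _ _ E H). apply locally_imp. now intros y [<- K].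
Qed.

Lemma analytic_const c z0 : analytic_at (fun _ => c) z0.
Proof.
apply analytic_intro with (fun _ => RtoC 0). apply locally_all. intros y.
split. apply cderiv_const. apply ccont_const.
Qed.

Lemma analytic_id z0 : analytic_at (fun y => y) z0.
Proof.
apply analytic_intro with (fun _ => RtoC 1). apply locally_all. intros y.
split. apply cderiv_id. apply ccont_const.
Qed.

Lemma analytic_plus f g z0 : analytic_at f z0 -> analytic_at g z0 -> analytic_at (fun y => f y + g y)%C z0.
Proof.
intros F G. apply analytic_intro with (fun y => C_derive f y + C_derive g y)%C.
generalize (locally_and _ _ _ (analytic_locally _ _ F) (analytic_locally _ _ G)). apply locally_imp.
intros y [F1 G1]. split. apply cderiv_plus; now apply analytic_cderiv.
apply ccont_plus; now apply analytic_ccont, analytic_derive.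
Qed.

Lemma analytic_mult f g z0 : analytic_at f z0 -> analytic_at g z0 -> analytic_at (fun y => f y * g y)%C z0.
Proof.
intros F G. apply analytic_intro with (fun y => C_derive f y * g y + f y * C_derive g y)%C.
generalize (locally_and _ _ _ (analytic_locally _ _ F) (analytic_locally _ _ G)). apply locally_imp.
intros y [F1 G1]. split. apply cderiv_mult; now apply analytic_cderiv.
apply ccont_plus; apply ccont_mult; auto using analytic_ccont, analytic_derive.
Qed.

Lemma analytic_opp f z0 : analytic_at f z0 -> analytic_at (fun y => - f y)%C z0.
Proof.
intros F. apply analytic_ext_loc with (fun y => (- (1)) * f y)%C. apply locally_all; intros; ring.
apply analytic_mult; auto. apply analytic_const.
Qed.

Lemma analytic_minus f g z0 : analytic_at f z0 -> analytic_at g z0 -> analytic_at (fun y => f y - g y)%C z0.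
Proof. intros F G. apply (analytic_plus f (fun y => - g y)%C); auto. now apply analytic_opp. Qed.

Lemma analytic_inv f z0 : analytic_at f z0 -> f z0 <> 0 -> analytic_at (fun y => / f y)%C z0.
Proof.
intros F N. apply analytic_intro with (fun y => - C_derive f y * / (f y * f y))%C.
generalize (locally_and _ _ _ (analytic_locally _ _ F) (ccont_nz _ _ (analytic_ccont _ _ F) N)). apply locally_imp.
intros y [F1 G1]. split. apply cderiv_inv; auto. now apply analytic_cderiv.
pose proof (analytic_ccont _ _ F1).
apply ccont_mult. now apply ccont_opp, analytic_ccont, analytic_derive.
apply (ccont_inv (fun y => f y * f y)%C). now apply ccont_mult. now apply Cmult_neq_0.
Qed.

Lemma analytic_div f g z0 : analytic_at f z0 -> analytic_at g z0 -> g z0 <> 0 -> analytic_at (fun y => f y / g y)%C z0.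
Proof. intros F G N. apply (analytic_mult f (fun y => / g y)%C); auto. now apply analytic_inv. Qed.

Lemma analytic_comp f g z0 : analytic_at f (g z0) -> analytic_at g z0 -> analytic_at (fun y => f (g y)) z0.
Proof.
intros F G. apply analytic_intro with (fun y => C_derive f (g y) * C_derive g y)%C.
assert (L : locally z0 (fun y => analytic_at f (g y))).
{ destruct (proj1 (locally_Cmod _ _) (analytic_locally _ _ F)) as [r [Hr Q]].
  generalize (analytic_ccont _ _ G r Hr). apply locally_imp. intros y; apply Q. }
generalize (locally_and _ _ _ L (analytic_locally _ _ G)). apply locally_imp.
intros y [F1 G1]. split. apply cderiv_comp; now apply analytic_cderiv.
apply ccont_mult. apply ccont_comp. now apply analytic_ccont, analytic_derive. now apply analytic_ccont.
now apply analytic_ccont, analytic_derive.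
Qed.

Lemma analytic_pow f z0 n : analytic_at f z0 -> analytic_at (fun y => f y ^ n)%C z0.
Proof.
intros F. induction n as [|n IH]; simpl. apply analytic_const. now apply analytic_mult.
Qed.

Lemma cradius_shift_n a r n : 0 < r -> cradius a r -> cradius (fun k => a (n + k)%nat) r.
Proof.
intros Hr H. induction n as [|n IH]; auto.
destruct (cradius_shift _ _ Hr IH) as [M HM]. exists M. intros k.
specialize (HM k). now rewrite Nat.add_succ_r in HM.
Qed.

Lemma PS_factor a r n z : Cmod z < r -> cradius a r -> (forall k, (k < n)%nat -> a k = 0) ->
  PS a z = (z ^ n * PS (fun k => a (n + k)%nat) z)%C.
Proof.
intros Hz Ha. assert (Hr : 0 < r) by (generalize (Cmod_ge_0 z); lra).
induction n as [|n IH]; intros H0. simpl. rewrite Cmult_1_l. reflexivity.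
rewrite IH by (intros; apply H0; lia). simpl Cpow. rewrite (Cmult_comm z), <- Cmult_assoc. f_equal.
unfold PS at 1. rewrite CSeries_shift.
- rewrite Nat.add_0_r, H0 by lia. rewrite Cmult_0_l, Cplus_0_l. unfold PS.
  rewrite <- CSeries_scal. apply CSeries_ext. intros k. rewrite Nat.add_succ_r. simpl. ring.
  apply (cradius_summable (fun k => a (S n + k)%nat) r); auto. now apply (cradius_shift_n a r (S n)).
- apply (cradius_summable (fun k => a (n + k)%nat) r); auto. now apply cradius_shift_n.
Qed.

Lemma analytic_factor g z0 : analytic_at g z0 ->
  locally z0 (fun z => g z = 0) \/
  exists n h, analytic_at h z0 /\ h z0 <> 0 /\ locally z0 (fun z => g z = (z - z0) ^ n * h z)%C.
Proof.
intros H. apply analytic_at_PS in H. destruct H as [a [r [Hr [Ha H]]]].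
destruct (classic (forall k, a k = 0)) as [Z|N].
- left. apply locally_Cmod. exists r. split; auto. intros y Hy. rewrite H by auto.
  unfold PS. apply CSeries_0. intros k. rewrite Z. ring.
- right. assert (E : exists n, a n <> 0 /\ forall k, (k < n)%nat -> a k = 0).
  { apply not_all_ex_not in N. destruct N as [m Hm]. revert Hm.
    induction m as [m IH] using lt_wf_ind. intros Hm.
    destruct (classic (exists k, (k < m)%nat /\ a k <> 0)) as [[k [K1 K2]]|N]. now apply (IH k).
    exists m. split; auto. intros k Hk. apply NNPP. intros C. apply N. now exists k. }
  destruct E as [n [E1 E2]]. exists n, (fun z => PS (fun k => a (n + k)%nat) (z - z0)%C).
  split; [|split].
  + apply analytic_at_PS. exists (fun k => a (n + k)%nat), r. split; auto. split; auto. now apply cradius_shift_n.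
  + replace (z0 - z0)%C with (RtoC 0) by ring. rewrite PS_0. now rewrite Nat.add_0_r.
  + apply locally_Cmod. exists r. split; auto. intros y Hy. rewrite H by auto.
    now apply PS_factor with r.
Qed.

Lemma locally'_of_locally (z : C) (P : C -> Prop) : locally z P -> locally' z P.
Proof. intros H. unfold locally', within. revert H. apply locally_imp. auto. Qed.

Lemma locally'_imp (z : C) (P Q : C -> Prop) :
  (forall y : C, y <> z -> P y -> Q y) -> locally' z P -> locally' z Q.
Proof. intros H. unfold locally', within. apply locally_imp. auto. Qed.

Lemma locally'_and (z : C) (P Q : C -> Prop) :
  locally' z P -> locally' z Q -> locally' z (fun y => P y /\ Q y).
Proof.
intros H1 H2. unfold locally', within in *. generalize (locally_and _ _ _ H1 H2).
apply locally_imp. tauto.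
Qed.

Lemma locally'_False (z : C) : ~ locally' z (fun _ => False).
Proof.
intros H. apply locally'_Cmod in H. destruct H as [r [Hr H]].
apply (H (z + RtoC (r / 2))%C).
- intros E. assert (E2 : RtoC (r / 2) = 0).
  { transitivity (z + RtoC (r / 2) - z)%C; [ring|]. rewrite E. ring. }
  apply RtoC_inj in E2. lra.
- replace (z + RtoC (r / 2) - z)%C with (RtoC (r / 2)) by ring. rewrite Cmod_R, Rabs_pos_eq; lra.
Qed.

Lemma locally'_open (z : C) (P : C -> Prop) : locally' z P -> locally z (fun y => locally' y P).
Proof.
intros H. apply locally'_Cmod in H. destruct H as [r [Hr H]].
apply locally_Cmod. exists r. split; auto. intros y Hy.
apply locally'_Cmod.
destruct (Ceq_dec y z) as [->|N]. exists r; split; auto.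
exists (Rmin (r - Cmod (y - z)) (Cmod (y - z))). split.
apply Rmin_pos. lra. now apply Cmod_sub_pos.
intros x Hx Hd. assert (H1 := Rmin_l (r - Cmod (y - z)) (Cmod (y - z))).
assert (H2 := Rmin_r (r - Cmod (y - z)) (Cmod (y - z))).
apply H.
- intros ->. rewrite Cmod_sub_sym in Hd. lra.
- generalize (Cmod_tri_sub x y z). lra.
Qed.

Lemma analytic_dichotomy g z0 : analytic_at g z0 ->
  locally z0 (fun z => g z = 0) \/ locally' z0 (fun z => g z <> 0).
Proof.
intros H. destruct (analytic_factor g z0 H) as [Z|[n [h [Ha [Hn E]]]]]; auto. right.
generalize (locally_and _ _ _ E (ccont_nz _ _ (analytic_ccont _ _ Ha) Hn)).
unfold locally', within. apply locally_imp. intros y [-> Hy] N.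
apply Cmult_neq_0; auto. apply Cpow_nz. now apply Cminus_eq_contra.
Qed.

Lemma germ_eq_refl z f : germ_eq z f f.
Proof. unfold germ_eq, locally', within. now apply locally_all. Qed.

Lemma germ_eq_sym z f g : germ_eq z f g -> germ_eq z g f.
Proof. apply locally'_imp. now intros y _ ->. Qed.

Lemma germ_eq_trans z f g h : germ_eq z f g -> germ_eq z g h -> germ_eq z f h.
Proof.
intros H1 H2. generalize (locally'_and _ _ _ H1 H2). apply locally'_imp. now intros y _ [-> ->].
Qed.

Lemma germ_eq_locally z f g : locally z (fun y => f y = g y) -> germ_eq z f g.
Proof. apply locally'_of_locally. Qed.

Lemma germ_eq_open z f g : germ_eq z f g -> locally z (fun y => germ_eq y f g).
Proof. apply locally'_open. Qed.

Lemma meromorphic_analytic f z : analytic_at f z -> meromorphic_at f z.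
Proof.
intros H. exists O, f. split; auto. apply locally'_of_locally, locally_all. intros y. apply Cmult_1_l.
Qed.

Lemma meromorphic_germ f g z : germ_eq z f g -> meromorphic_at f z -> meromorphic_at g z.
Proof.
intros E [n [h [Ha H]]]. exists n, h. split; auto.
generalize (locally'_and _ _ _ E H). apply locally'_imp. now intros y _ [<- K].
Qed.

Lemma meromorphic_dichotomy f z0 : meromorphic_at f z0 ->
  locally' z0 (fun z => f z = 0) \/ locally' z0 (fun z => f z <> 0).
Proof.
intros [n [g [Hg E]]]. destruct (analytic_dichotomy g z0 Hg) as [Z|N].
- left. generalize (locally'_and _ _ _ (locally'_of_locally _ _ Z) E). apply locally'_imp.
  intros y Hy [Z1 E1]. rewrite Z1 in E1. apply NNPP. intros K.
  revert E1. apply Cmult_neq_0; auto. apply Cpow_nz. now apply Cminus_eq_contra.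
- right. generalize (locally'_and _ _ _ N E). apply locally'_imp.
  intros y Hy [N1 E1] K. apply N1. rewrite <- E1, K. ring.
Qed.

Lemma meromorphic_minus f g z0 : meromorphic_at f z0 -> meromorphic_at g z0 ->
  meromorphic_at (fun z => f z - g z)%C z0.
Proof.
intros [n [u [Hu E]]] [m [v [Hv E']]].
exists (n + m)%nat, (fun z => (z - z0) ^ m * u z - (z - z0) ^ n * v z)%C. split.
- apply analytic_minus; apply analytic_mult; auto; apply (analytic_pow (fun z => z - z0)%C);
   apply analytic_minus; auto using analytic_id, analytic_const.
- generalize (locally'_and _ _ _ E E'). apply locally'_imp. intros y _ [<- <-].
  rewrite Cpow_add_r. ring.
Qed.

(** The local form of the identity theorem: near a point, coincidence of two meromorphic functions
    is all or nothing. *)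
Lemma meromorphic_germ_dichotomy f g z0 : meromorphic_at f z0 -> meromorphic_at g z0 ->
  germ_eq z0 f g \/ locally' z0 (fun z => f z <> g z).
Proof.
intros F G. destruct (meromorphic_dichotomy _ _ (meromorphic_minus _ _ _ F G)) as [Z|N].
- left. revert Z. apply locally'_imp. intros y _ Z. now apply Ceq_minus.
- right. revert N. apply locally'_imp. intros y _ N K. apply N. exact (proj1 (Ceq_minus _ _) K).
Qed.

Lemma meromorphic_quotient P Q z0 : analytic_at P z0 -> analytic_at Q z0 ->
  ~ locally z0 (fun z => Q z = 0) -> meromorphic_at (fun z => P z / Q z)%C z0.
Proof.
intros HP HQ N. destruct (analytic_factor Q z0 HQ) as [Z|[n [h [Ha [Hn E]]]]]; [easy|].
exists n, (fun z => P z / h z)%C. split. now apply analytic_div.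
generalize (locally_and _ _ _ E (ccont_nz _ _ (analytic_ccont _ _ Ha) Hn)).
unfold locally', within. apply locally_imp. intros y [-> Hy] K.
assert ((y - z0) ^ n <> 0)%C by now apply Cpow_nz, Cminus_eq_contra. field. auto.
Qed.

Lemma meromorphic_locally f z0 : meromorphic_at f z0 -> locally z0 (meromorphic_at f).
Proof.
intros Hf. pose proof Hf as [n [g [Hg E]]].
generalize (locally_and _ _ _ (analytic_locally _ _ Hg) (locally'_open _ _ E)). apply locally_imp.
intros y [G E'].
destruct (Ceq_dec y z0) as [->|N]; auto.
assert (Npow : locally y (fun z => (z - z0)%C <> 0)).
{ apply (ccont_nz (fun z => z - z0)%C). apply ccont_plus; [apply ccont_id | apply ccont_const].
  now apply Cminus_eq_contra. }
apply meromorphic_germ with (fun z => g z / (z - z0) ^ n)%C.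
- generalize (locally'_and _ _ _ E' (locally'_of_locally _ _ Npow)). apply locally'_imp.
  intros x _ [<- K]. field. now apply Cpow_nz.
- apply meromorphic_analytic, analytic_div; auto.
  apply (analytic_pow (fun z => z - z0)%C). apply analytic_minus; auto using analytic_id, analytic_const.
  now apply Cpow_nz, Cminus_eq_contra.
Qed.

(** * The identity theorem along paths *)

(** Connectedness of the interval: near each time the property passes from any moment to any other,
    so the supremum of the initial segments on which it holds cannot lie before 1. *)
Lemma unit_interval_induction (P : R -> Prop) : P 0 ->
  (forall t, unit_itv t -> exists d, 0 < d /\ forall s s', unit_itv s -> unit_itv s' ->
     Rabs (s - t) < d -> Rabs (s' - t) < d -> P s -> P s') ->
  forall t, unit_itv t -> P t.
Proof.
intros P0 H.
set (E := fun t => unit_itv t /\ forall s, 0 <= s <= t -> P s).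
assert (E0 : E 0). { split. unfold unit_itv; lra. intros s Hs. now replace s with 0 by lra. }
assert (B : bound E). { exists 1. intros x [Hx _]. apply Hx. }
destruct (completeness E B (ex_intro _ 0 E0)) as [m [M1 M2]].
assert (Hm : unit_itv m).
{ split. apply M1, E0. apply M2. intros x [Hx _]. apply Hx. }
destruct (H m Hm) as [d [Hd K]].
assert (X : exists x, E x /\ m - d < x).
{ apply NNPP. intros N. assert (m <= m - d); [|lra]. apply M2. intros x Hx.
  apply Rnot_lt_le. intros L. apply N. now exists x. }
destruct X as [x [Ex Hx]]. assert (Hxm : x <= m) by now apply M1.
assert (Near : forall s, unit_itv s -> Rabs (s - m) < d -> P s).
{ intros s Hs Hd'. apply (K x s); auto. apply Ex. rewrite Rabs_left1; lra.
  apply Ex. destruct Ex as [[? ?] _]. lra. }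
assert (E1 : forall y, unit_itv y -> y < m + d -> E y).
{ intros y Hy Hyd. split; auto. intros s Hs. destruct (Rle_lt_dec s x) as [L|L].
  apply Ex. lra. apply Near. unfold unit_itv in *; lra. apply Rabs_def1; lra. }
intros t Ht. destruct (Rlt_le_dec t (m + d)) as [L|L].
- apply (E1 t Ht L). destruct Ht; lra.
- exfalso. assert (Q : E (Rmin 1 (m + d / 2))).
  { apply E1. unfold unit_itv in *. split. apply Rmin_glb; lra. apply Rmin_l.
    eapply Rle_lt_trans; [apply Rmin_r|]. lra. }
  apply M1 in Q. destruct Ht. rewrite Rmin_right in Q; lra.
Qed.

Definition path_continuous (gamma : R -> C) : Prop :=
  forall t, unit_itv t -> filterlim gamma (within unit_itv (locally t)) (locally (gamma t)).

Lemma path_near gamma t (P : C -> Prop) : path_continuous gamma -> unit_itv t -> locally (gamma t) P ->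
  exists d, 0 < d /\ forall s, unit_itv s -> Rabs (s - t) < d -> P (gamma s).
Proof.
intros H Ht HP. destruct (H t Ht P HP) as [d Hd]. exists d. split; [apply d|].
intros s Hs L. apply Hd; auto.
Qed.

(** Near each point of the path the two functions agree on a punctured disc or nowhere on it;
    agreement at one time therefore spreads to neighbouring times. *)
Lemma identity_path gamma f g : path_continuous gamma ->
  (forall t, unit_itv t -> meromorphic_at f (gamma t) /\ meromorphic_at g (gamma t)) ->
  germ_eq (gamma 0) f g -> forall t, unit_itv t -> germ_eq (gamma t) f g.
Proof.
intros Hg Hm H0. apply unit_interval_induction; auto.
intros t Ht. destruct (Hm t Ht) as [F G].
destruct (meromorphic_germ_dichotomy _ _ _ F G) as [E|N].
- destruct (path_near gamma t _ Hg Ht (germ_eq_open _ _ _ E)) as [d [Hd K]].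
  exists d. split; auto.
- destruct (path_near gamma t _ Hg Ht (locally'_open _ _ N)) as [d [Hd K]].
  exists d. split; auto. intros s s' Hs Hs' L L' Q. exfalso.
  apply (locally'_False (gamma s)). generalize (locally'_and _ _ _ Q (K s Hs L)).
  apply locally'_imp. tauto.
Qed.

Definition segment (a b : C) (t : R) : C := (a + (b - a) * RtoC t)%C.

Lemma segment_continuous a b : path_continuous (segment a b).
Proof.
intros t _. apply filterlim_within_ext with (segment a b). reflexivity.
eapply filterlim_filter_le_1; [apply filter_le_within|].
apply (rderiv_continuous (segment a b) t (b - a)%C). apply rderiv_line.
Qed.

Lemma segment_ends a b : segment a b 0 = a /\ segment a b 1 = b.
Proof. unfold segment. split; ring. Qed.

Lemma identity_segment a b f g :
  (forall t, unit_itv t -> meromorphic_at f (segment a b t) /\ meromorphic_at g (segment a b t)) ->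
  germ_eq a f g -> germ_eq b f g.
Proof.
intros H E. rewrite <- (proj2 (segment_ends a b)).
apply (identity_path (segment a b) f g (segment_continuous a b) H).
now rewrite (proj1 (segment_ends a b)). unfold unit_itv; lra.
Qed.

(** * The hypergeometric equation and continuation through charts *)

Lemma segment_ball c r a b t : Cmod (a - c) < r -> Cmod (b - c) < r -> unit_itv t ->
  Cmod (segment a b t - c) < r.
Proof.
intros Ha Hb [H0 H1]. unfold segment.
replace (a + (b - a) * RtoC t - c)%C with (RtoC (1 - t) * (a - c) + RtoC t * (b - c))%C.
2:{ rewrite RtoC_minus. ring. }
eapply Rle_lt_trans; [apply Cmod_triangle|].
rewrite !Cmod_mult, !Cmod_R, !Rabs_pos_eq by lra.
destruct (Req_dec_T t 0) as [->|N]. lra.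
assert ((1 - t) * Cmod (a - c) <= (1 - t) * r) by (apply Rmult_le_compat_l; lra).
assert (t * Cmod (b - c) < t * r) by (apply Rmult_lt_compat_l; lra). lra.
Qed.

(** The abstract form of monodromy: a continued germ is, at each time, a member of a fixed family
    attached to the current chart. The index [k] lets two functions be continued together, with a
    common [j]: both elements of a basis must undergo the same matrix. *)
Lemma chart_propagation (I J : Type) (U : I -> C -> Prop) (phi : I -> J -> bool -> C -> C)
  (gamma : R -> C) (f : bool -> R -> C -> C) :
  (forall i z, U i z -> locally z (U i)) ->
  (forall i j k z, U i z -> meromorphic_at (phi i j k) z) ->
  (forall i i' j z, U i z -> U i' z -> exists j', forall k, germ_eq z (phi i j k) (phi i' j' k)) ->
  path_continuous gamma ->
  (forall t, unit_itv t -> exists i, U i (gamma t)) ->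
  (forall k, continuation gamma (f k)) ->
  (exists i j, U i (gamma 0) /\ forall k, germ_eq (gamma 0) (f k 0) (phi i j k)) ->
  forall t, unit_itv t ->
    exists i j, U i (gamma t) /\ forall k, germ_eq (gamma t) (f k t) (phi i j k).
Proof.
intros Uopen Mer Trans Hg Cov Cont Init. apply unit_interval_induction; auto.
intros t Ht. destruct (Cov t Ht) as [i Hi].
assert (L : locally (gamma t) (fun z => U i z /\ forall k, meromorphic_at (f k t) z)).
{ generalize (locally_and _ _ _ (Uopen i _ Hi)
    (locally_and _ _ _ (meromorphic_locally _ _ (proj1 (Cont true t Ht)))
                       (meromorphic_locally _ _ (proj1 (Cont false t Ht))))).
  apply locally_imp. intros y [H1 [H2 H3]]. split; auto. intros [|]; auto. }
apply locally_Cmod in L. destruct L as [r [Hr L]].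
destruct (path_near gamma t _ Hg Ht (locally_Cball (gamma t) r Hr)) as [d1 [Hd1 K1]].
destruct (proj2 (Cont true t Ht)) as [d2 K2].
destruct (proj2 (Cont false t Ht)) as [d3 K3].
exists (Rmin d1 (Rmin d2 d3)). split.
{ apply Rmin_pos; auto. apply Rmin_pos; [apply d2 | apply d3]. }
intros s s' Hs Hs' L1 L2 [i0 [j0 [U0 E0]]].
assert (M1 := Rmin_l d1 (Rmin d2 d3)). assert (M2 := Rmin_r d1 (Rmin d2 d3)).
assert (M3 := Rmin_l d2 d3). assert (M4 := Rmin_r d2 d3).
assert (G : forall k x, unit_itv x -> Rabs (x - t) < Rmin d1 (Rmin d2 d3) -> germ_eq (gamma x) (f k x) (f k t)).
{ intros [|] x Hx Lx; [apply K2 | apply K3]; auto; change (Rabs (x - t) < d2) || change (Rabs (x - t) < d3); lra. }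
assert (B : Cmod (gamma s - gamma t) < r) by (apply K1; auto; lra).
assert (B' : Cmod (gamma s' - gamma t) < r) by (apply K1; auto; lra).
(* The change to the chart of [gamma t] is made at [gamma s]. The straight segment to [gamma s']
   stays in a disc inside that chart, and the identity theorem on it finishes the step. *)
destruct (Trans i0 i j0 (gamma s) U0 (proj1 (L _ B))) as [j Hj].
exists i, j. split; [apply L, B'|]. intros k.
apply germ_eq_trans with (f k t). now apply G.
apply identity_segment with (gamma s).
- intros x Hx. destruct (L _ (segment_ball _ _ _ _ _ B B' Hx)). split; auto.
- apply germ_eq_trans with (f k s). apply germ_eq_sym. now apply G.
  apply germ_eq_trans with (phi i0 j0 k); auto.
Qed.

(** * Wronskians and the span of two solutions *)

Definition hyp_ode (w : C -> C) (x : C) : Prop :=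
  (x * (1 - x) * C_derive (C_derive w) x + (1 - 2 * x) * C_derive w x - w x / 4)%C = RtoC 0.

Definition sol_on (U : C -> Prop) (w : C -> C) : Prop :=
  forall x, U x -> analytic_at w x /\ hyp_ode w x.

Definition wron (u v : C -> C) (x : C) : C := (u x * C_derive v x - C_derive u x * v x)%C.

Definition star (c : C) (U : C -> Prop) : Prop :=
  U c /\ forall z, U z -> forall t, unit_itv t -> U (segment c z t).

Lemma cderiv_zero_segment f a b :
  (forall t, unit_itv t -> cderiv f (segment a b t) 0) -> f b = f a.
Proof.
intros H. destruct (segment_ends a b) as [E0 E1]. transitivity (f (segment a b 1)); [now rewrite E1|].
transitivity (f (segment a b 0)); [|now rewrite E0].
apply (rderiv_zero_const (fun t => f (segment a b t)) 0 1). lra.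
- intros t Ht. eapply rderiv_eq. apply cderiv_rderiv. apply H. unfold unit_itv; lra.
  apply rderiv_line. ring.
- intros t Ht. apply (continuous_ccont_comp f (segment a b)).
  eapply rderiv_continuous, rderiv_line. eapply cderiv_ccont, H. exact Ht.
Qed.

(** Abel's identity: the coefficient 1 - 2x of w' is the derivative of the leading coefficient x (1
    - x). *)
Lemma wron_const U c u v : star c U -> sol_on U u -> sol_on U v -> forall z, U z ->
  (z * (1 - z) * wron u v z = c * (1 - c) * wron u v c)%C.
Proof.
intros [Uc S] Hu Hv z Hz.
apply (cderiv_zero_segment (fun z => z * (1 - z) * wron u v z)%C). intros t Ht.
specialize (S z Hz t Ht). set (x := segment c z t) in *. clearbody x.
destruct (Hu x S) as [Au Ou], (Hv x S) as [Av Ov].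
assert (Du := analytic_cderiv _ _ Au). assert (Dv := analytic_cderiv _ _ Av).
assert (DDu := analytic_cderiv _ _ (analytic_derive _ _ Au)).
assert (DDv := analytic_cderiv _ _ (analytic_derive _ _ Av)).
eapply cderiv_eq.
- apply (cderiv_mult (fun z => z * (1 - z))%C (wron u v)).
  apply (cderiv_mult (fun z => z) (fun z => 1 - z)%C). apply cderiv_id. apply cderiv_minus. apply cderiv_const. apply cderiv_id.
  apply (cderiv_minus (fun z => u z * C_derive v z)%C (fun z => C_derive u z * v z)%C);
   apply cderiv_mult; eassumption.
- unfold hyp_ode in *. unfold wron.
  transitivity (u x * (x * (1 - x) * C_derive (C_derive v) x + (1 - 2 * x) * C_derive v x - v x / 4)
    - v x * (x * (1 - x) * C_derive (C_derive u) x + (1 - 2 * x) * C_derive u x - u x / 4))%C.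
  field. rewrite Ou, Ov. ring.
Qed.

Lemma wron_nz U c u v : star c U -> (forall z, U z -> z <> 0 /\ z <> 1) -> sol_on U u -> sol_on U v ->
  wron u v c <> 0 -> forall z, U z -> wron u v z <> 0.
Proof.
intros S N Hu Hv Hc z Hz E. assert (K := wron_const U c u v S Hu Hv z Hz).
rewrite E, Cmult_0_r in K. symmetry in K. revert K.
destruct (N c (proj1 S)). apply Cmult_neq_0; auto. apply Cmult_neq_0; auto.
apply Cminus_eq_contra. auto.
Qed.

(** The algebraic identity v W(u1, u2) = W(v, u2) u1 + W(u1, v) u2 has constant coefficients after
    division, since all three Wronskians are multiples of 1 / (x (1 - x)). This replaces a
    uniqueness theorem for the equation. *)
Lemma sol_span U c u1 u2 v : star c U -> (forall z, U z -> z <> 0 /\ z <> 1) ->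
  sol_on U u1 -> sol_on U u2 -> sol_on U v -> wron u1 u2 c <> 0 ->
  forall z, U z -> v z = (wron v u2 c / wron u1 u2 c * u1 z + wron u1 v c / wron u1 u2 c * u2 z)%C.
Proof.
intros S N H1 H2 Hv Hc z Hz.
assert (K := wron_const U c u1 u2 S H1 H2 z Hz).
assert (K1 := wron_const U c v u2 S Hv H2 z Hz).
assert (K2 := wron_const U c u1 v S H1 Hv z Hz).
assert (Hw := wron_nz U c u1 u2 S N H1 H2 Hc z Hz).
destruct (N c (proj1 S)) as [N0 N1]. destruct (N z Hz) as [M0 M1].
assert (N1' : (1 - c)%C <> 0) by (apply Cminus_eq_contra; auto).
assert (M1' : (1 - z)%C <> 0) by (apply Cminus_eq_contra; auto).
assert (F : forall a b : C, (z * (1 - z) * a = c * (1 - c) * b)%C -> b = (z * (1 - z) * a / (c * (1 - c)))%C).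
{ intros a b E. rewrite E. field. auto. }
rewrite (F _ _ K) in *. rewrite (F _ _ K1), (F _ _ K2).
assert (I : (v z * wron u1 u2 z = wron v u2 z * u1 z + wron u1 v z * u2 z)%C) by (unfold wron; ring).
transitivity ((v z * wron u1 u2 z) / wron u1 u2 z)%C. field; auto.
rewrite I. field. repeat split; auto.
Qed.

Lemma C_derive_lin p q u v z : analytic_at u z -> analytic_at v z ->
  C_derive (fun x => p * u x + q * v x)%C z = (p * C_derive u z + q * C_derive v z)%C.
Proof.
intros Hu Hv. apply C_derive_unique.
eapply cderiv_eq. apply (cderiv_plus (fun x => p * u x)%C (fun x => q * v x)%C).
apply (cderiv_mult (fun _ => p) u). apply cderiv_const. apply analytic_cderiv, Hu.
apply (cderiv_mult (fun _ => q) v). apply cderiv_const. apply analytic_cderiv, Hv. ring.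
Qed.

Lemma analytic_lin p q u v z : analytic_at u z -> analytic_at v z ->
  analytic_at (fun x => p * u x + q * v x)%C z.
Proof.
intros Hu Hv. apply (analytic_plus (fun x => p * u x)%C (fun x => q * v x)%C);
apply analytic_mult; auto using analytic_const.
Qed.

Lemma C_derive_loc f g z : locally z (fun y => f y = g y) -> analytic_at f z -> C_derive g z = C_derive f z.
Proof. intros E H. eapply C_derive_ext; eauto. now apply analytic_cderiv. Qed.

Lemma locally_locally (z : C) (P : C -> Prop) : locally z P -> locally z (fun y => locally y P).
Proof.
intros H. apply locally_Cmod in H. destruct H as [r [Hr H]]. apply locally_Cmod. exists r. split; auto.
intros y Hy. generalize (locally_open_ball z y r Hy). apply locally_imp. auto.
Qed.

Lemma C_derive2_loc f g z : locally z (fun y => f y = g y) -> analytic_at f z ->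
  C_derive (C_derive g) z = C_derive (C_derive f) z.
Proof.
intros E H. apply C_derive_loc.
- generalize (locally_and _ _ _ (locally_locally _ _ E) (analytic_locally _ _ H)). apply locally_imp.
  intros y [E1 H1]. symmetry. now apply C_derive_loc.
- now apply analytic_derive.
Qed.

Lemma hyp_ode_loc f g z : locally z (fun y => f y = g y) -> analytic_at f z -> hyp_ode f z -> hyp_ode g z.
Proof.
intros E H O. unfold hyp_ode. rewrite (C_derive2_loc f g), (C_derive_loc f g) by auto.
now rewrite <- (locally_singleton _ _ E).
Qed.

Lemma sol_on_ext U u v : (forall z, U z -> locally z U) -> (forall z, U z -> u z = v z) -> sol_on U u -> sol_on U v.
Proof.
intros Uo E H z Hz. destruct (H z Hz) as [A O].
assert (L : locally z (fun y => u y = v y)).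
{ generalize (Uo z Hz). apply locally_imp. auto. }
split. now apply analytic_ext_loc with u. now apply hyp_ode_loc with u.
Qed.

Lemma sol_on_lin U u v p q : sol_on U u -> sol_on U v -> sol_on U (fun x => p * u x + q * v x)%C.
Proof.
intros Hu Hv z Hz. destruct (Hu z Hz) as [Au Ou], (Hv z Hz) as [Av Ov].
split. now apply analytic_lin. unfold hyp_ode in *.
rewrite C_derive_lin by auto.
assert (E : C_derive (C_derive (fun x => p * u x + q * v x)%C) z =
   (p * C_derive (C_derive u) z + q * C_derive (C_derive v) z)%C).
{ rewrite <- (C_derive_lin p q (C_derive u) (C_derive v)) by now apply analytic_derive.
  apply C_derive_loc; [|apply analytic_lin; now apply analytic_derive].
  generalize (locally_and _ _ _ (analytic_locally _ _ Au) (analytic_locally _ _ Av)). apply locally_imp.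
  intros y [A1 A2]. symmetry. now apply C_derive_lin. }
rewrite E.
transitivity (p * (z * (1 - z) * C_derive (C_derive u) z + (1 - 2 * z) * C_derive u z - u z / 4) +
   q * (z * (1 - z) * C_derive (C_derive v) z + (1 - 2 * z) * C_derive v z - v z / 4))%C.
field. rewrite Ou, Ov. ring.
Qed.

Lemma sol_on_sub (U V : C -> Prop) u : (forall z, V z -> U z) -> sol_on U u -> sol_on V u.
Proof. intros H S z Hz. apply S, H, Hz. Qed.

Lemma locally_zero_derive f z : locally z (fun y => f y = RtoC 0) -> locally z (fun y => C_derive f y = RtoC 0).
Proof.
intros H. generalize (locally_locally _ _ H). apply locally_imp. intros y Hy.
rewrite (C_derive_loc (fun _ => RtoC 0) f). apply C_derive_unique, cderiv_const.
revert Hy; apply locally_imp; auto. apply analytic_const.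
Qed.

(** * Meromorphy and homogeneity of the Chazy formula *)

Lemma solution_derive_nz U W z : (forall z, U z -> locally z U) -> U z -> sol_on U W ->
  locally z (fun y => C_derive W y = 0) -> locally z (fun y => W y = 0).
Proof.
intros Uo Hz S H.
generalize (locally_and _ _ _ (Uo z Hz) (locally_and _ _ _ H (locally_zero_derive _ _ H))). apply locally_imp.
intros y [Uy [D1 D2]]. destruct (S y Uy) as [_ O]. unfold hyp_ode in O. rewrite D1, D2 in O.
transitivity (- (4) * (y * (1 - y) * 0 + (1 - 2 * y) * 0 - W y / 4))%C. field. rewrite O. ring.
Qed.

(* [x^(-1/2)] and [(x - 1)^(-1/2)] do not solve the equation. *)
Lemma solution_factor_nz U W (e : C) z : (forall z, U z -> locally z U) -> U z -> sol_on U W ->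
  e = 0 \/ e = 1 ->
  locally z (fun y => W y + 2 * (y - e) * C_derive W y = 0)%C -> locally z (fun y => W y = 0).
Proof.
intros Uo Hz S He H. apply (solution_derive_nz U W z Uo Hz S).
assert (H' := locally_zero_derive _ _ H).
generalize (locally_and _ _ _ (Uo z Hz) (locally_and _ _ _ H H')). apply locally_imp.
intros y [Uy [E1 E2]]. destruct (S y Uy) as [A O]. unfold hyp_ode in O.
rewrite (C_derive_unique _ _ (C_derive W y + (2 * C_derive W y + 2 * (y - e) * C_derive (C_derive W) y))%C) in E2.
2:{ eapply cderiv_eq. apply (cderiv_plus W (fun y => 2 * (y - e) * C_derive W y)%C). apply analytic_cderiv, A.
  apply (cderiv_mult (fun y => 2 * (y - e))%C (C_derive W)).
  apply (cderiv_mult (fun _ => RtoC 2) (fun y => y - e)%C). apply cderiv_const. apply cderiv_minus. apply cderiv_id. apply cderiv_const.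
  apply analytic_cderiv, analytic_derive, A. ring. }
set (w := W y) in *. set (w1 := C_derive W y) in *. set (w2 := C_derive (C_derive W) y) in *. clearbody w w1 w2.
assert (Ew : w = (- (2 * (y - e) * w1))%C).
{ transitivity ((w + 2 * (y - e) * w1) - 2 * (y - e) * w1)%C; [ring|]. rewrite E1. ring. }
rewrite Ew in O. clear E1 Ew w.
destruct He as [-> | ->].
- transitivity (- (2) * (y * (1 - y) * w2 + (1 - 2 * y) * w1 - - (2 * (y - 0) * w1) / 4)
    + (1 - y) * (w1 + (2 * w1 + 2 * (y - 0) * w2)))%C. field. rewrite O, E2. ring.
- transitivity (2 * (y * (1 - y) * w2 + (1 - 2 * y) * w1 - - (2 * (y - 1) * w1) / 4)
    + y * (w1 + (2 * w1 + 2 * (y - 1) * w2)))%C. field. rewrite O, E2. ring.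
Qed.

(** If W is not identically zero near z, the equation prevents each of the four factors of the
    denominator from vanishing identically. Each is then non-zero on a punctured disc, and so is the
    product. *)
Lemma chazy_formula_meromorphic U W z : (forall z, U z -> locally z U) -> U z -> sol_on U W ->
  ~ locally z (fun y => W y = 0) -> meromorphic_at (chazy_formula W) z.
Proof.
intros Uo Hz S N. destruct (S z Hz) as [A _]. pose proof (analytic_derive _ _ A) as A'.
assert (AX : forall c, analytic_at (fun _ => c) z) by (intros; apply analytic_const).
assert (Ai : analytic_at (fun y => y) z) by apply analytic_id.
assert (A1 : analytic_at (fun y => 2 * (y - 1) * C_derive W y + W y)%C z).
{ apply analytic_plus; auto. apply (analytic_mult (fun y => 2 * (y - 1))%C); auto.
  apply (analytic_mult (fun _ => RtoC 2)); auto. now apply analytic_minus. }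
assert (A2 : analytic_at (fun y => W y + 2 * y * C_derive W y)%C z).
{ apply analytic_plus; auto. apply (analytic_mult (fun y => 2 * y)%C); auto.
  now apply (analytic_mult (fun _ => RtoC 2)). }
apply (meromorphic_quotient
  (fun x => 1 / 8 * (((W x + 2 * x * C_derive W x) ^ 2 - 4 * x * C_derive W x ^ 2) ^ 2))%C
  (fun x => W x * C_derive W x * (2 * (x - 1) * C_derive W x + W x) * (W x + 2 * x * C_derive W x))%C).
- apply analytic_mult; auto.
  apply (analytic_pow (fun x => (W x + 2 * x * C_derive W x) ^ 2 - 4 * x * C_derive W x ^ 2)%C).
  apply analytic_minus. now apply (analytic_pow (fun x => W x + 2 * x * C_derive W x)%C).
  apply (analytic_mult (fun x => 4 * x)%C). now apply (analytic_mult (fun _ => RtoC 4)). now apply analytic_pow.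
- apply analytic_mult; auto. apply (analytic_mult (fun x => W x * C_derive W x)%C); auto. now apply analytic_mult.
- intros Z.
  assert (D : forall f, analytic_at f z -> ~ locally z (fun y => f y = 0) -> locally' z (fun y => f y <> 0)).
  { intros f Hf Nf. destruct (analytic_dichotomy f z Hf); auto. easy. }
  assert (D1 := D _ A N).
  assert (D2 : locally' z (fun y => C_derive W y <> 0)).
  { apply D; auto. intros K. apply N. now apply (solution_derive_nz U). }
  assert (D3 : locally' z (fun y => 2 * (y - 1) * C_derive W y + W y <> 0)%C).
  { apply (D (fun y => 2 * (y - 1) * C_derive W y + W y)%C); auto. intros K. apply N.
    apply (solution_factor_nz U W 1); auto. revert K. apply locally_imp.
    intros y Ky. transitivity (2 * (y - 1) * C_derive W y + W y)%C; [ring | exact Ky]. }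
  assert (D4 : locally' z (fun y => W y + 2 * y * C_derive W y <> 0)%C).
  { apply (D (fun y => W y + 2 * y * C_derive W y)%C); auto. intros K. apply N.
    apply (solution_factor_nz U W 0); auto. revert K. apply locally_imp.
    intros y Ky. transitivity (W y + 2 * y * C_derive W y)%C; [ring | exact Ky]. }
  apply (locally'_False z).
  generalize (locally'_and _ _ _ (locally'_of_locally _ _ Z) (locally'_and _ _ _ D1 (locally'_and _ _ _ D2 (locally'_and _ _ _ D3 D4)))).
  apply locally'_imp. intros y _ [E [N1 [N2 [N3 N4]]]]. revert E.
  repeat apply Cmult_neq_0; auto.
Qed.

Lemma chazy_formula_loc W1 W2 z : analytic_at W1 z -> locally z (fun y => W1 y = W2 y) ->
  germ_eq z (chazy_formula W1) (chazy_formula W2).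
Proof.
intros A E. apply germ_eq_locally.
generalize (locally_and _ _ _ (analytic_locally _ _ A) (locally_locally _ _ E)). apply locally_imp.
intros y [Ay Ey]. unfold chazy_formula. rewrite (C_derive_loc W1 W2) by auto.
now rewrite (locally_singleton _ _ Ey).
Qed.

(** Numerator and denominator are both homogeneous of degree 4 in (W, W'), so that only the class of
    W in the projective line matters. *)
Lemma chazy_formula_scal (c : C) W z : c <> 0 -> analytic_at W z ->
  germ_eq z (chazy_formula (fun x => c * W x)%C) (chazy_formula W).
Proof.
intros Hc A. apply germ_eq_locally. generalize (analytic_locally _ _ A). apply locally_imp.
intros y Ay. unfold chazy_formula.
rewrite (C_derive_unique (fun x => c * W x)%C y (c * C_derive W y)%C).
2:{ eapply cderiv_eq. apply (cderiv_mult (fun _ => c) W). apply cderiv_const. apply analytic_cderiv, Ay. ring. }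
set (w := W y). set (w1 := C_derive W y). clearbody w w1.
set (Q := (w * w1 * (2 * (y - 1) * w1 + w) * (w + 2 * y * w1))%C).
replace (c * w * (c * w1) * (2 * (y - 1) * (c * w1) + c * w) * (c * w + 2 * y * (c * w1)))%C
  with (c ^ 4 * Q)%C by (unfold Q; ring).
replace (((c * w + 2 * y * (c * w1)) ^ 2 - 4 * y * (c * w1) ^ 2) ^ 2)%C with
  (c ^ 4 * ((w + 2 * y * w1) ^ 2 - 4 * y * w1 ^ 2) ^ 2)%C by ring.
assert (Hc4 : (c ^ 4)%C <> 0) by now apply Cpow_nz.
destruct (Ceq_dec Q 0) as [E|N].
(* At a zero of the denominator both sides are divisions by zero, and [Cinv] of 0 is 0 because its
   components have numerator 0. *)
- rewrite E, Cmult_0_r. unfold Cdiv, Cinv, Cmult, RtoC. simpl.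
  apply injective_projections; simpl; unfold Rdiv; ring.
- field. auto.
Qed.

(** * The Gamma function *)

Lemma exp_le u v : u <= v -> exp u <= exp v.
Proof. intros [H | ->]; [left; now apply exp_increasing | right; reflexivity]. Qed.

Definition gamma_integrand (x t : R) : R := Rpower t (x - 1) * exp (- t).

Lemma gamma_integrand_pos x t : 0 < gamma_integrand x t.
Proof. apply Rmult_lt_0_compat; apply exp_pos. Qed.

Lemma gamma_integrand_exp x t : gamma_integrand x t = exp ((x - 1) * ln t - t).
Proof. unfold gamma_integrand, Rpower. now rewrite <- exp_plus. Qed.

Lemma gamma_integrand_continuous x t : 0 < t -> continuous (gamma_integrand x) t.
Proof.
intros Ht. apply continuous_ext with (fun t => exp ((x - 1) * ln t - t)).
intros; now rewrite gamma_integrand_exp.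
apply (ex_derive_continuous (K := R_AbsRing) (V := R_NormedModule)). auto_derive. exact Ht.
Qed.

Lemma gamma_ex_RInt x a b : 0 < a -> 0 < b -> ex_RInt (gamma_integrand x) a b.
Proof.
intros Ha Hb. apply (ex_RInt_continuous (V := R_CompleteNormedModule)). intros t [Ht _].
apply gamma_integrand_continuous. eapply Rlt_le_trans; [|exact Ht]. now apply Rmin_pos.
Qed.

Lemma gamma_RInt_mono x a b a' b' : 0 < a' -> a' <= a -> a <= b -> b <= b' ->
  RInt (gamma_integrand x) a b <= RInt (gamma_integrand x) a' b'.
Proof.
intros H0 H1 H2 H3.
assert (E1 : RInt (gamma_integrand x) a' b + RInt (gamma_integrand x) b b' = RInt (gamma_integrand x) a' b').
{ apply (RInt_Chasles (V := R_CompleteNormedModule)); apply gamma_ex_RInt; lra. }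
assert (E2 : RInt (gamma_integrand x) a' a + RInt (gamma_integrand x) a b = RInt (gamma_integrand x) a' b).
{ apply (RInt_Chasles (V := R_CompleteNormedModule)); apply gamma_ex_RInt; lra. }
assert (P : forall u v, 0 < u -> u <= v -> 0 <= RInt (gamma_integrand x) u v).
{ intros u v Hu Huv. apply RInt_ge_0; auto. apply gamma_ex_RInt; lra. intros; left; apply gamma_integrand_pos. }
assert (H4 := P a' a ltac:(lra) ltac:(lra)). assert (H5 := P b b' ltac:(lra) ltac:(lra)). lra.
Qed.

Lemma ln_le_sub1 y : 0 < y -> ln y <= y - 1.
Proof. intros H. generalize (exp_ineq1_le (ln y)). rewrite exp_ln; lra. Qed.

(** The tangent of ln at 2x. It gives t^x <= C exp (t / 2), which leaves half of the decay of exp (-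
    t). *)
Lemma gamma_tail_bound x t : 0 < x -> 1 <= t -> x * ln t <= t / 2 + (x * ln (2 * x) - x).
Proof.
intros Hx Ht. assert (H := ln_le_sub1 (t / (2 * x)) ltac:(apply Rdiv_lt_0_compat; lra)).
rewrite ln_div in H by lra. 
assert (x * (ln t - ln (2 * x)) <= x * (t / (2 * x) - 1)) by (apply Rmult_le_compat_l; lra).
replace (x * (t / (2 * x) - 1)) with (t / 2 - x) in H0 by (field; lra). lra.
Qed.

Lemma gamma_RInt_bounded x : 0 < x -> exists M, forall a b, 0 < a -> a <= b ->
  RInt (gamma_integrand x) a b <= M.
Proof.
intros Hx. set (C := exp (x * ln (2 * x) - x)).
(* 1 / x bounds the integral of t^(x-1) over (0, 1], and 2 C that of C exp (- t / 2) over [1,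
   oo). *)
exists (/ x + 2 * C). intros a b Ha Hab.
assert (L : forall a, 0 < a <= 1 -> RInt (gamma_integrand x) a 1 <= / x).
{ intros u Hu. apply Rle_trans with (RInt (fun t => Rpower t (x - 1)) u 1).
  - assert (Cp : forall t, 0 < t -> continuous (fun t => Rpower t (x - 1)) t).
    { intros t Ht. unfold Rpower. apply (ex_derive_continuous (K := R_AbsRing) (V := R_NormedModule)). auto_derive. exact Ht. }
    apply RInt_le; [lra| apply gamma_ex_RInt; lra | |].
    + apply (ex_RInt_continuous (V := R_CompleteNormedModule)). intros t [Ht _].
      apply Cp. rewrite Rmin_left in Ht; lra.
    + intros t Ht. unfold gamma_integrand. rewrite <- (Rmult_1_r (Rpower t (x - 1))) at 2.
      apply Rmult_le_compat_l. left; apply exp_pos. rewrite <- exp_0. left; apply exp_increasing. lra.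
  - assert (I : is_RInt (fun t => Rpower t (x - 1)) u 1 (Rpower 1 x / x - Rpower u x / x)).
    { apply (is_RInt_derive (V := R_CompleteNormedModule) (fun t => Rpower t x / x)).
      - intros t [Ht _]. rewrite Rmin_left in Ht by lra. unfold Rpower. auto_derive. lra.
        replace ((x - 1) * ln t) with (x * ln t + - ln t) by ring. rewrite exp_plus, exp_Ropp, exp_ln by lra. field. lra.
      - intros t [Ht _]. rewrite Rmin_left in Ht by lra. unfold Rpower.
        apply (ex_derive_continuous (K := R_AbsRing) (V := R_NormedModule)). auto_derive. lra. }
    apply (is_RInt_unique (V := R_CompleteNormedModule)) in I. rewrite I.
    unfold Rpower at 1. rewrite ln_1, Rmult_0_r, exp_0.
    assert (0 < Rpower u x / x) by (apply Rdiv_lt_0_compat; [apply exp_pos | lra]). lra. }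
assert (T : forall b, 1 <= b -> RInt (gamma_integrand x) 1 b <= 2 * C).
{ intros v Hv. apply Rle_trans with (RInt (fun t => C * exp (- t / 2)) 1 v).
  - apply RInt_le; [lra| apply gamma_ex_RInt; lra | |].
    + apply (ex_RInt_continuous (V := R_CompleteNormedModule)). intros t _.
      apply (ex_derive_continuous (K := R_AbsRing) (V := R_NormedModule)). auto_derive. auto.
    + intros t Ht. rewrite gamma_integrand_exp. unfold C. rewrite <- exp_plus.
      apply exp_le. generalize (gamma_tail_bound x t Hx ltac:(lra)).
      assert (0 <= ln t) by (rewrite <- ln_1; apply ln_le; lra). lra.
  - assert (I : is_RInt (fun t => C * exp (- t / 2)) 1 v (- 2 * C * exp (- v / 2) - - 2 * C * exp (- 1 / 2))).
    { apply (is_RInt_derive (V := R_CompleteNormedModule) (fun t => - 2 * C * exp (- t / 2))).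
      - intros t _. auto_derive. auto. unfold Rdiv.
        match goal with |- ?p = ?q => change (@eq R p q) end. field.
      - intros t _. apply (ex_derive_continuous (K := R_AbsRing) (V := R_NormedModule)). auto_derive. auto. }
    apply (is_RInt_unique (V := R_CompleteNormedModule)) in I. rewrite I.
    assert (0 < C) by apply exp_pos. assert (0 < exp (- v / 2)) by apply exp_pos.
    assert (exp (- 1 / 2) <= 1) by (rewrite <- exp_0; apply exp_le; lra). nra. }
apply Rle_trans with (RInt (gamma_integrand x) (Rmin a 1) (Rmax b 1)).
- apply gamma_RInt_mono; auto. apply Rmin_pos; lra. apply Rmin_l. apply Rmax_l.
- assert (0 < Rmin a 1) by (apply Rmin_pos; lra). assert (1 <= Rmax b 1) by apply Rmax_r.
  assert (E : RInt (gamma_integrand x) (Rmin a 1) 1 + RInt (gamma_integrand x) 1 (Rmax b 1) = RInt (gamma_integrand x) (Rmin a 1) (Rmax b 1)).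
  { apply (RInt_Chasles (V := R_CompleteNormedModule)); apply gamma_ex_RInt; lra. }
  rewrite <- E. apply Rplus_le_compat. apply L. split; auto. apply Rmin_r. apply T; auto.
Qed.

(** The integrand is positive, so the improper integral is the supremum of the integrals over
    compact intervals. Positivity, functional equation and convexity are derived from this
    description. *)
Lemma Gamma_spec x : 0 < x ->
  (forall a b, 0 < a -> a <= b -> RInt (gamma_integrand x) a b <= Gamma x) /\
  (forall e, 0 < e -> exists a0 b0, 0 < a0 <= b0 /\
    forall a b, 0 < a -> a <= a0 -> b0 <= b -> Gamma x - e < RInt (gamma_integrand x) a b).
Proof.
intros Hx. destruct (gamma_RInt_bounded x Hx) as [M HM].
set (E := fun y => exists a b, 0 < a <= b /\ y = RInt (gamma_integrand x) a b).
destruct (completeness E) as [L [L1 L2]].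
{ exists M. intros y [a [b [H ->]]]. apply HM; lra. }
{ exists (RInt (gamma_integrand x) 1 1), 1, 1. split; auto. lra. }
assert (S1 : forall a b, 0 < a -> a <= b -> RInt (gamma_integrand x) a b <= L).
{ intros a b Ha Hab. apply L1. exists a, b. auto. }
assert (S2 : forall e, 0 < e -> exists a0 b0, 0 < a0 <= b0 /\
    forall a b, 0 < a -> a <= a0 -> b0 <= b -> L - e < RInt (gamma_integrand x) a b).
{ intros e He. apply NNPP. intros N. assert (L <= L - e); [|lra].
  apply L2. intros y [a0 [b0 [H ->]]]. apply Rnot_lt_le. intros K. apply N.
  exists a0, b0. split; auto. intros a b Ha Ha0 Hb. eapply Rlt_le_trans; [exact K|].
  apply gamma_RInt_mono; lra. }
replace (Gamma x) with L; auto. symmetry. unfold Gamma.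
apply (is_RInt_gen_unique (V := R_CompleteNormedModule)).
intros P [e HP]. destruct (S2 e (cond_pos e)) as [a0 [b0 [H K]]].
apply (Filter_prod _ _ _ (fun a => 0 < a <= a0) (fun b => b0 <= b)).
- exists (mkposreal a0 (proj1 H)). intros y Hy Hy0. 
  change (Rabs (y - 0) < a0) in Hy. rewrite Rminus_0_r in Hy. apply Rabs_def2 in Hy. lra.
- exists b0. intros y Hy. lra.
- intros a b Ha Hb. exists (RInt (gamma_integrand x) a b). split.
  + apply (RInt_correct (V := R_CompleteNormedModule)). apply gamma_ex_RInt; simpl; lra.
  + apply HP. change (Rabs (RInt (gamma_integrand x) a b - L) < e).
    specialize (K a b ltac:(lra) ltac:(lra) Hb). specialize (S1 a b ltac:(lra) ltac:(lra)).
    apply Rabs_def1; lra.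
Qed.

Lemma Gamma_pos x : 0 < x -> 0 < Gamma x.
Proof.
intros Hx. destruct (Gamma_spec x Hx) as [H _].
eapply Rlt_le_trans; [|apply (H 1 2); lra]. apply RInt_gt_0. lra.
intros; apply gamma_integrand_pos. intros; apply gamma_integrand_continuous; lra.
Qed.

Lemma Gamma_succ x : 0 < x -> Gamma (x + 1) = x * Gamma x.
Proof.
intros Hx. destruct (Gamma_spec x Hx) as [A1 A2]. destruct (Gamma_spec (x + 1) ltac:(lra)) as [B1 B2].
assert (Hx1 : 0 < x + 1) by lra.
(* The boundary term t^x exp (- t) of the integration by parts; it is small at both ends. *)
set (bd := fun t => exp (x * ln t - t)).
assert (I : forall a b, 0 < a -> a <= b ->
   x * RInt (gamma_integrand x) a b - RInt (gamma_integrand (x + 1)) a b = bd b - bd a).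
{ intros a b Ha Hab.
  assert (Ex := gamma_ex_RInt x a b Ha ltac:(lra)). assert (Ey := gamma_ex_RInt (x + 1) a b Ha ltac:(lra)).
  pose proof (RInt_scal (V := R_CompleteNormedModule) _ a b x Ex) as Sc.
  change (RInt (fun t => x * gamma_integrand x t) a b = x * RInt (gamma_integrand x) a b) in Sc.
  assert (Exx : ex_RInt (fun t => x * gamma_integrand x t) a b) by exact (ex_RInt_scal (V := R_NormedModule) _ a b x Ex).
  pose proof (RInt_minus (V := R_CompleteNormedModule) _ _ a b Exx Ey) as Mi.
  change (RInt (fun t => x * gamma_integrand x t - gamma_integrand (x + 1) t) a b =
     RInt (fun t => x * gamma_integrand x t) a b - RInt (gamma_integrand (x + 1)) a b) in Mi.
  rewrite <- Sc, <- Mi.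
  apply (is_RInt_unique (V := R_CompleteNormedModule)).
  apply (is_RInt_derive (V := R_CompleteNormedModule) bd).
  - intros t [Ht _]. rewrite Rmin_left in Ht by lra. unfold bd. rewrite !gamma_integrand_exp.
    auto_derive. lra. replace (x + 1 - 1) with x by ring.
    replace ((x - 1) * ln t - t) with (x * ln t - t + - ln t) by ring.
    unfold Rminus at 1. rewrite (exp_plus _ (- ln t)), (exp_Ropp (ln t)), exp_ln by lra.
    unfold Rminus. field. lra.
  - intros t [Ht _]. rewrite Rmin_left in Ht by lra.
    apply (continuous_minus (V := R_NormedModule) (fun t => x * gamma_integrand x t)).
    apply (continuous_scal_r (V := R_NormedModule) x). apply gamma_integrand_continuous; lra.
    apply gamma_integrand_continuous; lra. }
assert (Bd0 : forall e, 0 < e -> forall t, 0 < t -> t <= exp (ln e / x) -> bd t <= e).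
{ intros e He t Ht Hl. unfold bd. rewrite <- (exp_ln e He). apply exp_le.
  assert (ln t <= ln e / x) by (rewrite <- (ln_exp (ln e / x)); apply ln_le; auto).
  assert (x * ln t <= x * (ln e / x)) by (apply Rmult_le_compat_l; lra).
  replace (x * (ln e / x)) with (ln e) in H0 by (field; lra). lra. }
assert (Bdi : forall e, 0 < e -> forall t, 1 <= t -> 2 * (x * ln (2 * x) - x - ln e) <= t -> bd t <= e).
{ intros e He t Ht Hl. unfold bd. rewrite <- (exp_ln e He). apply exp_le.
  generalize (gamma_tail_bound x t Hx Ht). lra. }
assert (Bp : forall t, 0 < bd t) by (intros; apply exp_pos).
apply cond_eq. intros e He.
(* The error for Gamma x is later multiplied by x, and x / (x + 1) <= 1 brings it down to e / 4. The
   other errors of e / 4 are the one for Gamma (x + 1) and the two boundary terms. *)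
assert (He4 : 0 < e / 4) by lra. assert (Hex : 0 < e / (4 * (x + 1))) by (apply Rdiv_lt_0_compat; lra).
destruct (A2 _ Hex) as [a1 [b1 [H1 K1]]]. destruct (B2 _ He4) as [a2 [b2 [H2 K2]]].
set (a := Rmin (Rmin a1 a2) (exp (ln (e / 4) / x))).
set (b := Rmax (Rmax b1 b2) (Rmax 1 (2 * (x * ln (2 * x) - x - ln (e / 4))))).
assert (Ha : 0 < a /\ a <= a1 /\ a <= a2 /\ a <= exp (ln (e / 4) / x)).
{ unfold a. repeat split. apply Rmin_pos; [apply Rmin_pos; lra | apply exp_pos].
  eapply Rle_trans; [apply Rmin_l | apply Rmin_l]. eapply Rle_trans; [apply Rmin_l | apply Rmin_r]. apply Rmin_r. }
assert (Hb : b1 <= b /\ b2 <= b /\ 1 <= b /\ 2 * (x * ln (2 * x) - x - ln (e / 4)) <= b).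
{ unfold b. repeat split.
  eapply Rle_trans; [apply Rmax_l | apply Rmax_l]. eapply Rle_trans; [apply Rmax_r | apply Rmax_l].
  eapply Rle_trans; [apply Rmax_l | apply Rmax_r]. eapply Rle_trans; [apply Rmax_r | apply Rmax_r]. }
clearbody a b.
specialize (I a b ltac:(lra) ltac:(lra)). specialize (K1 a b ltac:(lra) ltac:(lra) ltac:(lra)).
specialize (K2 a b ltac:(lra) ltac:(lra) ltac:(lra)). specialize (A1 a b ltac:(lra) ltac:(lra)).
specialize (B1 a b ltac:(lra) ltac:(lra)).
specialize (Bd0 _ He4 a ltac:(lra) ltac:(lra)). specialize (Bdi _ He4 b ltac:(lra) ltac:(lra)).
assert (P1 := Bp a). assert (P2 := Bp b).
set (X := RInt (gamma_integrand x) a b) in *. set (Y := RInt (gamma_integrand (x + 1)) a b) in *.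
assert (x * (Gamma x - X) <= x * (e / (4 * (x + 1)))) by (apply Rmult_le_compat_l; lra).
assert (x * (e / (4 * (x + 1))) <= e / 4).
{ replace (e / 4) with ((x + 1) * (e / (4 * (x + 1)))) by (field; lra). apply Rmult_le_compat_r; lra. }
assert (0 <= x * (Gamma x - X)) by (apply Rmult_le_pos; lra).
apply Rabs_def1; lra.
Qed.

(** Both endpoints lie above the tangent of exp at the weighted mean m; averaging the two tangent
    inequalities cancels the linear terms. *)
Lemma exp_convex l u v : 0 <= l <= 1 -> exp (l * u + (1 - l) * v) <= l * exp u + (1 - l) * exp v.
Proof.
intros Hl. set (m := l * u + (1 - l) * v).
assert (T : forall p, exp m * (1 + (p - m)) <= exp p).
{ intros p. replace (exp p) with (exp m * exp (p - m)) by (rewrite <- exp_plus; f_equal; ring).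
  apply Rmult_le_compat_l. left; apply exp_pos. apply exp_ineq1_le. }
assert (l * (exp m * (1 + (u - m))) <= l * exp u) by (apply Rmult_le_compat_l; [lra | apply T]).
assert ((1 - l) * (exp m * (1 + (v - m))) <= (1 - l) * exp v) by (apply Rmult_le_compat_l; [lra | apply T]).
assert (E : l * (exp m * (1 + (u - m))) + (1 - l) * (exp m * (1 + (v - m))) = exp m) by (unfold m; ring).
lra.
Qed.

(* Hoelder's inequality, in the form of Young's inequality for the integrands
   normalised by [Gamma x] and [Gamma y]. *)
Lemma ln_Gamma_convex x y l : 0 < x -> 0 < y -> 0 <= l <= 1 ->
  ln (Gamma (l * x + (1 - l) * y)) <= l * ln (Gamma x) + (1 - l) * ln (Gamma y).
Proof.
intros Hx Hy Hl. set (z := l * x + (1 - l) * y).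
assert (Hz : 0 < z). { unfold z. destruct (Req_dec_T l 0). subst; lra. assert (0 < l * x) by (apply Rmult_lt_0_compat; lra). assert (0 <= (1 - l) * y) by (apply Rmult_le_pos; lra). lra. }
pose proof (Gamma_pos x Hx) as Px. pose proof (Gamma_pos y Hy) as Py. pose proof (Gamma_pos z Hz) as Pz.
set (k := l * ln (Gamma x) + (1 - l) * ln (Gamma y)).
rewrite <- (ln_exp k). apply ln_le; auto.
apply Rnot_lt_le. intros N.
destruct (Gamma_spec z Hz) as [_ Z]. destruct (Z (Gamma z - exp k)) as [a [b [H K]]]. lra.
specialize (K a b ltac:(lra) ltac:(lra) ltac:(lra)).
destruct (Gamma_spec x Hx) as [A _]. destruct (Gamma_spec y Hy) as [B _].
specialize (A a b ltac:(lra) ltac:(lra)). specialize (B a b ltac:(lra) ltac:(lra)).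
assert (Ex := gamma_ex_RInt x a b ltac:(lra) ltac:(lra)). assert (Ey := gamma_ex_RInt y a b ltac:(lra) ltac:(lra)).
(* The weights for which c1 Gamma x + c2 Gamma y = exp k. *)
set (c1 := exp k * l / Gamma x). set (c2 := exp k * (1 - l) / Gamma y).
pose proof (RInt_scal (V := R_CompleteNormedModule) _ a b c1 Ex) as S1.
change (RInt (fun t => c1 * gamma_integrand x t) a b = c1 * RInt (gamma_integrand x) a b) in S1.
pose proof (RInt_scal (V := R_CompleteNormedModule) _ a b c2 Ey) as S2.
change (RInt (fun t => c2 * gamma_integrand y t) a b = c2 * RInt (gamma_integrand y) a b) in S2.
assert (E1 : ex_RInt (fun t => c1 * gamma_integrand x t) a b) by exact (ex_RInt_scal (V := R_NormedModule) _ a b c1 Ex).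
assert (E2 : ex_RInt (fun t => c2 * gamma_integrand y t) a b) by exact (ex_RInt_scal (V := R_NormedModule) _ a b c2 Ey).
pose proof (RInt_plus (V := R_CompleteNormedModule) _ _ a b E1 E2) as S3.
change (RInt (fun t => c1 * gamma_integrand x t + c2 * gamma_integrand y t) a b =
  RInt (fun t => c1 * gamma_integrand x t) a b + RInt (fun t => c2 * gamma_integrand y t) a b) in S3.
assert (Le : RInt (gamma_integrand z) a b <= RInt (fun t => c1 * gamma_integrand x t + c2 * gamma_integrand y t) a b).
{ apply RInt_le; [lra | apply gamma_ex_RInt; lra | exact (ex_RInt_plus (V := R_NormedModule) _ _ a b E1 E2) |].
  intros t Ht. rewrite !gamma_integrand_exp.
  assert (Q := exp_convex l ((x - 1) * ln t - t - ln (Gamma x)) ((y - 1) * ln t - t - ln (Gamma y)) Hl).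
  unfold Rminus at 3 6 in Q.
  replace ((x - 1) * ln t - t + - ln (Gamma x)) with (((x - 1) * ln t - t) + - ln (Gamma x)) in Q by ring.
  assert (X : forall u w, 0 < w -> exp (u - ln w) = exp u / w).
  { intros u w Hw. unfold Rminus. rewrite exp_plus, exp_Ropp, exp_ln; auto. }
  rewrite !X in Q by auto.
  replace (exp ((z - 1) * ln t - t)) with (exp k * exp (l * ((x - 1) * ln t - t - ln (Gamma x)) + (1 - l) * ((y - 1) * ln t - t - ln (Gamma y)))).
  2:{ rewrite <- exp_plus. f_equal. unfold k, z. ring. }
  unfold c1, c2.
  replace (exp k * l / Gamma x * exp ((x - 1) * ln t - t) + exp k * (1 - l) / Gamma y * exp ((y - 1) * ln t - t))
   with (exp k * (l * (exp ((x - 1) * ln t - t) / Gamma x) + (1 - l) * (exp ((y - 1) * ln t - t) / Gamma y))) by (field; lra).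
  apply Rmult_le_compat_l; auto. left; apply exp_pos. }
rewrite S3, S1, S2 in Le.
assert (Pk : 0 < exp k) by apply exp_pos.
assert (0 <= c1) by (apply Rmult_le_pos; [apply Rmult_le_pos; lra | left; now apply Rinv_0_lt_compat]).
assert (0 <= c2) by (apply Rmult_le_pos; [apply Rmult_le_pos; lra | left; now apply Rinv_0_lt_compat]).
assert (c1 * RInt (gamma_integrand x) a b <= c1 * Gamma x) by (apply Rmult_le_compat_l; auto).
assert (c2 * RInt (gamma_integrand y) a b <= c2 * Gamma y) by (apply Rmult_le_compat_l; auto).
assert (c1 * Gamma x + c2 * Gamma y = exp k) by (unfold c1, c2; field; lra).
lra.
Qed.

(** * The digamma function *)

Lemma ln_Gamma_succ x : 0 < x -> ln (Gamma (x + 1)) = ln (Gamma x) + ln x.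
Proof. intros Hx. rewrite Gamma_succ, ln_mult; auto using Gamma_pos. ring. Qed.

(** The chord over [y, y + 1], on which ln Gamma increases by ln y. *)
Lemma ln_Gamma_upper y h : 0 < y -> 0 < h <= 1 -> ln (Gamma (y + h)) - ln (Gamma y) <= h * ln y.
Proof.
intros Hy Hh. assert (C := ln_Gamma_convex (y + 1) y h ltac:(lra) Hy ltac:(lra)).
replace (h * (y + 1) + (1 - h) * y) with (y + h) in C by ring.
rewrite ln_Gamma_succ in C by auto. lra.
Qed.

(** y lies between y - 1 and y + h, so the slope to the right of y is at least the slope ln (y - 1)
    over [y - 1, y]. The weight [l] writes y as a mean of these two points. *)
Lemma ln_Gamma_lower y h : 1 < y -> 0 < h -> h * ln (y - 1) <= ln (Gamma (y + h)) - ln (Gamma y).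
Proof.
intros Hy Hh.
set (l := h / (1 + h)).
assert (Hl : 0 <= l <= 1).
{ unfold l. split. left; apply Rdiv_lt_0_compat; lra. apply Rmult_le_reg_r with (1 + h); [lra|]. field_simplify; lra. }
assert (C := ln_Gamma_convex (y - 1) (y + h) l ltac:(lra) ltac:(lra) Hl).
replace (l * (y - 1) + (1 - l) * (y + h)) with y in C by (unfold l; field; lra).
assert (E := ln_Gamma_succ (y - 1) ltac:(lra)). replace (y - 1 + 1) with y in E by ring.
set (A := ln (Gamma y)) in *. set (B := ln (Gamma (y - 1))) in *. set (D := ln (Gamma (y + h))) in *.
assert (C' : A * (1 + h) <= h * B + D).
{ replace (h * B + D) with ((l * B + (1 - l) * D) * (1 + h)) by (unfold l; field; lra).
  apply Rmult_le_compat_r; lra. }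
nra.
Qed.

(** The shifts - 2 and + 1 make the bounds independent of h, of either sign; this uniformity permits
    the passage to the derivative. *)
Lemma ln_Gamma_slope y h : 2 < y -> h <> 0 -> Rabs h <= 1 ->
  ln (y - 2) <= (ln (Gamma (y + h)) - ln (Gamma y)) / h <= ln (y + 1).
Proof.
intros Hy Hh Ha. assert (M : forall u v, 0 < u -> u <= v -> ln u <= ln v) by (intros; apply ln_le; lra).
destruct (Rlt_le_dec h 0) as [N|P].
- rewrite Rabs_left in Ha by auto.
  assert (U := ln_Gamma_upper (y + h) (- h) ltac:(lra) ltac:(lra)).
  assert (L := ln_Gamma_lower (y + h) (- h) ltac:(lra) ltac:(lra)).
  replace (y + h + - h) with y in * by ring.
  assert (M1 := M (y - 2) (y + h - 1) ltac:(lra) ltac:(lra)). assert (M2 := M (y + h) (y + 1) ltac:(lra) ltac:(lra)).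
  replace ((ln (Gamma (y + h)) - ln (Gamma y)) / h) with ((ln (Gamma y) - ln (Gamma (y + h))) / (- h)) by (field; lra).
  split; [apply (proj1 (Rle_div_r _ _ (- h) ltac:(lra))) | apply (proj2 (Rle_div_l _ _ (- h) ltac:(lra)))]; nra.
- rewrite Rabs_pos_eq in Ha by auto.
  assert (U := ln_Gamma_upper y h ltac:(lra) ltac:(lra)).
  assert (L := ln_Gamma_lower y h ltac:(lra) ltac:(lra)).
  assert (M1 := M (y - 2) (y - 1) ltac:(lra) ltac:(lra)). assert (M2 := M y (y + 1) ltac:(lra) ltac:(lra)).
  split; [apply (proj1 (Rle_div_r _ _ h ltac:(lra))) | apply (proj2 (Rle_div_l _ _ h ltac:(lra)))]; nra.
Qed.

Definition psum (x : R) (n : nat) : R := match n with O => 0 | S m => sum_f_R0 (fun k => / (x + INR k)) m end.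

Lemma psum_S x n : psum x (S n) = psum x n + / (x + INR n).
Proof. destruct n; simpl; ring. Qed.

Lemma ln_Gamma_shift x n : 0 < x ->
  ln (Gamma (x + INR (S n))) = ln (Gamma x) + sum_f_R0 (fun k => ln (x + INR k)) n.
Proof.
intros Hx. induction n as [|n IH].
- simpl. rewrite Rplus_0_r. now apply ln_Gamma_succ.
- rewrite tech5, S_INR, <- Rplus_assoc, ln_Gamma_succ, IH. ring.
  generalize (pos_INR (S n)); lra.
Qed.

Lemma sum_ln_derive x n : 0 < x ->
  derivable_pt_lim (fun y => sum_f_R0 (fun k => ln (y + INR k)) n) x (psum x (S n)).
Proof.
intros Hx. assert (D : forall k, derivable_pt_lim (fun y => ln (y + INR k)) x (/ (x + INR k))).
{ intros k. apply is_derive_Reals. auto_derive. generalize (pos_INR k); lra. field. generalize (pos_INR k); lra. }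
induction n as [|n IH].
- simpl. apply (D O).
- rewrite psum_S. apply (derivable_pt_lim_plus (fun y => sum_f_R0 (fun k => ln (y + INR k)) n)); auto.
Qed.

(** Euler's sequence for digamma. With ln (x + n) in place of ln n it is monotone from the start. *)
Definition psi_seq (x : R) (n : nat) : R := ln (x + INR n) - psum x n.

Lemma ln_step y : 0 < y -> / (y + 1) <= ln (y + 1) - ln y <= / y.
Proof.
intros Hy. rewrite <- ln_div by lra. split.
- assert (H := ln_le_sub1 (y / (y + 1)) ltac:(apply Rdiv_lt_0_compat; lra)).
  rewrite ln_div in * by lra. replace (y / (y + 1) - 1) with (- / (y + 1)) in H by (field; lra). lra.
- eapply Rle_trans; [apply ln_le_sub1; apply Rdiv_lt_0_compat; lra|]. right; field; lra.
Qed.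

(** By [ln_step] the sequence decreases, while the sequence minus 1 / (x + n) increases. *)
Lemma psi_seq_cvg x : 0 < x -> ex_finite_lim_seq (psi_seq x).
Proof.
intros Hx. apply (ex_finite_lim_seq_decr _ (ln x - / x)).
- intros n. unfold psi_seq. rewrite psum_S, S_INR. generalize (pos_INR n). intros P.
  generalize (ln_step (x + INR n) ltac:(lra)). replace (x + (INR n + 1)) with (x + INR n + 1) by ring. lra.
- intros n. assert (K : ln x - / x <= psi_seq x n - / (x + INR n)).
  { induction n as [|n IH]. unfold psi_seq; simpl. rewrite Rplus_0_r. lra.
    unfold psi_seq in *. rewrite psum_S, S_INR. generalize (pos_INR n). intros P.
    generalize (ln_step (x + INR n) ltac:(lra)). replace (x + (INR n + 1)) with (x + INR n + 1) by ring. lra. }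
  assert (0 < / (x + INR n)) by (apply Rinv_0_lt_compat; generalize (pos_INR n); lra). lra.
Qed.

Lemma ln_gap (x e : R) : 0 < e -> exists N, forall n, (N <= n)%nat -> 2 < x + INR n /\ ln (x + INR n + 1) - ln (x + INR n - 2) < e.
Proof.
intros He. destruct (nfloor_ex (Rabs x + 3 + 3 / e)) as [N [HN1 HN2]].
{ assert (0 < 3 / e) by (apply Rdiv_lt_0_compat; lra). generalize (Rabs_pos x). lra. }
exists (S N). intros n Hn. assert (INR N + 1 <= INR n) by (rewrite <- S_INR; now apply le_INR).
assert (0 < 3 / e) by (apply Rdiv_lt_0_compat; lra).
assert (- Rabs x <= x) by (generalize (Rle_abs (- x)); rewrite Rabs_Ropp; lra).
assert (Hy : 3 / e + 1 < x + INR n - 2) by lra.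
split. lra. rewrite <- ln_div by lra.
eapply Rle_lt_trans; [apply ln_le_sub1; apply Rdiv_lt_0_compat; lra|].
replace ((x + INR n + 1) / (x + INR n - 2) - 1) with (3 / (x + INR n - 2)) by (field; lra).
apply Rmult_lt_reg_r with (x + INR n - 2); [lra|].
replace (3 / (x + INR n - 2) * (x + INR n - 2)) with 3 by (field; lra).
assert (e * (3 / e) = 3) by (field; lra). nra.
Qed.

(** The functional equation moves the difference quotient of ln Gamma from x to x + n. There
    convexity pins it to ln (x + n) up to an error uniform in h, and the finite sum of logarithms
    contributes - [psum]. Differentiability of Gamma, without which [Derive] would carry no meaning,
    comes out of the same estimate. *)
Lemma digamma_limit x : 0 < x -> is_lim_seq (psi_seq x) (digamma x).
Proof.
intros Hx. destruct (psi_seq_cvg x Hx) as [d Hd].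
replace (digamma x) with d; auto.
assert (D : derivable_pt_lim (fun y => ln (Gamma y)) x d).
{ intros e He. apply is_lim_seq_Reals in Hd. destruct (Hd (e / 3) ltac:(lra)) as [N1 HN1].
  destruct (ln_gap x (e / 3) ltac:(lra)) as [N2 HN2].
  set (n := S (N1 + N2)). specialize (HN1 n ltac:(lia)). destruct (HN2 n ltac:(lia)) as [Hy G]. unfold Rdist in HN1.
  destruct (sum_ln_derive x (N1 + N2) Hx (e / 3) ltac:(lra)) as [dl Hdl].
  assert (Hm : 0 < Rmin dl (Rmin 1 (x / 2))) by (apply Rmin_pos; [apply dl | apply Rmin_pos; lra]).
  exists (mkposreal _ Hm). intros h Hh Hh'. simpl in Hh'.
  assert (B1 := Rmin_l dl (Rmin 1 (x / 2))). assert (B2 := Rmin_r dl (Rmin 1 (x / 2))).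
  assert (B3 := Rmin_l 1 (x / 2)). assert (B4 := Rmin_r 1 (x / 2)).
  specialize (Hdl h Hh ltac:(lra)). fold n in Hdl.
  assert (Hxh : 0 < x + h) by (apply Rabs_def2 in Hh'; lra).
  assert (S := ln_Gamma_slope (x + INR n) h Hy Hh ltac:(lra)).
  assert (E1 := ln_Gamma_shift x (N1 + N2) Hx). assert (E2 := ln_Gamma_shift (x + h) (N1 + N2) Hxh). fold n in E1, E2.
  replace (x + INR n + h) with (x + h + INR n) in S by ring. rewrite E1, E2 in S.
  set (T1 := sum_f_R0 (fun k => ln (x + INR k)) (N1 + N2)) in *.
  set (T2 := sum_f_R0 (fun k => ln (x + h + INR k)) (N1 + N2)) in *.
  set (q := (ln (Gamma (x + h)) - ln (Gamma x)) / h).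
  replace ((ln (Gamma (x + h)) + T2 - (ln (Gamma x) + T1)) / h) with (q + (T2 - T1) / h) in S by (unfold q; field; auto).
  unfold psi_seq in HN1.
  assert (M1 : ln (x + INR n) <= ln (x + INR n + 1)) by (apply ln_le; lra).
  assert (M2 : ln (x + INR n - 2) <= ln (x + INR n)) by (apply ln_le; lra).
  apply Rabs_def2 in HN1. apply Rabs_def2 in Hdl. apply Rabs_def1; lra. }
assert (DG : is_derive Gamma x (Gamma x * d)).
{ apply is_derive_ext_loc with (fun y => exp (ln (Gamma y))).
  - exists (mkposreal x Hx). intros y Hy. change (Rabs (y - x) < x) in Hy. apply Rabs_def2 in Hy.
    apply exp_ln, Gamma_pos. lra.
  - rewrite <- (exp_ln (Gamma x)) at 1 by now apply Gamma_pos. rewrite Rmult_comm.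
    apply (is_derive_comp (K := R_AbsRing) (V := R_NormedModule) exp (fun y => ln (Gamma y))).
    apply is_derive_Reals, derivable_pt_lim_exp. now apply is_derive_Reals. }
unfold digamma. rewrite (is_derive_unique _ _ _ DG). field. generalize (Gamma_pos x Hx); lra.
Qed.

Lemma digamma_succ x : 0 < x -> digamma (x + 1) = digamma x + / x.
Proof.
intros Hx. assert (H1 := digamma_limit x Hx). assert (H2 := digamma_limit (x + 1) ltac:(lra)).
apply is_lim_seq_incr_1 in H1.
assert (E : forall n, psi_seq (x + 1) n = psi_seq x (S n) + / x).
{ intros n. unfold psi_seq. rewrite S_INR. replace (x + 1 + INR n) with (x + (INR n + 1)) by ring.
  assert (P : psum x (S n) = psum (x + 1) n + / x).
  { induction n as [|n IH]. simpl. rewrite Rplus_0_r. ring.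
    rewrite psum_S, IH, psum_S, S_INR. replace (x + 1 + INR n) with (x + (INR n + 1)) by ring. ring. }
  rewrite P. ring. }
apply (is_lim_seq_ext _ _ _ E) in H2.
assert (H3 : is_lim_seq (fun n => psi_seq x (S n) + / x) (digamma x + / x)).
{ apply is_lim_seq_plus'; auto. apply is_lim_seq_const. }
apply is_lim_seq_unique in H2. apply is_lim_seq_unique in H3. rewrite H2 in H3. now injection H3.
Qed.

(** 1 / (k + 1/2) = 2 / (2k + 1), and the odd terms of the harmonic sum are all terms minus the even
    ones. *)
Lemma psum_half n : psum (1 / 2) n = 2 * psum 1 (2 * n) - psum 1 n.
Proof.
induction n as [|n IH]. simpl; ring.
replace (2 * S n)%nat with (S (S (2 * n))) by lia.
rewrite !psum_S, IH, S_INR, mult_INR. simpl (INR 2). generalize (pos_INR n). intros. field. lra.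
Qed.

Lemma digamma_half : digamma (1 / 2) - digamma 1 = - 2 * ln 2.
Proof.
assert (H1 := digamma_limit 1 ltac:(lra)). assert (H2 := digamma_limit (1 / 2) ltac:(lra)).
assert (H3 : is_lim_seq (fun n => psi_seq 1 (2 * n)) (digamma 1)).
{ apply (is_lim_seq_subseq (psi_seq 1) _ (fun n => (2 * n)%nat)); auto.
  apply eventually_subseq. intros n; lia. }
(* The logarithms that remain once [psum_half] has cancelled the harmonic sums in psi_seq (1/2) n -
   2 psi_seq 1 (2n) + psi_seq 1 n. *)
assert (Lg : is_lim_seq (fun n => ln ((1 / 2 + INR n) * (1 + INR n) / (1 + 2 * INR n) ^ 2)) (ln (1 / 4))).
{ apply (is_lim_seq_continuous ln (fun n => (1 / 2 + INR n) * (1 + INR n) / (1 + 2 * INR n) ^ 2) (1/4)).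
  - apply continuity_pt_filterlim. apply (ex_derive_continuous (K := R_AbsRing) (V := R_NormedModule) ln). auto_derive. lra.
  - assert (I : is_lim_seq (fun n => / (1 + 2 * INR n)) 0).
    { replace (Finite 0) with (Rbar_inv p_infty) by reflexivity. apply is_lim_seq_inv; [|easy].
      apply (is_lim_seq_le_p_loc INR). exists O. intros n _. generalize (pos_INR n); lra. apply is_lim_seq_INR. }
    apply is_lim_seq_ext with (fun n => 1 / 4 + 1 / 4 * / (1 + 2 * INR n)).
    intros n. generalize (pos_INR n). intros. field. lra.
    replace (Finite (1 / 4)) with (Finite (1 / 4 + 1 / 4 * 0)) by (f_equal; ring).
    apply is_lim_seq_plus'. apply is_lim_seq_const. apply (is_lim_seq_scal_l _ (1 / 4) 0 I). }
assert (H4 : is_lim_seq (fun n => psi_seq (1 / 2) n - 2 * psi_seq 1 (2 * n) + psi_seq 1 n) (digamma (1 / 2) - 2 * digamma 1 + digamma 1)).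
{ apply is_lim_seq_plus'; auto. apply is_lim_seq_minus'; auto. apply (is_lim_seq_scal_l _ 2 (digamma 1)). exact H3. }
assert (H5 : is_lim_seq (fun n => psi_seq (1 / 2) n - 2 * psi_seq 1 (2 * n) + psi_seq 1 n) (ln (1 / 4))).
{ eapply is_lim_seq_ext; [|exact Lg]. intros n. unfold psi_seq. rewrite psum_half, mult_INR. simpl (INR 2).
  generalize (pos_INR n). intros P. 
  rewrite ln_div, ln_mult, ln_pow by (try apply pow_lt; try apply Rmult_lt_0_compat; lra). simpl INR. change (1 + 1) with 2. ring. }
apply is_lim_seq_unique in H4. apply is_lim_seq_unique in H5. rewrite H4 in H5. injection H5. intros E.
replace (1 / 4) with (/ (2 ^ 2)) in E by field. rewrite ln_Rinv, ln_pow in E by lra. simpl in E. lra.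
Qed.

(** * The Frobenius solutions at the origin *)

(** The Taylor coefficients of F(1/2, 1/2; 1); the factor k! in the denominator of the general
    formula cancels (1)_k. *)
Definition hc (k : nat) : R := (pochhammer (1 / 2) k / INR (fact k)) ^ 2.

(** The bracket in the series of g without its logarithm. *)
Definition hd (k : nat) : R := digamma (1 / 2 + INR k) + digamma (1 / 2 + INR k) - 2 * digamma (INR k + 1).

Lemma INR_fact_pos k : 0 < INR (fact k).
Proof. apply lt_0_INR, lt_O_fact. Qed.

Lemma hc_S k : hc (S k) = hc k * ((INR k + 1 / 2) / (INR k + 1)) ^ 2.
Proof.
unfold hc. simpl pochhammer. rewrite fact_simpl, mult_INR, S_INR.
generalize (INR_fact_pos k) (pos_INR k). intros. field. lra.
Qed.

Lemma hc_0 : hc 0 = 1.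
Proof. unfold hc. simpl. field. Qed.

Lemma hc_bound k : 0 < hc k <= 1.
Proof.
induction k as [|k IH]. rewrite hc_0. lra. rewrite hc_S. generalize (pos_INR k). intros P.
set (q := (INR k + 1 / 2) / (INR k + 1)).
assert (Q : 0 < q <= 1).
{ unfold q. split. apply Rdiv_lt_0_compat; lra. apply Rmult_le_reg_r with (INR k + 1). lra.
  unfold Rdiv at 1. rewrite Rmult_assoc, Rinv_l by lra. lra. }
assert (0 < q ^ 2 <= 1) by (simpl; nra). nra.
Qed.

Lemma hd_S k : hd (S k) = hd k + 2 / (INR k + 1 / 2) - 2 / (INR k + 1).
Proof.
unfold hd. rewrite S_INR. generalize (pos_INR k). intros P.
replace (1 / 2 + (INR k + 1)) with (1 / 2 + INR k + 1) by ring.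
rewrite !digamma_succ by lra. field. lra.
Qed.

Lemma hd_0 : hd 0 = - 4 * ln 2.
Proof.
unfold hd. simpl INR. rewrite Rplus_0_r, Rplus_0_l. generalize digamma_half. lra.
Qed.

Lemma hd_bound k : Rabs (hd k) <= 4.
Proof.
assert (L : 0 <= ln 2 <= 1).
{ split. rewrite <- ln_1. apply ln_le; lra. generalize (ln_le_sub1 2). lra. }
(* The increment of [hd] is at most 4 / (k + 1) - 4 / (k + 2), so the upper bound telescopes; the
   initial value - 4 ln 2 lies in [- 4, 0]. *)
assert (K : - 4 <= hd k <= 4 - 4 / (INR k + 1)).
{ induction k as [|k IH]. rewrite hd_0. simpl. lra.
  rewrite hd_S, S_INR. generalize (pos_INR k). intros P.
  assert (D : 2 / (INR k + 1 / 2) - 2 / (INR k + 1) = / ((INR k + 1 / 2) * (INR k + 1))) by (field; lra).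
  assert (D2 : 4 / (INR k + 1) - 4 / (INR k + 1 + 1) = 4 / ((INR k + 1) * (INR k + 2))) by (field; lra).
  assert (0 < / ((INR k + 1 / 2) * (INR k + 1))) by (apply Rinv_0_lt_compat; nra).
  assert (D3 : / ((INR k + 1 / 2) * (INR k + 1)) <= 4 / ((INR k + 1) * (INR k + 2))).
  { replace (4 / ((INR k + 1) * (INR k + 2))) with (/ ((INR k + 2) / 4 * (INR k + 1))) by (field; lra).
    apply Rinv_le_contravar; nra. }
  lra. }
assert (0 < 4 / (INR k + 1)) by (apply Rdiv_lt_0_compat; [lra | generalize (pos_INR k); lra]).
apply Rabs_le. lra.
Qed.

Definition ca (k : nat) : C := RtoC (hc k).
Definition ea (k : nat) : C := RtoC (hc k * hd k).

Lemma ca_radius : cradius ca 1.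
Proof. exists 1. intros k. unfold ca. rewrite pow1, Cmod_R, Rabs_pos_eq; generalize (hc_bound k); lra. Qed.

Lemma ea_radius : cradius ea 1.
Proof.
exists 4. intros k. unfold ea. rewrite pow1, Cmod_R, Rabs_mult, (Rabs_pos_eq (hc k)) by (generalize (hc_bound k); lra).
generalize (hc_bound k) (hd_bound k) (Rabs_pos (hd k)). nra.
Qed.

Definition Fhyp : C -> C := PS ca.
(** The analytic part of g, so that g = [Fhyp] log + [Hhyp] for every branch of the logarithm. *)
Definition Hhyp : C -> C := PS ea.

Lemma pochhammer_1 k : pochhammer 1 k = INR (fact k).
Proof.
induction k as [|k IH]. reflexivity. simpl pochhammer. rewrite IH, fact_simpl, mult_INR, S_INR. ring.
Qed.

Lemma hyperF_Fhyp x : hyperF (1 / 2) (1 / 2) 1 x = Fhyp x.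
Proof.
apply CSeries_ext. intros k. f_equal. unfold ca, hc. rewrite pochhammer_1. f_equal.
field. generalize (INR_fact_pos k). lra.
Qed.

Lemma hyperg_Fhyp_Hhyp x : Cmod x < 1 -> hyperg (1 / 2) (1 / 2) x = (Fhyp x * Clog x + Hhyp x)%C.
Proof.
intros Hx. unfold Fhyp, Hhyp, PS. rewrite (Cmult_comm _ (Clog x)), <- CSeries_scal, <- CSeries_plus.
- apply CSeries_ext. intros k. unfold ca, ea, hc.
  replace (pochhammer (1 / 2) k * pochhammer (1 / 2) k / INR (fact k) ^ 2) with ((pochhammer (1 / 2) k / INR (fact k)) ^ 2).
  2:{ field. generalize (INR_fact_pos k). lra. }
  fold (hc k). fold (hd k). rewrite RtoC_mult. ring.
- apply csummable_scal. apply cradius_summable with 1; auto using ca_radius.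
- apply cradius_summable with 1; auto using ea_radius.
- apply cradius_summable with 1; auto using ca_radius.
Qed.

Definition PS_X (a : nat -> C) (k : nat) : C := match k with O => RtoC 0 | S j => a j end.

Lemma PS_mulX a r z : Cmod z < r -> cradius a r -> (z * PS a z)%C = PS (PS_X a) z.
Proof.
intros Hz Ha. assert (S0 := cradius_summable a r z Hz Ha).
assert (S1 : csummable (fun k => PS_X a (S k) * z ^ S k)%C).
{ apply (csummable_le _ (fun k => Cmod z * Cmod (a k * z ^ k))).
  intros k. simpl. rewrite !Cmod_mult. right; ring. now apply (ex_series_scal (V := R_NormedModule)). }
unfold PS. rewrite (CSeries_shift (fun k => PS_X a k * z ^ k)%C) by (now apply csummable_shift).
simpl PS_X. rewrite Cmult_0_l, Cplus_0_l, <- CSeries_scal by exact S0.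
apply CSeries_ext. intros k. simpl. ring.
Qed.

Lemma cradius_X a r : 0 <= r -> cradius a r -> cradius (PS_X a) r.
Proof.
intros Hr [M HM]. exists (Rabs M * (r + 1)). intros [|k]; simpl.
- rewrite Cmod_0, Rmult_0_l. apply Rmult_le_pos. apply Rabs_pos. lra.
- replace (Cmod (a k) * (r * r ^ k)) with (Cmod (a k) * r ^ k * r) by ring.
  generalize (HM k) (Rle_abs M) (Rabs_pos M). nra.
Qed.

Lemma PS_lin a b (p q : C) r z : Cmod z < r -> cradius a r -> cradius b r ->
  (p * PS a z + q * PS b z)%C = PS (fun k => p * a k + q * b k)%C z.
Proof.
intros Hz Ha Hb. unfold PS. rewrite <- !CSeries_scal, <- CSeries_plus by
 (try apply csummable_scal; now apply cradius_summable with r).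
apply CSeries_ext. intros k. ring.
Qed.

Lemma cradius_lin a b (p q : C) r : 0 <= r -> cradius a r -> cradius b r -> cradius (fun k => p * a k + q * b k)%C r.
Proof.
intros Hr [M HM] [N HN]. exists (Cmod p * M + Cmod q * N). intros k.
assert (P : 0 <= r ^ k) by now apply pow_le.
apply Rle_trans with ((Cmod p * Cmod (a k) + Cmod q * Cmod (b k)) * r ^ k).
apply Rmult_le_compat_r; auto. eapply Rle_trans; [apply Cmod_triangle|]. rewrite !Cmod_mult. lra.
assert (A1 := Rmult_le_compat_l _ _ _ (Cmod_ge_0 p) (HM k)).
assert (A2 := Rmult_le_compat_l _ _ _ (Cmod_ge_0 q) (HN k)). lra.
Qed.

Lemma cradius_le a r s : 0 <= s <= r -> cradius a r -> cradius a s.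
Proof.
intros Hs [M HM]. exists M. intros k. eapply Rle_trans; [|apply (HM k)].
apply Rmult_le_compat_l. apply Cmod_ge_0. apply pow_incr. lra.
Qed.

Lemma PS_ext a b z : (forall k, a k = b k) -> PS a z = PS b z.
Proof. intros H. apply CSeries_ext. intros k. now rewrite H. Qed.

Lemma hyp_ode_coefficients a z : cradius a 1 -> Cmod z < 1 ->
  (z * (1 - z) * PS (PS_d (PS_d a)) z + (1 - 2 * z) * PS (PS_d a) z - PS a z / 4)%C =
  PS (fun k => RtoC ((INR k + 1) ^ 2) * a (S k) - RtoC ((INR k + 1 / 2) ^ 2) * a k)%C z.
Proof.
intros Ha Hz. pose proof (Cmod_ge_0 z) as Z0.
(* Two radii between |z| and 1, one for each differentiation of the series. *)
set (s1 := (Cmod z + 3) / 4). set (s := (Cmod z + 1) / 2).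
assert (Hs : Cmod z < s < s1 /\ s1 < 1) by (unfold s, s1; lra).
assert (R1 : cradius (PS_d a) s1) by (apply cradius_d with 1; auto; lra).
assert (R2 : cradius (PS_d (PS_d a)) s) by (apply cradius_d with s1; auto; lra).
assert (R1' : cradius (PS_d a) s) by (apply cradius_le with s1; auto; lra).
assert (R0 : cradius a s) by (apply cradius_le with 1; auto; lra).
assert (X2 := cradius_X _ s ltac:(lra) R2). assert (X1 := cradius_X _ s ltac:(lra) R1').
transitivity ((1 * (z * PS (PS_d (PS_d a)) z) + (- (1)) * (z * (z * PS (PS_d (PS_d a)) z)))
   + (1 * (1 * PS (PS_d a) z + (- (2)) * (z * PS (PS_d a) z)) + (- / 4) * PS a z))%C.
field.
assert (XX := cradius_X _ s ltac:(lra) X2).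
rewrite (PS_mulX _ s z) by (auto; lra). rewrite (PS_mulX _ s z) by (auto; lra).
rewrite (PS_mulX (PS_d a) s z) by (auto; lra).
rewrite (PS_lin _ _ _ _ s z) by (auto; lra).
rewrite (PS_lin (PS_d a) _ _ _ s z) by (auto; lra).
rewrite (PS_lin _ a _ _ s z); [| lra | apply cradius_lin; auto; lra | auto].
match goal with |- (PS ?u z + PS ?v z)%C = _ => transitivity (1 * PS u z + 1 * PS v z)%C; [ring|] end.
rewrite (PS_lin _ _ _ _ s z); [| lra | apply cradius_lin; auto; lra | apply cradius_lin; auto; try lra; apply cradius_lin; auto; lra].
apply PS_ext. intros k.
assert (C4 : RtoC ((INR k + 1 / 2) ^ 2) = (RtoC (INR k) * RtoC (INR k) + RtoC (INR k) + / 4)%C).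
{ replace ((INR k + 1 / 2) ^ 2) with (INR k * INR k + INR k + / 4) by field.
  rewrite !RtoC_plus, RtoC_mult, RtoC_inv by lra. reflexivity. }
rewrite C4, RtoC_pow, RtoC_plus.
destruct k as [|[|k]]; unfold PS_X, PS_d; rewrite ?S_INR, ?RtoC_plus; simpl (INR 0); field.
Qed.

Definition unit_disc (z : C) : Prop := Cmod z < 1.

Lemma unit_disc_open z : unit_disc z -> locally z unit_disc.
Proof.
intros H. unfold unit_disc in *. replace z with (z - 0)%C in H by ring.
generalize (locally_open_ball 0 z 1 H). apply locally_imp. intros y. now replace (y - 0)%C with y by ring.
Qed.

Lemma PS_analytic a z : cradius a 1 -> unit_disc z -> analytic_at (PS a) z.
Proof.
intros Ha Hz. assert (A0 : analytic_at (PS a) 0).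
{ apply analytic_at_PS. exists a, 1. split; [lra|]. split; auto. intros y _. f_equal. ring. }
pose proof (Cmod_ge_0 z) as Z0. unfold unit_disc in Hz.
apply analytic_intro with (PS (PS_d a)). generalize (unit_disc_open z Hz). apply locally_imp. intros y Hy.
pose proof (Cmod_ge_0 y) as Y0. unfold unit_disc in Hy.
split. now apply PS_cderiv with 1. 
eapply cderiv_ccont. apply (PS_cderiv (PS_d a) ((Cmod y + 1) / 2)). lra. apply cradius_d with 1; auto. lra.
Qed.

Lemma PS_derive1 a z : cradius a 1 -> unit_disc z -> C_derive (PS a) z = PS (PS_d a) z.
Proof. intros Ha Hz. apply C_derive_unique. now apply PS_cderiv with 1. Qed.

Lemma PS_derive2 a z : cradius a 1 -> unit_disc z -> C_derive (C_derive (PS a)) z = PS (PS_d (PS_d a)) z.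
Proof.
intros Ha Hz. apply C_derive_unique. apply cderiv_ext_loc with (PS (PS_d a)).
- generalize (unit_disc_open z Hz). apply locally_imp. intros y Hy. now rewrite PS_derive1.
- unfold unit_disc in Hz. pose proof (Cmod_ge_0 z).
  apply (PS_cderiv (PS_d a) ((Cmod z + 1) / 2)). lra. apply cradius_d with 1; auto. lra.
Qed.

Lemma Fhyp_sol : sol_on unit_disc Fhyp.
Proof.
intros z Hz. split. apply PS_analytic; auto using ca_radius.
unfold hyp_ode, Fhyp. rewrite PS_derive2, PS_derive1 by auto using ca_radius.
rewrite hyp_ode_coefficients by auto using ca_radius.
unfold PS. apply CSeries_0. intros k. unfold ca. rewrite hc_S, <- !RtoC_mult, <- RtoC_minus.
replace ((INR k + 1) ^ 2 * (hc k * ((INR k + 1 / 2) / (INR k + 1)) ^ 2) - (INR k + 1 / 2) ^ 2 * hc k) with 0.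
ring. field. generalize (pos_INR k); lra.
Qed.

Lemma Hhyp_analytic z : unit_disc z -> analytic_at Hhyp z.
Proof. intros. apply PS_analytic; auto using ea_radius. Qed.

(* What is left of the equation for [Fhyp log + Hhyp] once the terms in [log] cancel. *)
Lemma Hhyp_ode z : unit_disc z ->
  (z * (1 - z) * C_derive (C_derive Hhyp) z + (1 - 2 * z) * C_derive Hhyp z - Hhyp z / 4
   + 2 * (1 - z) * C_derive Fhyp z - Fhyp z)%C = 0.
Proof.
intros Hz. unfold Hhyp, Fhyp. rewrite PS_derive2, !PS_derive1 by auto using ea_radius, ca_radius.
rewrite hyp_ode_coefficients by auto using ea_radius.
unfold unit_disc in Hz. pose proof (Cmod_ge_0 z) as Z0.
set (s1 := (Cmod z + 3) / 4). set (s := (Cmod z + 1) / 2).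
assert (Hs : Cmod z < s < s1 /\ s1 < 1) by (unfold s, s1; lra).
assert (Rd : cradius (PS_d ca) s) by (apply cradius_d with 1; [lra | apply ca_radius]).
assert (Rc : cradius ca s) by (apply cradius_le with 1; [lra | apply ca_radius]).
assert (RX := cradius_X _ s ltac:(lra) Rd).
set (oc := (fun k => RtoC ((INR k + 1) ^ 2) * ea (S k) - RtoC ((INR k + 1 / 2) ^ 2) * ea k)%C).
set (tc := (fun k => 1 * (2 * PS_d ca k + (- (2)) * PS_X (PS_d ca) k) + (- (1)) * ca k)%C).
assert (E : (2 * (1 - z) * PS (PS_d ca) z - PS ca z)%C = PS tc z).
{ transitivity (1 * (2 * PS (PS_d ca) z + (- (2)) * (z * PS (PS_d ca) z)) + (- (1)) * PS ca z)%C. ring.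
  rewrite (PS_mulX _ s z) by (auto; lra). rewrite (PS_lin (PS_d ca) _ _ _ s z) by (auto; lra).
  rewrite (PS_lin _ ca _ _ s z); [reflexivity | lra | apply cradius_lin; auto; lra | auto]. }
transitivity (PS oc z + (2 * (1 - z) * PS (PS_d ca) z - PS ca z))%C; [ring|]. rewrite E.
(* Since (k + 1)^2 hc (k + 1) = (k + 1/2)^2 hc k, only the increment of [hd] survives in [oc k]. *)
assert (O : forall k, oc k = (- tc k)%C).
{ intros k. unfold oc, tc. transitivity (RtoC (- (2 * (INR k + 1) * hc (S k) - 2 * INR k * hc k - hc k))).
  - unfold ea. rewrite hd_S, hc_S, <- !RtoC_mult, <- RtoC_minus. f_equal. field.
    generalize (pos_INR k); lra.
  - assert (X : PS_X (PS_d ca) k = RtoC (INR k * hc k)).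
    { destruct k as [|k]; unfold PS_X, PS_d, ca. simpl. now rewrite Rmult_0_l. now rewrite RtoC_mult. }
    rewrite X. unfold PS_d, ca. rewrite S_INR. rewrite RtoC_opp, !RtoC_minus, !RtoC_mult, !RtoC_plus. ring. }
rewrite (PS_ext _ _ _ O).
assert (Rt : cradius tc s) by (apply cradius_lin; auto; try lra; apply cradius_lin; auto; lra).
transitivity (PS (fun k => - tc k) z + 1 * PS tc z)%C; [ring|].
rewrite (PS_ext (fun k => - tc k)%C (fun k => (- (1)) * tc k + 0 * tc k)%C) by (intros; ring).
rewrite <- (PS_lin tc tc _ _ s z) by (auto; lra). ring.
Qed.

Lemma frobenius_analytic (l : C -> C) z : unit_disc z -> analytic_at l z ->
  analytic_at (fun y => Fhyp y * l y + Hhyp y)%C z.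
Proof.
intros Hz Hl. apply analytic_plus; [|now apply Hhyp_analytic]. apply analytic_mult; auto. now apply Fhyp_sol.
Qed.

Lemma frobenius_derive (l : C -> C) z : unit_disc z -> cderiv l z (/ z) ->
  C_derive (fun y => Fhyp y * l y + Hhyp y)%C z = (C_derive Fhyp z * l z + Fhyp z * / z + C_derive Hhyp z)%C.
Proof.
intros Hz Hl. apply C_derive_unique. apply cderiv_plus; [|now apply analytic_cderiv, Hhyp_analytic].
apply cderiv_mult; auto. now apply analytic_cderiv, Fhyp_sol.
Qed.

(** The branch [l] of the logarithm enters through its derivative alone, so the result serves both
    for [Clog z] on the cut plane and for Clog (- z) + i pi on the plane slit along the positive
    axis. *)
Lemma frobenius_sol (U : C -> Prop) (l : C -> C) : (forall z, U z -> locally z U) ->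
  (forall z, U z -> unit_disc z /\ z <> 0 /\ cderiv l z (/ z)) -> sol_on U (fun y => Fhyp y * l y + Hhyp y)%C.
Proof.
intros Uo H z Hz. destruct (H z Hz) as [Dz [Nz Lz]].
assert (Al : analytic_at l z).
{ apply analytic_intro with (fun y => / y)%C. generalize (Uo z Hz). apply locally_imp. intros y Hy.
  destruct (H y Hy) as [_ [N L]]. split; auto. apply (ccont_inv (fun y => y)); auto. apply ccont_id. }
split. now apply frobenius_analytic.
unfold hyp_ode. destruct (Fhyp_sol z Dz) as [AF OF]. assert (AH := Hhyp_analytic z Dz).
rewrite (frobenius_derive l z Dz Lz).
assert (E2 : C_derive (C_derive (fun y => Fhyp y * l y + Hhyp y)%C) z =
  (C_derive (C_derive Fhyp) z * l z + C_derive Fhyp z * / z + (C_derive Fhyp z * / z + Fhyp z * (- (1) / (z * z))) + C_derive (C_derive Hhyp) z)%C).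
{ apply C_derive_unique. apply cderiv_ext_loc with (fun y => C_derive Fhyp y * l y + Fhyp y * / y + C_derive Hhyp y)%C.
  - generalize (Uo z Hz). apply locally_imp. intros y Hy. symmetry. destruct (H y Hy) as [? [? ?]]. now apply frobenius_derive.
  - apply cderiv_plus; [|now apply analytic_cderiv, analytic_derive].
    apply (cderiv_plus (fun y => C_derive Fhyp y * l y)%C (fun y => Fhyp y * / y)%C); apply cderiv_mult; auto.
    now apply analytic_cderiv, analytic_derive. now apply analytic_cderiv.
    apply (cderiv_inv (fun y => y)); auto. apply cderiv_id. }
rewrite E2. assert (OH := Hhyp_ode z Dz). unfold hyp_ode in OF.
transitivity (l z * (z * (1 - z) * C_derive (C_derive Fhyp) z + (1 - 2 * z) * C_derive Fhyp z - Fhyp z / 4)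
  + (z * (1 - z) * C_derive (C_derive Hhyp) z + (1 - 2 * z) * C_derive Hhyp z - Hhyp z / 4
   + 2 * (1 - z) * C_derive Fhyp z - Fhyp z))%C.
field. auto. rewrite OF, OH. ring.
Qed.

Lemma frobenius_wron (l : C -> C) z : unit_disc z -> z <> 0 -> cderiv l z (/ z) ->
  (z * (1 - z) * wron Fhyp (fun y => Fhyp y * l y + Hhyp y) z)%C = 1.
Proof.
intros Dz Nz Lz.
(* z (1 - z) times the Wronskian: the logarithms cancel and the pole 1 / z is absorbed. The
   expression makes sense at 0, where its value is F(0)^2 = 1. *)
set (K := fun z => ((1 - z) * (Fhyp z * Fhyp z + z * (Fhyp z * C_derive Hhyp z - C_derive Fhyp z * Hhyp z)))%C).
assert (EK : K z = K 0).
{ apply cderiv_zero_segment. intros t Ht.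
  assert (Dx : unit_disc (segment 0 z t)).
  { unfold unit_disc. replace (segment 0 z t) with (segment 0 z t - 0)%C by ring. apply segment_ball; auto.
    rewrite Cmod_sub_0. lra. now replace (z - 0)%C with z by ring. }
  set (x := segment 0 z t) in *. clearbody x.
  destruct (Fhyp_sol x Dx) as [AF OF]. assert (AH := Hhyp_analytic x Dx). assert (OH := Hhyp_ode x Dx). unfold hyp_ode in OF.
  assert (D1 := analytic_cderiv _ _ AF). assert (D2 := analytic_cderiv _ _ (analytic_derive _ _ AF)).
  assert (D3 := analytic_cderiv _ _ AH). assert (D4 := analytic_cderiv _ _ (analytic_derive _ _ AH)).
  unfold K. eapply cderiv_eq.
  - apply (cderiv_mult (fun z => 1 - z)%C). apply cderiv_minus. apply cderiv_const. apply cderiv_id.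
    apply (cderiv_plus (fun z => Fhyp z * Fhyp z)%C). apply cderiv_mult; eassumption.
    apply (cderiv_mult (fun z => z)). apply cderiv_id.
    apply (cderiv_minus (fun z => Fhyp z * C_derive Hhyp z)%C (fun z => C_derive Fhyp z * Hhyp z)%C); apply cderiv_mult; eassumption.
  - transitivity (Fhyp x * (x * (1 - x) * C_derive (C_derive Hhyp) x + (1 - 2 * x) * C_derive Hhyp x - Hhyp x / 4
       + 2 * (1 - x) * C_derive Fhyp x - Fhyp x)
      - Hhyp x * (x * (1 - x) * C_derive (C_derive Fhyp) x + (1 - 2 * x) * C_derive Fhyp x - Fhyp x / 4))%C.
    field. rewrite OF, OH. ring. }
transitivity (K z).
- unfold wron. rewrite frobenius_derive by auto. unfold K. field. auto.
- rewrite EK. unfold K, Fhyp. rewrite PS_0. unfold ca. rewrite hc_0. ring.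
Qed.

(** * The complex logarithm *)

(* Coquelicot types equalities in carriers of canonical structures, which [ring]
   and [field] do not recognise as [R]. *)
Ltac as_R := match goal with |- @eq _ ?a ?b => change (@eq R a b) end.

Lemma cderiv_eps f z l :
  (forall e, 0 < e -> locally z (fun y => Cmod (f y - f z - l * (y - z)) <= e * Cmod (y - z))) ->
  cderiv f z l.
Proof.
intros H. exists (fun y => if Ceq_dec y z then l else (f y - f z) / (y - z))%C. split; [|split].
- intros e He. destruct (Ceq_dec z z) as [_|N]; [|easy].
  generalize (H (e / 2) ltac:(lra)). apply locally_imp. intros y Hy.
  destruct (Ceq_dec y z) as [->|N]. now rewrite Cmod_sub_0.
  assert (N' : (y - z)%C <> RtoC 0) by now apply Cminus_eq_contra.
  assert (Hp : 0 < Cmod (y - z)) by now apply Cmod_gt_0.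
  replace ((f y - f z) / (y - z) - l)%C with ((f y - f z - l * (y - z)) / (y - z))%C by (field; auto).
  rewrite Cmod_div by auto. apply Rlt_div_l; auto. nra.
- now destruct (Ceq_dec z z).
- apply locally_all. intros y. destruct (Ceq_dec y z) as [->|N]; [ring|].
  field. now apply Cminus_eq_contra.
Qed.

Lemma partial_derivatives_eps (u ux : R -> R -> R) (x y uy : R) :
  locally (T := prod_UniformSpace R_UniformSpace R_UniformSpace) (x, y)
    (fun p => is_derive (fun s => u s (snd p)) (fst p) (ux (fst p) (snd p))) ->
  is_derive (fun s => u x s) y uy ->
  continuous (U := R_UniformSpace) (fun p : R * R => ux (fst p) (snd p)) (x, y) ->
  forall e, 0 < e -> locally ((x, y) : C) (fun w : C =>
    Rabs (u (Re w) (Im w) - u x y - ((Re w - x) * ux x y + (Im w - y) * uy)) <= e * Cmod (w - (x, y))).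
Proof.
intros H1 H2 H3 e He.
destruct (is_derive_filterdiff u x y ux uy H1 H2 H3) as [_ D].
specialize (D (x, y) (fun P HP => HP) (mkposreal e He)). simpl in D.
revert D. apply locally_imp. intros w D. eapply Rle_trans; [exact D|]. right. f_equal.
change (sqrt (Rabs (Re w - x) ^ 2 + Rabs (Im w - y) ^ 2) = sqrt ((Re w - x) ^ 2 + (Im w - y) ^ 2)).
now rewrite !pow2_abs.
Qed.

(** The Cauchy-Riemann equations are built into the hypotheses: the derivatives in y are given as -
    [vx] and [ux]. *)
Lemma cauchy_riemann (u ux v vx : R -> R -> R) (x y : R) :
  locally (T := prod_UniformSpace R_UniformSpace R_UniformSpace) (x, y)
    (fun p => is_derive (fun s => u s (snd p)) (fst p) (ux (fst p) (snd p))) ->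
  is_derive (fun s => u x s) y (- vx x y) ->
  continuous (U := R_UniformSpace) (fun p : R * R => ux (fst p) (snd p)) (x, y) ->
  locally (T := prod_UniformSpace R_UniformSpace R_UniformSpace) (x, y)
    (fun p => is_derive (fun s => v s (snd p)) (fst p) (vx (fst p) (snd p))) ->
  is_derive (fun s => v x s) y (ux x y) ->
  continuous (U := R_UniformSpace) (fun p : R * R => vx (fst p) (snd p)) (x, y) ->
  cderiv (fun w => (u (Re w) (Im w), v (Re w) (Im w))) (x, y) (ux x y, vx x y).
Proof.
intros H1 H2 H3 H4 H5 H6. apply cderiv_eps. intros e He.
assert (A := partial_derivatives_eps u ux x y _ H1 H2 H3 (e / 2) ltac:(lra)).
assert (B := partial_derivatives_eps v vx x y _ H4 H5 H6 (e / 2) ltac:(lra)).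
generalize (locally_and _ _ _ A B). apply locally_imp. intros w [A1 B1].
eapply Rle_trans; [apply Cmod_le_Re_Im|].
match goal with |- Rabs ?p + Rabs ?q <= _ =>
  replace p with (u (Re w) (Im w) - u x y - ((Re w - x) * ux x y + (Im w - y) * - vx x y));
  [replace q with (v (Re w) (Im w) - v x y - ((Re w - x) * vx x y + (Im w - y) * ux x y))|] end.
lra. all: unfold Cminus, Cplus, Copp, Cmult, Re, Im; simpl; ring.
Qed.

Definition cexp (z : C) : C := (exp (Re z) * cos (Im z), exp (Re z) * sin (Im z)).

Lemma cont2_ex_derive (f : R -> R) (g : R * R -> R) p : continuous (U := R_UniformSpace) g p -> ex_derive f (g p) ->
  continuous (U := R_UniformSpace) (fun q => f (g q)) p.
Proof.
intros H1 H2. apply (continuous_comp g f); auto.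
apply (ex_derive_continuous (K := R_AbsRing) (V := R_NormedModule)); auto.
Qed.

Lemma cexp_cderiv z : cderiv cexp z (cexp z).
Proof.
destruct z as [x y].
apply (cauchy_riemann (fun x y => exp x * cos y) (fun x y => exp x * cos y) (fun x y => exp x * sin y) (fun x y => exp x * sin y)).
- apply filter_forall. intros p. auto_derive; auto. simpl; as_R; ring.
- auto_derive; auto. ring.
- apply (continuous_mult (K := R_AbsRing)); apply cont2_ex_derive; try apply continuous_fst; try apply continuous_snd; auto_derive; auto.
- apply filter_forall. intros p. auto_derive; auto. simpl; as_R; ring.
- auto_derive; auto. ring.
- apply (continuous_mult (K := R_AbsRing)); apply cont2_ex_derive; try apply continuous_fst; try apply continuous_snd; auto_derive; auto.
Qed.

Lemma cexp_nz z : cexp z <> 0.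
Proof.
intros E. unfold cexp, RtoC in E. injection E. intros E2 E1.
assert (P := exp_pos (Re z)). assert (cos (Im z) = 0) by nra. assert (sin (Im z) = 0) by nra.
generalize (sin2_cos2 (Im z)). rewrite H, H0. unfold Rsqr. lra.
Qed.

Definition slit (z : C) : Prop := Im z <> 0 \/ 0 < Re z.

Lemma slit_open z : slit z -> locally z slit.
Proof.
intros H. apply locally_Cmod.
assert (B : forall y : C, Rabs (Re y - Re z) <= Cmod (y - z) /\ Rabs (Im y - Im z) <= Cmod (y - z)).
{ intros y. split. apply (re_le_Cmod (y - z)). apply (im_le_Cmod (y - z)). }
destruct H as [H|H].
- exists (Rabs (Im z)). split. now apply Rabs_pos_lt. intros y Hy. left. intros E.
  destruct (B y) as [_ B2]. rewrite E in B2. replace (0 - Im z) with (- Im z) in B2 by ring. rewrite Rabs_Ropp in B2. lra.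
- exists (Re z). split; auto. intros y Hy. right. destruct (B y) as [B1 _].
  assert (Q : Rabs (Re y - Re z) < Re z) by lra. apply Rabs_def2 in Q. lra.
Qed.

Lemma slit_pos x y : slit (x, y) -> 0 < x ^ 2 + y ^ 2 /\ 0 < sqrt (x ^ 2 + y ^ 2) + x.
Proof.
unfold slit. change (Im (x, y)) with y. change (Re (x, y)) with x. intros H. split.
- destruct H; simpl; nra.
- destruct H as [H|H].
  + assert (L : Rabs x < sqrt (x ^ 2 + y ^ 2)).
    { rewrite <- sqrt_Rsqr_abs. apply sqrt_lt_1; unfold Rsqr; nra. }
    apply Rabs_def2 in L. lra.
  + generalize (sqrt_pos (x ^ 2 + y ^ 2)). lra.
Qed.

(** With s = |z|, the vector (s + x, y) points in the direction of half the argument of z. Its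
    squared length appears when the arctangent of [Clog] is differentiated. *)
Lemma arg_identity (x y s : R) : 0 < s -> 0 < s + x -> s * s = x ^ 2 + y ^ 2 ->
  (s + x) ^ 2 + y ^ 2 = 2 * s * (s + x).
Proof. intros. nra. Qed.

Lemma Clog_cderiv z : slit z -> cderiv Clog z (/ z)%C.
Proof.
destruct z as [x y]. intros Hz.
assert (L := slit_open _ Hz).
assert (Hp := slit_pos x y Hz).
assert (Sq : forall x y, 0 < x ^ 2 + y ^ 2 -> 0 < sqrt (x ^ 2 + y ^ 2) /\ sqrt (x ^ 2 + y ^ 2) * sqrt (x ^ 2 + y ^ 2) = x ^ 2 + y ^ 2).
{ intros. split. now apply sqrt_lt_R0. apply sqrt_sqrt. lra. }
assert (A1 : forall x y, slit (x, y) -> is_derive (fun s => ln (sqrt (s ^ 2 + y ^ 2))) x (x / (x ^ 2 + y ^ 2))).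
{ intros a b H. destruct (slit_pos a b H) as [P1 P2]. destruct (Sq a b P1) as [P3 P4].
  auto_derive. simpl in P1, P3. rewrite Rmult_1_r in *. repeat split; lra.
  simpl in *. rewrite !Rmult_1_r in *. set (s := sqrt (a * a + b * b)) in *. rewrite <- P4. field. lra. }
assert (A2 : forall x y, slit (x, y) -> is_derive (fun s => ln (sqrt (x ^ 2 + s ^ 2))) y (y / (x ^ 2 + y ^ 2))).
{ intros a b H. destruct (slit_pos a b H) as [P1 P2]. destruct (Sq a b P1) as [P3 P4].
  auto_derive. simpl in P1, P3. rewrite Rmult_1_r in *. repeat split; lra.
  simpl in *. rewrite !Rmult_1_r in *. set (s := sqrt (a * a + b * b)) in *. rewrite <- P4. field. lra. }
assert (B1 : forall x y, slit (x, y) -> is_derive (fun s => 2 * atan (y / (sqrt (s ^ 2 + y ^ 2) + s))) x (- y / (x ^ 2 + y ^ 2))).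
{ intros a b H. destruct (slit_pos a b H) as [P1 P2]. destruct (Sq a b P1) as [P3 P4].
  auto_derive. simpl in P1, P2, P3. rewrite Rmult_1_r in *. repeat split; lra.
  simpl in *. rewrite !Rmult_1_r in *. set (s := sqrt (a * a + b * b)) in *.
  assert (I := arg_identity a b s P3 P2 ltac:(simpl; lra)).
  assert (N : (s + a) * (s + a) + b * b = 2 * s * (s + a)) by (simpl in I; lra).
  rewrite <- P4.
  transitivity (- 2 * b * (a / s + 1) / ((s + a) * (s + a) + b * b)). field. repeat split; nra.
  rewrite N. field. lra. }
assert (B2 : forall x y, slit (x, y) -> is_derive (fun s => 2 * atan (s / (sqrt (x ^ 2 + s ^ 2) + x))) y (x / (x ^ 2 + y ^ 2))).
{ intros a b H. destruct (slit_pos a b H) as [P1 P2]. destruct (Sq a b P1) as [P3 P4].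
  auto_derive. simpl in P1, P2, P3. rewrite Rmult_1_r in *. repeat split; lra.
  simpl in *. rewrite !Rmult_1_r in *. set (s := sqrt (a * a + b * b)) in *.
  assert (I := arg_identity a b s P3 P2 ltac:(simpl; lra)).
  assert (N : (s + a) * (s + a) + b * b = 2 * s * (s + a)) by (simpl in I; lra).
  assert (N2 : b * b = s * s - a * a) by lra.
  rewrite <- P4.
  transitivity (2 * (s + a - b * b / s) / ((s + a) * (s + a) + b * b)). field. repeat split; nra.
  rewrite N, N2. field. lra. }
assert (Cn : forall f : R * R -> R, continuous (U := R_UniformSpace) f (x, y) ->
   continuous (U := R_UniformSpace) (fun p => f p / (fst p ^ 2 + snd p ^ 2)) (x, y)).
{ intros f Hf. apply (continuous_mult (K := R_AbsRing) f); auto.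
  apply (cont2_ex_derive Rinv (fun p : R * R => fst p ^ 2 + snd p ^ 2)).
  - apply (continuous_plus (V := R_NormedModule) (fun p : R * R => fst p ^ 2) (fun p : R * R => snd p ^ 2)).
    apply (cont2_ex_derive (fun t => t ^ 2) fst). apply continuous_fst. auto_derive; auto.
    apply (cont2_ex_derive (fun t => t ^ 2) snd). apply continuous_snd. auto_derive; auto.
  - auto_derive. simpl fst; simpl snd. lra. }
replace (/ (x, y))%C with (x / (x ^ 2 + y ^ 2), - y / (x ^ 2 + y ^ 2)) by reflexivity.
apply (cauchy_riemann (fun x y => ln (sqrt (x ^ 2 + y ^ 2))) (fun x y => x / (x ^ 2 + y ^ 2))
  (fun x y => 2 * atan (y / (sqrt (x ^ 2 + y ^ 2) + x))) (fun x y => - y / (x ^ 2 + y ^ 2))).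
- revert L. apply locally_imp. intros [a b] H. now apply A1.
- replace (- (- y / (x ^ 2 + y ^ 2))) with (y / (x ^ 2 + y ^ 2)) by (field; lra). now apply A2.
- apply (Cn fst). apply continuous_fst.
- revert L. apply locally_imp. intros [a b] H. now apply B1.
- now apply B2.
- apply (Cn (fun p => - snd p)). apply (continuous_opp (V := R_NormedModule) snd). apply continuous_snd.
Qed.

Lemma Clog_real t : 0 < t -> Clog (RtoC t) = RtoC (ln t).
Proof.
intros H. unfold Clog. rewrite Cmod_R, Rabs_pos_eq by lra. rewrite re_RtoC, im_RtoC.
unfold RtoC. f_equal. unfold Rdiv. rewrite Rmult_0_l, atan_0. ring.
Qed.

Lemma Clog_Ci : Clog Ci = (Clog (- Ci) + Ci * RtoC PI)%C.
Proof.
assert (E1 : Clog Ci = (0, PI / 2)).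
{ unfold Clog. rewrite Cmod_Ci. simpl. rewrite ln_1. replace (1 / (1 + 0)) with 1 by field. rewrite atan_1. f_equal. field. }
assert (E2 : Clog (- Ci) = (0, - (PI / 2))).
{ unfold Clog. rewrite Cmod_opp, Cmod_Ci. unfold Ci, Copp. simpl. rewrite ln_1. replace (- (1) / (1 + - 0)) with (- (1)) by field. rewrite atan_opp, atan_1. f_equal. field. }
rewrite E1, E2. apply injective_projections; simpl; field.
Qed.

(** * Landen's transformation *)

Lemma PS_real a x : (forall k, Im (a k) = 0) -> PS a (RtoC x) = RtoC (Re (PS a (RtoC x))).
Proof.
intros H. apply injective_projections; [reflexivity|]. change (Series (fun k => Im (a k * RtoC x ^ k)%C) = 0).
rewrite (Series_ext _ (fun k => 0 * 0)).
rewrite Series_scal_l. ring. intros k. rewrite <- RtoC_pow, im_scal_r, H. ring.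
Qed.

Lemma PS_d_real a k : (forall k, Im (a k) = 0) -> Im (PS_d a k) = 0.
Proof. intros H. unfold PS_d. rewrite im_scal_l, H. ring. Qed.

Lemma unit_disc_RtoC t : Rabs t < 1 -> unit_disc (RtoC t).
Proof. intros H. unfold unit_disc. now rewrite Cmod_R. Qed.

Definition fr (t : R) : R := Re (Fhyp (RtoC t)).
Definition fr1 (t : R) : R := Re (C_derive Fhyp (RtoC t)).
Definition fr2 (t : R) : R := Re (C_derive (C_derive Fhyp) (RtoC t)).
Definition hr (t : R) : R := Re (Hhyp (RtoC t)).
Definition hr1 (t : R) : R := Re (C_derive Hhyp (RtoC t)).

Lemma ca_real k : Im (ca k) = 0. Proof. reflexivity. Qed.
Lemma ea_real k : Im (ea k) = 0. Proof. reflexivity. Qed.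

Lemma Fhyp_real t : Fhyp (RtoC t) = RtoC (fr t).
Proof. apply PS_real, ca_real. Qed.

Lemma Hhyp_real t : Hhyp (RtoC t) = RtoC (hr t).
Proof. apply PS_real, ea_real. Qed.

Lemma Fhyp_derive_real t : Rabs t < 1 -> C_derive Fhyp (RtoC t) = RtoC (fr1 t).
Proof.
intros H. unfold fr1, Fhyp. rewrite PS_derive1 by auto using ca_radius, unit_disc_RtoC.
apply PS_real. intros k. apply PS_d_real, ca_real.
Qed.

Lemma Fhyp_derive2_real t : Rabs t < 1 -> C_derive (C_derive Fhyp) (RtoC t) = RtoC (fr2 t).
Proof.
intros H. unfold fr2, Fhyp. rewrite PS_derive2 by auto using ca_radius, unit_disc_RtoC.
apply PS_real. intros k. apply PS_d_real. intros j. apply PS_d_real, ca_real.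
Qed.

Lemma Re_derive f t l : cderiv f (RtoC t) l -> is_derive (fun u => Re (f (RtoC u))) t (Re l).
Proof.
intros H. assert (G : rderiv RtoC t 1).
{ split; simpl. apply (is_derive_id (K := R_AbsRing)). apply (is_derive_const (K := R_AbsRing) (V := R_NormedModule)). }
assert (K := cderiv_rderiv f RtoC t l 1 H G). rewrite Cmult_1_r in K. apply K.
Qed.

Lemma fr_derive t : Rabs t < 1 -> is_derive fr t (fr1 t).
Proof. intros H. apply Re_derive, analytic_cderiv, Fhyp_sol, unit_disc_RtoC, H. Qed.

Lemma fr1_derive t : Rabs t < 1 -> is_derive fr1 t (fr2 t).
Proof. intros H. apply Re_derive, analytic_cderiv, analytic_derive, Fhyp_sol, unit_disc_RtoC, H. Qed.

Lemma hr_derive t : Rabs t < 1 -> is_derive hr t (hr1 t).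
Proof. intros H. apply Re_derive, analytic_cderiv, Hhyp_analytic, unit_disc_RtoC, H. Qed.

Lemma hr1_ex_derive t : Rabs t < 1 -> ex_derive hr1 t.
Proof. intros H. eexists. apply Re_derive, analytic_cderiv, analytic_derive, Hhyp_analytic, unit_disc_RtoC, H. Qed.

Lemma fr_ode t : Rabs t < 1 -> t * (1 - t) * fr2 t + (1 - 2 * t) * fr1 t = fr t / 4.
Proof.
intros H. destruct (Fhyp_sol _ (unit_disc_RtoC t H)) as [_ O]. unfold hyp_ode in O.
rewrite Fhyp_derive2_real, Fhyp_derive_real, Fhyp_real in O by auto.
assert (E : RtoC (t * (1 - t) * fr2 t + (1 - 2 * t) * fr1 t - fr t / 4) = 0).
{ rewrite <- O. rewrite !RtoC_minus, RtoC_plus, !RtoC_mult, !RtoC_minus, RtoC_mult, RtoC_div by lra. reflexivity. }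
apply RtoC_inj in E. lra.
Qed.

Lemma fr_0 : fr 0 = 1.
Proof. unfold fr, Fhyp. rewrite PS_0. unfold ca. rewrite hc_0. reflexivity. Qed.

Lemma hr_0 : hr 0 = - 4 * ln 2.
Proof. unfold hr, Hhyp. rewrite PS_0. unfold ea. rewrite hc_0, hd_0. simpl. ring. Qed.

(** The Taylor coefficients of the derivative of F; they are non-negative and tend to 1 / pi. *)
Definition hm (k : nat) : R := (INR k + 1) * hc (S k).

Lemma hm_bound k : 0 <= hm k.
Proof. unfold hm. generalize (pos_INR k) (hc_bound (S k)). intros. apply Rmult_le_pos; lra. Qed.

Lemma hm_series t : 0 <= t < 1 -> is_series (fun k => hm k * t ^ k) (fr1 t).
Proof.
intros Ht. assert (Ha : Rabs t < 1) by (rewrite Rabs_pos_eq; lra).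
unfold fr1, Fhyp. rewrite PS_derive1 by auto using ca_radius, unit_disc_RtoC.
assert (S : csummable (fun k => PS_d ca k * RtoC t ^ k)%C).
{ apply cradius_summable with ((t + 1) / 2). rewrite Cmod_R. rewrite Rabs_pos_eq; lra.
  apply cradius_d with 1. lra. apply ca_radius. }
apply csummable_is_series in S. apply is_series_C in S. destruct S as [S _].
eapply is_series_ext; [|exact S]. intros k. cbv beta.
rewrite <- RtoC_pow, re_scal_r. unfold PS_d, ca. rewrite re_scal_l, S_INR. reflexivity.
Qed.

Lemma fr1_nonneg t : 0 <= t < 1 -> 0 <= fr1 t.
Proof.
intros Ht. rewrite <- (is_series_unique _ _ (hm_series t Ht)).
rewrite <- (Rmult_0_l (Series (fun k => hm k * t ^ k))), <- Series_scal_l.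
apply Series_le. intros k. split. lra. rewrite Rmult_0_l. apply Rmult_le_pos. apply hm_bound. apply pow_le; lra.
eexists; apply hm_series, Ht.
Qed.

Lemma fr_pos t : 0 <= t < 1 -> 1 <= fr t.
Proof.
intros Ht. destruct (Req_dec_T t 0) as [->|N]. rewrite fr_0; lra.
destruct (MVT_gen fr 0 t fr1) as [c [Hc E]].
- rewrite Rmin_left, Rmax_right by lra. intros x Hx. apply fr_derive. rewrite Rabs_pos_eq; lra.
- rewrite Rmin_left, Rmax_right by lra. intros x Hx. apply continuity_pt_filterlim.
  apply (ex_derive_continuous (K := R_AbsRing) (V := R_NormedModule)). eexists. apply fr_derive. rewrite Rabs_pos_eq; lra.
- rewrite Rmin_left, Rmax_right in Hc by lra. rewrite fr_0 in E.
  assert (0 <= fr1 c) by (apply fr1_nonneg; lra). nra.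
Qed.

Lemma real_zero_const (g : R -> R) a b : a <= b -> (forall t, a < t < b -> is_derive g t 0) ->
  (forall t, a <= t <= b -> continuous g t) -> g b = g a.
Proof.
intros Hab G1 G2. destruct (MVT_gen g a b (fun _ => 0)) as [c [_ Hc2]].
- intros x. rewrite Rmin_left, Rmax_right by auto. apply G1.
- intros x. rewrite Rmin_left, Rmax_right by auto. intros Hx. apply continuity_pt_filterlim. now apply G2.
- lra.
Qed.

Lemma continuous_of_derive (g : R -> R) t l : is_derive g t l -> continuous g t.
Proof. intros H. apply (ex_derive_continuous (K := R_AbsRing) (V := R_NormedModule)). now exists l. Qed.

(** The square of Landen's ascending modulus 2 sqrt k / (1 + k). *)
Definition landen_X (k : R) : R := 4 * k / (1 + k) ^ 2.

Lemma landen_X_range k : 0 <= k < 1 -> 0 <= landen_X k < 1.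
Proof.
intros Hk. unfold landen_X. assert (0 < (1 + k) ^ 2) by (apply pow_lt; lra). split.
- apply Rmult_le_pos; [lra|]. left; now apply Rinv_0_lt_compat.
- apply Rmult_lt_reg_r with ((1 + k) ^ 2); auto. unfold Rdiv. rewrite Rmult_assoc, Rinv_l by lra. nra.
Qed.

Lemma landen_X_derive k : 0 <= k -> is_derive landen_X k (4 * (1 - k) / (1 + k) ^ 3).
Proof. intros Hk. unfold landen_X. auto_derive. simpl. nra. field. lra. Qed.

(* Both sides, as functions of the modulus [k], satisfy
   [(k (1 - k^2) y')' = k y]; [q1] and [q2] are [k (1 - k^2) y'], and their
   Wronskian vanishes at the singular point [k = 0]. *)
Lemma landen k : 0 <= k < 1 -> fr (landen_X k) = (1 + k) * fr (k ^ 2).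
Proof.
intros Hk.
set (y1 := fun k => fr (k ^ 2)). set (y2 := fun k => fr (landen_X k) / (1 + k)).
set (q1 := fun k => 2 * k ^ 2 * (1 - k ^ 2) * fr1 (k ^ 2)).
set (q2 := fun k => (1 + k) * (landen_X k * (1 - landen_X k)) * fr1 (landen_X k) - k * (1 - k) / (1 + k) * fr (landen_X k)).
set (d1 := fun k => 2 * k * fr1 (k ^ 2)).
set (d2 := fun k => (fr1 (landen_X k) * (4 * (1 - k) / (1 + k) ^ 3) * (1 + k) - fr (landen_X k)) / (1 + k) ^ 2).
assert (Sq : forall k, 0 <= k < 1 -> Rabs (k ^ 2) < 1).
{ intros u Hu. rewrite Rabs_pos_eq by nra. nra. }
assert (Xq : forall k, 0 <= k < 1 -> Rabs (landen_X k) < 1).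
{ intros u Hu. generalize (landen_X_range u Hu). intros. rewrite Rabs_pos_eq; lra. }
assert (Cf : forall (f f' : R -> R) (u v : R), Rabs (u ^ 2) < 1 -> (forall t, Rabs t < 1 -> is_derive f t (f' t)) ->
   is_derive (fun k => f (k ^ 2)) u (2 * u * f' (u ^ 2))).
{ intros f f' u _ Hu Hf. apply (is_derive_comp (K := R_AbsRing) (V := R_NormedModule) f (fun k => k ^ 2)).
  now apply Hf. auto_derive; auto. ring. }
assert (Cx : forall (f f' : R -> R) (u : R), 0 <= u < 1 -> (forall t, Rabs t < 1 -> is_derive f t (f' t)) ->
   is_derive (fun k => f (landen_X k)) u (4 * (1 - u) / (1 + u) ^ 3 * f' (landen_X u))).
{ intros f f' u Hu Hf. apply (is_derive_comp (K := R_AbsRing) (V := R_NormedModule) f landen_X).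
  apply Hf, Xq, Hu. apply landen_X_derive. lra. }
assert (D1 : forall u, 0 <= u < 1 -> is_derive y1 u (d1 u)).
{ intros u Hu. apply (Cf fr fr1 u 0); auto using fr_derive. }
assert (D2 : forall u, 0 <= u < 1 -> is_derive y2 u (d2 u)).
{ intros u Hu. unfold y2. assert (Q := Cx fr fr1 u Hu fr_derive).
  assert (P : is_derive (fun k => 1 + k) u 1) by (auto_derive; auto).
  assert (W := is_derive_div _ _ _ _ _ Q P ltac:(lra)). 
  match type of W with is_derive _ _ ?val => replace (d2 u) with val end. exact W. as_R.
  unfold d2. field. lra. }
assert (E1 : forall u, 0 <= u < 1 -> is_derive q1 u (u * y1 u)).
{ intros u Hu. assert (Q := Cf fr1 fr2 u 0 (Sq u Hu) fr1_derive).
  assert (P : is_derive (fun k => 2 * k ^ 2 * (1 - k ^ 2)) u (4 * u - 8 * u ^ 3)) by (auto_derive; auto; ring).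
  assert (W := is_derive_mult _ _ _ _ _ P Q Rmult_comm). unfold plus, mult in W; simpl in W.
  match type of W with is_derive _ _ ?val => replace (u * y1 u) with val end. exact W. as_R.
  unfold y1. generalize (fr_ode (u ^ 2) (Sq u Hu)). intros O.
  transitivity (4 * u * (u ^ 2 * (1 - u ^ 2) * fr2 (u ^ 2) + (1 - 2 * u ^ 2) * fr1 (u ^ 2))). simpl; ring.
  rewrite O. field. }
assert (E2 : forall u, 0 <= u < 1 -> is_derive q2 u (u * y2 u)).
{ intros u Hu. assert (Q := Cx fr fr1 u Hu fr_derive). assert (Q1 := Cx fr1 fr2 u Hu fr1_derive).
  assert (P : is_derive (fun k => (1 + k) * (landen_X k * (1 - landen_X k))) u
     (landen_X u * (1 - landen_X u) + (1 + u) * (4 * (1 - u) / (1 + u) ^ 3 * (1 - 2 * landen_X u)))).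
  { assert (DX := landen_X_derive u ltac:(lra)). auto_derive. repeat apply conj; auto; now exists (4 * (1 - u) / (1 + u) ^ 3).
    replace (Derive (fun x => landen_X x) u) with (4 * (1 - u) / (1 + u) ^ 3) by (symmetry; now apply is_derive_unique).
    simpl. field. lra. }
  assert (P2 : is_derive (fun k => k * (1 - k) / (1 + k)) u ((1 - 2 * u - u ^ 2) / (1 + u) ^ 2)) by (auto_derive; [lra | field; lra]).
  assert (W1 := is_derive_mult _ _ _ _ _ P Q1 Rmult_comm). assert (W2 := is_derive_mult _ _ _ _ _ P2 Q Rmult_comm).
  assert (W := is_derive_minus _ _ _ _ _ W1 W2).
  unfold minus, opp, plus, mult in W; simpl in W.
  match type of W with is_derive _ _ ?val => replace (u * y2 u) with val end. exact W. as_R.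
  unfold y2. generalize (fr_ode (landen_X u) (Xq u Hu)). intros O.
  set (a0 := fr (landen_X u)) in *. set (a1 := fr1 (landen_X u)) in *. set (a2 := fr2 (landen_X u)) in *. 
  transitivity ((1 + u) * (4 * (1 - u) / (1 + u) ^ 3) * (landen_X u * (1 - landen_X u) * a2 + (1 - 2 * landen_X u) * a1)
    + (landen_X u * (1 - landen_X u) - u * (1 - u) / (1 + u) * (4 * (1 - u) / (1 + u) ^ 3)) * a1
    - (1 - 2 * u - u ^ 2) / (1 + u) ^ 2 * a0).
  simpl. as_R. field; lra.
  rewrite O. unfold landen_X. field. lra. }
(* The equations q' = k y cancel in the derivative of y1 q2 - y2 q1; what remains is d1 q2 - d2 q1,
   which is zero because q1 and q2 are k (1 - k^2) times d1 and d2. At k = 0 both q vanish. *)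
assert (V : forall u, 0 <= u < 1 -> y1 u * q2 u - y2 u * q1 u = 0).
{ intros u Hu.
  assert (DV : forall v, 0 <= v < 1 -> is_derive (fun v => y1 v * q2 v - y2 v * q1 v) v (d1 v * q2 v - d2 v * q1 v)).
  { intros v Hv. assert (W1 := is_derive_mult _ _ _ _ _ (D1 v Hv) (E2 v Hv) Rmult_comm).
    assert (W2 := is_derive_mult _ _ _ _ _ (D2 v Hv) (E1 v Hv) Rmult_comm).
    assert (W := is_derive_minus _ _ _ _ _ W1 W2). unfold minus, opp, plus, mult in W; simpl in W.
    match type of W with is_derive _ _ ?val => replace (d1 v * q2 v - d2 v * q1 v) with val end. exact W. as_R. ring. }
  transitivity (y1 0 * q2 0 - y2 0 * q1 0).
  - apply (real_zero_const (fun v => y1 v * q2 v - y2 v * q1 v) 0 u). lra.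
    + intros t Ht. replace 0 with (d1 t * q2 t - d2 t * q1 t). apply DV; lra.
      unfold d1, d2, q1, q2, landen_X. field. lra.
    + intros t Ht. eapply continuous_of_derive. apply DV. lra.
  - unfold q1, q2, landen_X. field. }
(* For k in (0, 1) the relation V = 0 may be divided by k (1 - k^2) and says that y2 / y1 has
   derivative 0; the denominator is at least 1. *)
assert (R : y2 k / y1 k = y2 0 / y1 0).
{ assert (DR : forall v, 0 <= v < 1 -> is_derive (fun v => y2 v / y1 v) v ((d2 v * y1 v - y2 v * d1 v) / y1 v ^ 2)).
  { intros v Hv. apply is_derive_div; auto. unfold y1. generalize (fr_pos (v ^ 2)). intros Q. 
    assert (0 <= v ^ 2 < 1) by nra. specialize (Q H). lra. }
  apply (real_zero_const (fun v => y2 v / y1 v) 0 k). lra.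
  - intros t Ht. assert (Z : d2 t * y1 t - y2 t * d1 t = 0).
    { assert (VV := V t ltac:(lra)). assert (Pp : t * (1 - t ^ 2) <> 0) by nra.
      apply Rmult_eq_reg_l with (t * (1 - t ^ 2)); auto. rewrite Rmult_0_r, <- VV.
      unfold d1, d2, q1, q2, landen_X. field. lra. }
    replace 0 with ((d2 t * y1 t - y2 t * d1 t) / y1 t ^ 2) by (rewrite Z; unfold Rdiv; ring). apply DR. lra.
  - intros t Ht. eapply continuous_of_derive, DR. lra. }
assert (Y1 : 1 <= y1 k) by (unfold y1; apply fr_pos; nra).
assert (Y0 : y2 0 / y1 0 = 1).
{ unfold y1, y2, landen_X. replace (4 * 0 / (1 + 0) ^ 2) with 0 by field. replace (0 ^ 2) with 0 by ring. rewrite fr_0. field. }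
rewrite Y0 in R. assert (Y : y2 k = y1 k). { apply (f_equal (fun r => r * y1 k)) in R. field_simplify in R; lra. }
unfold y1, y2 in Y. rewrite <- Y. field. lra.
Qed.

(** * The connection formula *)

Definition wallis_int (n : nat) : R := RInt (fun t => sin t ^ n) 0 (PI / 2).

Lemma sin_pow_ex_RInt n : ex_RInt (fun t => sin t ^ n) 0 (PI / 2).
Proof.
apply (ex_RInt_continuous (V := R_CompleteNormedModule)). intros t _.
apply (ex_derive_continuous (K := R_AbsRing) (V := R_NormedModule)). auto_derive. auto.
Qed.

(** Integration of the derivative of sin^(n+1) cos, a function that vanishes at both ends. *)
Lemma wallis_int_rec n : (INR n + 2) * wallis_int (S (S n)) = (INR n + 1) * wallis_int n.
Proof.
assert (I : is_RInt (fun t => (INR n + 1) * sin t ^ n - (INR n + 2) * sin t ^ S (S n)) 0 (PI / 2)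
   (sin (PI / 2) ^ S n * cos (PI / 2) - sin 0 ^ S n * cos 0)).
{ apply (is_RInt_derive (V := R_CompleteNormedModule) (fun t => sin t ^ S n * cos t)).
  - intros t _. auto_derive; auto. change (match n with O => 1 | S _ => INR n + 1 end) with (INR (S n)). rewrite S_INR.
    assert (S2 := sin2_cos2 t). unfold Rsqr in S2.
    transitivity ((INR n + 1) * sin t ^ n * (cos t * cos t) - sin t ^ n * (sin t * sin t)). simpl; as_R; ring.
    replace (cos t * cos t) with (1 - sin t * sin t) by lra. simpl; as_R; ring.
  - intros t _. apply (ex_derive_continuous (K := R_AbsRing) (V := R_NormedModule)). auto_derive. auto. }
apply (is_RInt_unique (V := R_CompleteNormedModule)) in I.
rewrite cos_PI2, sin_0, Rmult_0_r in I. simpl (0 ^ S n) in I. rewrite Rmult_0_l, Rmult_0_l, Rminus_0_r in I.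
rewrite (RInt_Rminus (fun t => (INR n + 1) * sin t ^ n) (fun t => (INR n + 2) * sin t ^ S (S n))) in I
  by (apply ex_RInt_Rscal, sin_pow_ex_RInt).
rewrite (RInt_Rscal (fun t => sin t ^ n)), (RInt_Rscal (fun t => sin t ^ S (S n))) in I by apply sin_pow_ex_RInt.
unfold wallis_int. lra.
Qed.

Lemma wallis_int_decr n : wallis_int (S n) <= wallis_int n.
Proof.
apply RInt_le; auto using sin_pow_ex_RInt. generalize PI_RGT_0; lra.
intros t Ht. assert (0 <= sin t <= 1).
{ split. apply sin_ge_0; generalize PI_RGT_0; lra. apply SIN_bound. }
simpl. assert (0 <= sin t ^ n) by (apply pow_le; lra). nra.
Qed.

Lemma wallis_int_0 : wallis_int 0 = PI / 2.
Proof.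
unfold wallis_int. rewrite (RInt_ext _ (fun _ => 1)) by (intros; reflexivity).
rewrite RInt_const. unfold scal; simpl; unfold mult; simpl. as_R. ring.
Qed.

Lemma wallis_int_1 : wallis_int 1 = 1.
Proof.
unfold wallis_int.
assert (I : is_RInt (fun t => sin t ^ 1) 0 (PI / 2) (- cos (PI / 2) - - cos 0)).
{ apply (is_RInt_derive (V := R_CompleteNormedModule) (fun t => - cos t)).
  - intros t _. auto_derive; auto. simpl; as_R; ring.
  - intros t _. apply (ex_derive_continuous (K := R_AbsRing) (V := R_NormedModule)). auto_derive. auto. }
apply (is_RInt_unique (V := R_CompleteNormedModule)) in I. rewrite I, cos_PI2, cos_0. ring.
Qed.

(** Equal to binom(2k, k) / 4^k, the rational factor in Wallis' integrals; its square is [hc]. *)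
Definition ha (k : nat) : R := pochhammer (1 / 2) k / INR (fact k).

Lemma ha_S k : ha (S k) = ha k * ((INR k + 1 / 2) / (INR k + 1)).
Proof.
unfold ha. simpl pochhammer. rewrite fact_simpl, mult_INR, S_INR.
generalize (INR_fact_pos k) (pos_INR k). intros. field. lra.
Qed.

Lemma ha_pos k : 0 < ha k.
Proof.
induction k as [|k IH]. unfold ha; simpl; lra.
rewrite ha_S. generalize (pos_INR k). intros. apply Rmult_lt_0_compat; auto. apply Rdiv_lt_0_compat; lra.
Qed.

Lemma wallis_int_even k : wallis_int (2 * k) = PI / 2 * ha k.
Proof.
induction k as [|k IH]. change (2 * 0)%nat with O. rewrite wallis_int_0. unfold ha; simpl. field.
replace (2 * S k)%nat with (S (S (2 * k))) by lia.
assert (R := wallis_int_rec (2 * k)). rewrite IH, mult_INR in R. simpl (INR 2) in R.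
generalize (pos_INR k). intros P. rewrite ha_S.
apply Rmult_eq_reg_l with ((1 + 1) * INR k + 2); [|lra]. rewrite R. field. lra.
Qed.

Lemma wallis_int_odd k : wallis_int (S (2 * k)) = / ((2 * INR k + 1) * ha k).
Proof.
induction k as [|k IH]. change (S (2 * 0)) with 1%nat. rewrite wallis_int_1. unfold ha; simpl. field.
replace (S (2 * S k)) with (S (S (S (2 * k)))) by lia.
assert (R := wallis_int_rec (S (2 * k))). rewrite IH, S_INR, mult_INR in R. simpl (INR 2) in R.
generalize (pos_INR k) (ha_pos k). intros P Q. rewrite ha_S, S_INR.
apply Rmult_eq_reg_l with ((1 + 1) * INR k + 1 + 2); [|lra]. rewrite R. field. lra.
Qed.

(** The inequalities W_(2k+3) <= W_(2k+2) <= W_(2k+1) between Wallis' integrals, each multiplied by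
    [ha (S k)] to produce its square. *)
Lemma hm_wallis k : (INR k + 1) / (INR k + 3 / 2) / PI <= hm k <= / PI.
Proof.
assert (E : hm k = (INR k + 1) * (ha (S k) * ha (S k))) by (unfold hm, hc; fold (ha (S k)); ring).
assert (PP := PI_RGT_0). assert (A := ha_pos (S k)). assert (A0 := ha_pos k). assert (P := pos_INR k).
assert (H1 := wallis_int_decr (2 * S k)). rewrite wallis_int_even, wallis_int_odd, S_INR in H1.
assert (H2 := wallis_int_decr (S (2 * k))). replace (S (S (2 * k))) with (2 * S k)%nat in H2 by lia.
rewrite wallis_int_even, wallis_int_odd in H2.
assert (E0 : ha k = ha (S k) * ((INR k + 1) / (INR k + 1 / 2))) by (rewrite ha_S; field; lra).
rewrite E0 in H2. rewrite E. set (a := ha (S k)) in *. clearbody a.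
replace (/ ((2 * INR k + 1) * (a * ((INR k + 1) / (INR k + 1 / 2))))) with (/ (2 * (INR k + 1) * a)) in H2 by (field; lra).
split.
- assert (B : / (2 * (INR k + 1) + 1) <= PI / 2 * (a * a)).
  { replace (/ (2 * (INR k + 1) + 1)) with (/ ((2 * (INR k + 1) + 1) * a) * a) by (field; lra). nra. }
  replace ((INR k + 1) / (INR k + 3 / 2) / PI) with (/ (2 * (INR k + 1) + 1) * (2 * (INR k + 1) / PI)) by (field; lra).
  replace ((INR k + 1) * (a * a)) with (PI / 2 * (a * a) * (2 * (INR k + 1) / PI)) by (field; lra).
  apply Rmult_le_compat_r; auto. apply Rmult_le_pos. lra. left; now apply Rinv_0_lt_compat.
- assert (B : PI / 2 * (a * a) <= / (2 * (INR k + 1))).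
  { replace (/ (2 * (INR k + 1))) with (/ (2 * (INR k + 1) * a) * a) by (field; lra). nra. }
  replace (/ PI) with (/ (2 * (INR k + 1)) * (2 * (INR k + 1) / PI)) by (field; lra).
  replace ((INR k + 1) * (a * a)) with (PI / 2 * (a * a) * (2 * (INR k + 1) / PI)) by (field; lra).
  apply Rmult_le_compat_r; auto. apply Rmult_le_pos. lra. left; now apply Rinv_0_lt_compat.
Qed.

(** Comparison of F' with the geometric series of ratio t and coefficient 1 / pi. *)
Lemma fr1_upper t : 0 <= t < 1 -> (1 - t) * fr1 t <= / PI.
Proof.
intros Ht. assert (G : is_series (fun k => / PI * t ^ k) (/ PI * / (1 - t))).
{ apply (is_series_scal (V := R_NormedModule) (/ PI)). apply is_series_geom. rewrite Rabs_pos_eq; lra. }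
assert (L : fr1 t <= / PI * / (1 - t)).
{ rewrite <- (is_series_unique _ _ (hm_series t Ht)), <- (is_series_unique _ _ G).
  apply Series_le; [|eexists; exact G]. intros k. assert (0 <= t ^ k) by (apply pow_le; lra).
  split. apply Rmult_le_pos; auto using hm_bound. apply Rmult_le_compat_r; auto. apply hm_wallis. }
apply Rle_trans with ((1 - t) * (/ PI * / (1 - t))). apply Rmult_le_compat_l; lra. right. field. generalize PI_RGT_0; lra.
Qed.

(** The first N terms are non-negative and are dropped; on the others the coefficients are at least
    the lower Wallis bound for N, which increases with the index. *)
Lemma fr1_lower N t : 0 <= t < 1 -> (INR N + 1) / (INR N + 3 / 2) / PI * t ^ N <= (1 - t) * fr1 t.
Proof.
intros Ht. set (m := (INR N + 1) / (INR N + 3 / 2) / PI). assert (PP := PI_RGT_0).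
assert (G : is_series (fun k => (m * t ^ N) * t ^ k) (m * t ^ N * / (1 - t))).
{ apply (is_series_scal (V := R_NormedModule) (m * t ^ N)). apply is_series_geom. rewrite Rabs_pos_eq; lra. }
assert (S : ex_series (fun k => hm k * t ^ k)) by (eexists; now apply hm_series).
assert (L : m * t ^ N * / (1 - t) <= fr1 t).
{ rewrite <- (is_series_unique _ _ (hm_series t Ht)), <- (is_series_unique _ _ G).
  apply Rle_trans with (Series (fun k => hm (N + k)%nat * t ^ (N + k))).
  - apply Series_le.
    + intros k. assert (0 <= t ^ k) by (apply pow_le; lra). assert (0 <= t ^ N) by (apply pow_le; lra).
      assert (M : 0 <= m). { unfold m. generalize (pos_INR N). intros. apply Rmult_le_pos. apply Rmult_le_pos. lra. left; apply Rinv_0_lt_compat; lra. left; apply Rinv_0_lt_compat; lra. }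
      split. { apply Rmult_le_pos; [|assumption]. apply Rmult_le_pos; assumption. }
      rewrite pow_add, Rmult_assoc. apply Rmult_le_compat_r. now apply Rmult_le_pos.
      eapply Rle_trans; [|apply (hm_wallis (N + k))]. unfold m. unfold Rdiv.
      apply Rmult_le_compat_r. left; now apply Rinv_0_lt_compat.
      rewrite plus_INR. generalize (pos_INR N) (pos_INR k). intros.
      apply Rmult_le_reg_r with ((INR N + 3 / 2) * (INR N + INR k + 3 / 2)). nra.
      field_simplify; nra.
    + now apply (ex_series_incr_n (fun k => hm k * t ^ k) N).
  - destruct N as [|N]. right; reflexivity.
    rewrite (Series_incr_n (fun k => hm k * t ^ k) (Datatypes.S N)) by (auto; lia).
    assert (0 <= sum_f_R0 (fun k => hm k * t ^ k) (pred (Datatypes.S N))).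
    { apply cond_pos_sum. intros k. apply Rmult_le_pos. apply hm_bound. apply pow_le; lra. }
    lra. }
apply Rle_trans with ((1 - t) * (m * t ^ N * / (1 - t))). right; field; lra. apply Rmult_le_compat_l; lra.
Qed.

(** * The two coefficients of the connection formula *)

Definition gr (t : R) : R := fr t * ln t + hr t.

(* The transformation [k^2 -> 4k/(1+k)^2] cancels the logarithms exactly; the
   limit [k -> 0] then reads off the coefficient [a]. *)
Lemma landen_coefficient (phi : R -> R) (a b : R) :
  (forall t, 0 < t < 1 -> phi t = a * fr t + b * gr t) ->
  (forall k, 0 < k < 1 -> (1 + k) * phi (k ^ 2) = 2 * phi (landen_X k)) -> a = 0.
Proof.
intros H1 H2.
(* The difference of the two sides of the functional equation without its terms in ln k. They are 2
   b (1 + k) fr (k^2) ln k and 2 b fr (landen_X k) ln k, equal by [landen]. What remains is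
   continuous at 0. *)
set (D := fun k => (1 + k) * (a * fr (k ^ 2) + b * hr (k ^ 2))
  - 2 * (a * fr (landen_X k) + b * fr (landen_X k) * (2 * ln 2 - 2 * ln (1 + k)) + b * hr (landen_X k))).
assert (Z : forall k, 0 < k < 1 -> D k = 0).
{ intros k Hk. specialize (H2 k Hk).
  assert (X := landen_X_range k ltac:(lra)).
  assert (X0 : 0 < landen_X k). { unfold landen_X. apply Rdiv_lt_0_compat. lra. apply pow_lt; lra. }
  rewrite (H1 (k ^ 2)) in H2 by (simpl; nra). rewrite (H1 (landen_X k)) in H2 by lra.
  unfold gr in H2. rewrite ln_pow in H2 by lra.
  assert (LX : ln (landen_X k) = 2 * ln 2 + ln k - 2 * ln (1 + k)).
  { unfold landen_X. rewrite ln_div, ln_pow, ln_mult by (try apply pow_lt; lra).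
    replace 4 with (2 ^ 2) by ring. rewrite ln_pow by lra. simpl. ring. }
  rewrite LX in H2. assert (La := landen k ltac:(lra)). unfold D. simpl (INR 2) in H2.
  rewrite La in *. lra. }
assert (C0 : continuous D 0).
{ assert (C1 : forall f f' : R -> R, (forall t, Rabs t < 1 -> is_derive f t (f' t)) -> ex_derive (fun k => f (k ^ 2)) 0 /\ ex_derive (fun k => f (landen_X k)) 0).
  { intros f f' Hf. split.
    - apply (ex_derive_comp (K := R_AbsRing) (V := R_NormedModule) f (fun k => k ^ 2)). exists (f' (0 ^ 2)). apply Hf. simpl. rewrite Rmult_0_l, Rabs_R0; lra. auto_derive; auto.
    - apply (ex_derive_comp (K := R_AbsRing) (V := R_NormedModule) f landen_X). exists (f' (landen_X 0)). apply Hf. unfold landen_X. replace (4 * 0 / (1 + 0) ^ 2) with 0 by field. rewrite Rabs_R0; lra.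
      eexists. apply landen_X_derive. lra. }
  destruct (C1 _ _ fr_derive) as [C2 C3]. destruct (C1 _ _ hr_derive) as [C4 C5].
  apply (ex_derive_continuous (K := R_AbsRing) (V := R_NormedModule)). unfold D.
  apply (ex_derive_minus (K := R_AbsRing) (V := R_NormedModule)).
  - apply (ex_derive_mult (fun k => 1 + k)). auto_derive; auto.
    apply (ex_derive_plus (K := R_AbsRing) (V := R_NormedModule)); apply (ex_derive_mult (fun _ => _)); auto; apply ex_derive_const.
  - apply (ex_derive_mult (fun _ => 2)). apply ex_derive_const.
    apply (ex_derive_plus (K := R_AbsRing) (V := R_NormedModule)). apply (ex_derive_plus (K := R_AbsRing) (V := R_NormedModule)).
    apply (ex_derive_mult (fun _ => a)); auto. apply ex_derive_const.
    apply (ex_derive_mult (fun k => b * fr (landen_X k))). apply (ex_derive_mult (fun _ => b)); auto. apply ex_derive_const.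
    auto_derive. lra. apply (ex_derive_mult (fun _ => b)); auto. apply ex_derive_const. }
assert (D0 : D 0 = 0).
{ apply NNPP. intros N. assert (P : 0 < Rabs (D 0)) by now apply Rabs_pos_lt.
  destruct (C0 _ (locally_ball (D 0) (mkposreal _ P))) as [d Hd].
  assert (Hk : 0 < Rmin (d / 2) (1 / 2)) by (apply Rmin_pos; [generalize (cond_pos d); lra | lra]).
  assert (K1 := Rmin_l (d / 2) (1 / 2)). assert (K2 := Rmin_r (d / 2) (1 / 2)).
  set (k := Rmin (d / 2) (1 / 2)) in *.
  assert (B : ball 0 d k). { change (Rabs (k - 0) < d). rewrite Rminus_0_r, Rabs_pos_eq; lra. }
  apply Hd in B. rewrite (Z k) in B by lra. change (Rabs (0 - D 0) < Rabs (D 0)) in B.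
  rewrite Rminus_0_l, Rabs_Ropp in B. lra. }
(* D 0 = - a - b (hr 0 + 4 ln 2), and hr 0 = - 4 ln 2. *)
unfold D, landen_X in D0. replace (4 * 0 / (1 + 0) ^ 2) with 0 in D0 by field. replace (0 ^ 2) with 0 in D0 by ring.
rewrite fr_0, hr_0, Rplus_0_r, ln_1 in D0. lra.
Qed.

(** Landen's identity at j = (1 - k) / (1 + k), for which landen_X j = 1 - k^2, j^2 = 1 - landen_X k
    and 1 + j = 2 / (1 + k). *)
Lemma fr_reflect_landen k : 0 < k < 1 -> (1 + k) * fr (1 - k ^ 2) = 2 * fr (1 - landen_X k).
Proof.
intros Hk. set (j := (1 - k) / (1 + k)).
assert (Hj : 0 <= j < 1).
{ unfold j. split. apply Rmult_le_pos. lra. left; apply Rinv_0_lt_compat; lra.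
  apply Rmult_lt_reg_r with (1 + k). lra. unfold Rdiv. rewrite Rmult_assoc, Rinv_l by lra. lra. }
assert (L := landen j Hj).
replace (landen_X j) with (1 - k ^ 2) in L by (unfold landen_X, j; field; lra).
replace (j ^ 2) with (1 - landen_X k) in L by (unfold landen_X, j; field; lra).
rewrite L. unfold j. field. lra.
Qed.

(** Used to conclude that a constant multiple of g vanishing on (0, 1) has constant 0. Near 0 both
    ln t and hr t are negative. *)
Lemma gr_neg : exists t, 0 < t < 1 /\ gr t < 0.
Proof.
assert (C : continuous hr 0).
{ eapply continuous_of_derive. apply hr_derive. rewrite Rabs_R0; lra. }
assert (L2 : 0 < ln 2) by (rewrite <- ln_1; apply ln_increasing; lra).
destruct (C _ (locally_ball (hr 0) (mkposreal _ L2))) as [d Hd].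
set (t := Rmin (d / 2) (1 / 2)).
assert (Ht : 0 < t) by (apply Rmin_pos; [generalize (cond_pos d); lra | lra]).
assert (K1 := Rmin_l (d / 2) (1 / 2)). assert (K2 := Rmin_r (d / 2) (1 / 2)). fold t in K1, K2.
exists t. split. lra.
assert (B : ball 0 d t). { change (Rabs (t - 0) < d). generalize (cond_pos d). rewrite Rminus_0_r, Rabs_pos_eq; lra. }
apply Hd in B. change (Rabs (hr t - hr 0) < ln 2) in B. rewrite hr_0 in B. apply Rabs_def2 in B.
unfold gr. assert (ln t < 0) by (rewrite <- ln_1; apply ln_increasing; lra).
assert (1 <= fr t) by (apply fr_pos; lra). nra.
Qed.

Lemma ln_le_self n : ln (INR n + 2) <= INR n + 2.
Proof. generalize (pos_INR n) (ln_le_sub1 (INR n + 2)). lra. Qed.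

(** The hypothesis is differentiated and multiplied by t. As t tends to 0 the right side tends to -
    b, while Wallis' bounds force t F'(1 - t) to 1 / pi. *)
Lemma reflect_slope (b : R) : (forall t, 0 < t < 1 -> fr (1 - t) = b * gr t) -> b = - / PI.
Proof.
intros H. assert (PP := PI_RGT_0).
(* Squares make t ln t elementary: it lies between - 2 / (n + 2) and 0 because ln (n + 2) <= n +
   2. *)
set (tn := fun n => / (INR n + 2) ^ 2).
assert (T0 : forall n, 0 < tn n < 1).
{ intros n. generalize (pos_INR n). intros P. unfold tn. split. apply Rinv_0_lt_compat, pow_lt; lra.
  rewrite <- Rinv_1. apply Rinv_lt_contravar; simpl; nra. }
assert (I2 : is_lim_seq (fun n => / (INR n + 2)) 0).
{ replace (Finite 0) with (Rbar_inv p_infty) by reflexivity. apply is_lim_seq_inv; [|easy].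
  apply (is_lim_seq_le_p_loc INR). exists O. intros n _. lra. apply is_lim_seq_INR. }
assert (TL : is_lim_seq tn 0).
{ apply is_lim_seq_ext with (fun n => / (INR n + 2) * / (INR n + 2)).
  intros n. unfold tn. generalize (pos_INR n). intros. simpl. field. lra.
  replace (Finite 0) with (Finite (0 * 0)) by (f_equal; ring). now apply is_lim_seq_mult'. }
assert (TLn : is_lim_seq (fun n => tn n * ln (tn n)) 0).
{ apply is_lim_seq_le_le with (fun n => - 2 * / (INR n + 2)) (fun _ => 0).
  - intros n. generalize (pos_INR n). intros P.
    assert (E : ln (tn n) = - 2 * ln (INR n + 2)).
    { unfold tn. rewrite ln_Rinv, ln_pow by (try apply pow_lt; lra). simpl. ring. }
    assert (0 <= ln (INR n + 2)) by (rewrite <- ln_1; apply ln_le; lra).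
    rewrite E. split.
    + replace (- 2 * / (INR n + 2)) with (tn n * (- 2 * (INR n + 2))) by (unfold tn; field; lra).
      apply Rmult_le_compat_l. left; apply T0. generalize (ln_le_self n). lra.
    + generalize (T0 n). nra.
  - replace (Finite 0) with (Finite (- 2 * 0)) by (f_equal; ring). now apply (is_lim_seq_scal_l _ (-2) 0).
  - apply is_lim_seq_const. }
assert (LimC : forall f : R -> R, continuous f 0 -> is_lim_seq (fun n => f (tn n)) (f 0)).
{ intros f Hf. apply is_lim_seq_continuous; auto. apply continuity_pt_filterlim. exact Hf. }
assert (R01 : Rabs 0 < 1) by (rewrite Rabs_R0; lra).
assert (L1 := LimC fr (continuous_of_derive _ _ _ (fr_derive 0 R01))).
assert (L2 := LimC fr1 (continuous_of_derive _ _ _ (fr1_derive 0 R01))).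
assert (L3 := LimC hr1 (ex_derive_continuous (K := R_AbsRing) (V := R_NormedModule) _ _ (hr1_ex_derive 0 R01))).
(* After multiplication by t every term on the right has a limit at 0, and only [fr t] contributes
   to it. *)
assert (DE : forall t, 0 < t < 1 -> t * fr1 (1 - t) = - b * (t * ln t * fr1 t + fr t + t * hr1 t)).
{ intros t Ht.
  assert (A1 : is_derive (fun t => fr (1 - t)) t (- fr1 (1 - t))).
  { assert (K := is_derive_comp (K := R_AbsRing) (V := R_NormedModule) fr (fun t => 1 - t) t (fr1 (1 - t)) (-1)).
    replace (- fr1 (1 - t)) with (scal (-1) (fr1 (1 - t))) by (unfold scal; simpl; unfold mult; simpl; ring).
    apply K. apply fr_derive. rewrite Rabs_pos_eq; lra. auto_derive; auto. }
  assert (A2 : is_derive (fun t => b * gr t) t (b * (fr1 t * ln t + fr t * / t + hr1 t))).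
  { apply is_derive_scal. apply (is_derive_plus (K := R_AbsRing) (V := R_NormedModule) (fun t => fr t * ln t) hr).
    apply (is_derive_mult fr ln); [| |exact Rmult_comm]. apply fr_derive. rewrite Rabs_pos_eq; lra.
    auto_derive. lra. field. lra. apply hr_derive. rewrite Rabs_pos_eq; lra. }
  assert (A3 : is_derive (fun t => fr (1 - t)) t (b * (fr1 t * ln t + fr t * / t + hr1 t))).
  { apply is_derive_ext_loc with (fun t => b * gr t); auto.
    assert (Hm : 0 < Rmin t (1 - t)) by (apply Rmin_pos; lra).
    exists (mkposreal _ Hm). intros u Hu. symmetry. apply H. change (Rabs (u - t) < Rmin t (1 - t)) in Hu.
    assert (M1 := Rmin_l t (1 - t)). assert (M2 := Rmin_r t (1 - t)). apply Rabs_def2 in Hu. lra. }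
  assert (E := is_derive_unique _ _ _ A1). rewrite (is_derive_unique _ _ _ A3) in E.
  replace (fr1 (1 - t)) with (- (b * (fr1 t * ln t + fr t * / t + hr1 t))) by lra. field. lra. }
assert (LR : is_lim_seq (fun n => tn n * fr1 (1 - tn n)) (- b)).
{ apply is_lim_seq_ext with (fun n => - b * (tn n * ln (tn n) * fr1 (tn n) + fr (tn n) + tn n * hr1 (tn n))).
  intros n. symmetry. apply DE, T0.
  replace (Finite (- b)) with (Finite (- b * (0 * fr1 0 + fr 0 + 0 * hr1 0))) by (f_equal; rewrite fr_0; ring).
  apply (is_lim_seq_scal_l _ (- b) (Finite _)). apply is_lim_seq_plus'. apply is_lim_seq_plus'; auto. now apply is_lim_seq_mult'.
  now apply is_lim_seq_mult'. }
assert (U : - b <= / PI).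
{ apply (is_lim_seq_le (fun n => tn n * fr1 (1 - tn n)) (fun _ => / PI) (- b) (/ PI)); auto; [|apply is_lim_seq_const].
  intros n. assert (Q := fr1_upper (1 - tn n)). generalize (T0 n). intros. replace (1 - (1 - tn n)) with (tn n) in Q by ring. apply Q. lra. }
(* The number N of dropped terms is fixed while the points tend to 0, and goes to infinity only
   afterwards. *)
assert (Lo : forall N, (INR N + 1) / (INR N + 3 / 2) / PI <= - b).
{ intros N. set (m := (INR N + 1) / (INR N + 3 / 2) / PI).
  apply (is_lim_seq_le (fun n => m * (1 - tn n) ^ N) (fun n => tn n * fr1 (1 - tn n)) m (- b)); auto.
  - intros n. assert (Q := fr1_lower N (1 - tn n)). generalize (T0 n). intros. replace (1 - (1 - tn n)) with (tn n) in Q by ring. apply Q. lra.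
  - replace (Finite m) with (Finite (m * (1 - 0) ^ N)) by (f_equal; rewrite Rminus_0_r, pow1; ring).
    apply (is_lim_seq_scal_l _ m (Finite _)). apply (LimC (fun t => (1 - t) ^ N)).
    apply (ex_derive_continuous (K := R_AbsRing) (V := R_NormedModule)). auto_derive. auto. }
assert (Lo2 : / PI <= - b).
{ apply (is_lim_seq_le (fun N => (INR N + 1) / (INR N + 3 / 2) / PI) (fun _ => - b) (/ PI) (- b)); auto; [|apply is_lim_seq_const].
  apply is_lim_seq_ext with (fun N => / PI + (- / 2 * / PI) * / (INR N + 3 / 2)).
  intros n. generalize (pos_INR n). intros. field. lra.
  replace (Finite (/ PI)) with (Finite (/ PI + (- / 2 * / PI) * 0)) by (f_equal; ring).
  apply is_lim_seq_plus'. apply is_lim_seq_const. apply (is_lim_seq_scal_l _ _ (Finite 0)).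
  replace (Finite 0) with (Rbar_inv p_infty) by reflexivity. apply is_lim_seq_inv; [|easy].
  apply (is_lim_seq_le_p_loc INR). exists O. intros n _. lra. apply is_lim_seq_INR. }
lra.
Qed.

(** The region where the series in x and the series in 1 - x both converge. *)
Definition lens (z : C) : Prop := Cmod z < 1 /\ Cmod (1 - z) < 1.

Lemma lens_open z : lens z -> locally z lens.
Proof.
intros [H1 H2].
assert (A : locally z (fun y => Cmod (y - 0) < 1)) by (apply locally_open_ball; now replace (z - 0)%C with z by ring).
assert (B : locally z (fun y => Cmod (y - 1) < 1)) by (apply locally_open_ball; now rewrite Cmod_sub_sym).
generalize (locally_and _ _ _ A B). apply locally_imp. intros y [Y1 Y2]. split.
now replace y with (y - 0)%C by ring. now rewrite Cmod_sub_sym.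
Qed.

Lemma lens_Re z : lens z -> 0 < Re z < 1.
Proof.
intros [H1 H2]. generalize (re_le_Cmod z) (re_le_Cmod (1 - z)). change (Re (1 - z)) with (1 - Re z).
intros A B. assert (A' : Rabs (Re z) < 1) by lra. assert (B' : Rabs (1 - Re z) < 1) by lra.
apply Rabs_def2 in A'. apply Rabs_def2 in B'. lra.
Qed.

Lemma lens_star : star (RtoC (1 / 2)) lens.
Proof.
assert (H : lens (RtoC (1 / 2))).
{ split. rewrite Cmod_R, Rabs_pos_eq; lra. rewrite <- RtoC_minus, Cmod_R, Rabs_pos_eq; lra. }
split; auto. intros z [H1 H2] t Ht. destruct H as [C1 C2]. split.
- replace (segment (RtoC (1 / 2)) z t) with (segment (RtoC (1 / 2)) z t - 0)%C by ring.
  apply segment_ball; auto; [now replace (RtoC (1 / 2) - 0)%C with (RtoC (1 / 2)) by ring | now replace (z - 0)%C with z by ring].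
- rewrite Cmod_sub_sym. apply segment_ball; auto; now rewrite Cmod_sub_sym.
Qed.

Lemma C_derive_reflect f z : analytic_at f (1 - z)%C -> C_derive (fun y => f (1 - y)%C) z = (- C_derive f (1 - z))%C.
Proof.
intros A. apply C_derive_unique. eapply cderiv_eq.
apply (cderiv_comp f (fun y => 1 - y)%C). apply analytic_cderiv, A. apply cderiv_minus. apply cderiv_const. apply cderiv_id. ring.
Qed.

Lemma analytic_reflect f z : analytic_at f (1 - z)%C -> analytic_at (fun y => f (1 - y)%C) z.
Proof. intros A. apply (analytic_comp f (fun y => 1 - y)%C); auto. apply analytic_minus; auto using analytic_const, analytic_id. Qed.

Lemma locally_reflect (P : C -> Prop) z : locally (1 - z)%C P -> locally z (fun y => P (1 - y)%C).
Proof.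
intros H. apply locally_Cmod in H. destruct H as [r [Hr H]]. apply locally_Cmod. exists r. split; auto.
intros y Hy. apply H. replace (1 - y - (1 - z))%C with (z - y)%C by ring. now rewrite Cmod_sub_sym.
Qed.

Lemma sol_on_reflect (U : C -> Prop) w : sol_on U w -> sol_on (fun z => U (1 - z)%C) (fun y => w (1 - y)%C).
Proof.
intros S z Hz. destruct (S _ Hz) as [A O]. split. now apply analytic_reflect.
unfold hyp_ode in *. rewrite C_derive_reflect by auto.
rewrite (C_derive_loc (fun y => - C_derive w (1 - y))%C).
- rewrite (C_derive_unique _ _ (- - C_derive (C_derive w) (1 - z))%C).
  + rewrite <- O. ring.
  + apply cderiv_opp. eapply cderiv_eq. apply (cderiv_comp (C_derive w) (fun y => 1 - y)%C). apply analytic_cderiv, analytic_derive, A.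
    apply cderiv_minus. apply cderiv_const. apply cderiv_id. ring.
- generalize (locally_reflect _ _ (analytic_locally _ _ A)). apply locally_imp. intros y Hy. symmetry. now apply C_derive_reflect.
- apply analytic_opp. now apply (analytic_reflect (C_derive w)), analytic_derive.
Qed.

(** F(1 - z) solves the equation in the lens, so it is p F + q g with complex constants p and q.
    Both are determined on the real segment (0, 1), where F and g are real, through their real and
    imaginary parts. *)
Lemma connection z : lens z -> Fhyp (1 - z)%C = (- / RtoC PI * (Fhyp z * Clog z + Hhyp z))%C.
Proof.
set (g := fun y => (Fhyp y * Clog y + Hhyp y)%C).
assert (Lu : forall z, lens z -> unit_disc z) by (intros y [H _]; exact H).
assert (L01 : forall z, lens z -> z <> 0 /\ z <> 1).
{ intros y Hy. apply lens_Re in Hy. split; intros ->; simpl in Hy; lra. }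
assert (LC : forall z, lens z -> cderiv Clog z (/ z)).
{ intros y Hy. apply Clog_cderiv. right. apply lens_Re in Hy. lra. }
assert (S1 : sol_on lens Fhyp) by (apply sol_on_sub with unit_disc; auto using Fhyp_sol).
assert (S2 : sol_on lens g).
{ apply frobenius_sol. apply lens_open. intros y Hy. repeat split; auto. now apply L01. }
assert (S3 : sol_on lens (fun y => Fhyp (1 - y)%C)).
{ apply sol_on_sub with (fun z => unit_disc (1 - z)%C). intros y [_ H]; exact H. apply sol_on_reflect, Fhyp_sol. }
assert (Hc := proj1 lens_star).
assert (Wn : wron Fhyp g (RtoC (1 / 2)) <> 0).
{ intros E. assert (K := frobenius_wron Clog (RtoC (1 / 2)) (Lu _ Hc) (proj1 (L01 _ Hc)) (LC _ Hc)). fold g in K. rewrite E, Cmult_0_r in K.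
  symmetry in K. revert K. apply C1_nz. }
assert (Sp := sol_span lens (RtoC (1 / 2)) Fhyp g (fun y => Fhyp (1 - y)%C) lens_star L01 S1 S2 S3 Wn).
set (p := (wron (fun y => Fhyp (1 - y)%C) g (RtoC (1 / 2)) / wron Fhyp g (RtoC (1 / 2)))%C) in Sp.
set (q := (wron Fhyp (fun y => Fhyp (1 - y)%C) (RtoC (1 / 2)) / wron Fhyp g (RtoC (1 / 2)))%C) in Sp.
assert (Rl : forall t, 0 < t < 1 -> RtoC (fr (1 - t)) = (p * RtoC (fr t) + q * RtoC (gr t))%C).
{ intros t Ht. assert (Lt : lens (RtoC t)).
  { split. rewrite Cmod_R, Rabs_pos_eq; lra. rewrite <- RtoC_minus, Cmod_R, Rabs_pos_eq; lra. }
  specialize (Sp _ Lt). cbv beta in Sp. rewrite <- RtoC_minus, !Fhyp_real in Sp. rewrite Sp. do 2 f_equal.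
  unfold g, gr. rewrite Fhyp_real, Hhyp_real, Clog_real by lra. now rewrite RtoC_plus, RtoC_mult. }
assert (ReE : forall t, 0 < t < 1 -> fr (1 - t) = Re p * fr t + Re q * gr t).
{ intros t Ht. assert (K := f_equal Re (Rl t Ht)). rewrite re_plus, !re_scal_r in K. exact K. }
assert (ImE : forall t, 0 < t < 1 -> 0 = Im p * fr t + Im q * gr t).
{ intros t Ht. assert (K := f_equal Im (Rl t Ht)). rewrite im_plus, !im_scal_r in K. exact K. }
assert (P1 : Re p = 0).
{ apply (landen_coefficient (fun t => fr (1 - t)) (Re p) (Re q) ReE). intros k Hk. now apply fr_reflect_landen. }
(* The imaginary parts are the coefficients of the zero function, for which the Landen relation is
   trivial. *)
assert (P2 : Im p = 0).
{ apply (landen_coefficient (fun t => 0) (Im p) (Im q) ImE). intros k Hk. ring. }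
assert (Q1 : Re q = - / PI).
{ apply reflect_slope. intros t Ht. rewrite ReE, P1 by auto. ring. }
assert (Q2 : Im q = 0).
{ destruct gr_neg as [t [Ht G]]. assert (K := ImE t Ht). rewrite P2 in K. nra. }
assert (EP : p = 0) by (apply injective_projections; [exact P1 | exact P2]).
assert (EQ : q = (- / RtoC PI)%C).
{ rewrite <- RtoC_inv by (generalize PI_RGT_0; lra). rewrite <- RtoC_opp. apply injective_projections; [exact Q1 | exact Q2]. }
intros Hz. rewrite (Sp z Hz), EP, EQ. fold (g z). ring.
Qed.

(** * Slit planes and Pfaff's transformation *)

(** [germ_eq] says nothing about the centre. If the difference did not vanish on a full disc it
    would be non-zero on a punctured one. *)
Lemma analytic_germ_locally f g z : analytic_at f z -> analytic_at g z -> germ_eq z f g ->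
  locally z (fun y => f y = g y).
Proof.
intros Hf Hg E. destruct (analytic_dichotomy _ _ (analytic_minus _ _ _ Hf Hg)) as [Z|N].
- revert Z. apply locally_imp. intros y Z. now apply Ceq_minus.
- exfalso. apply (locally'_False z). generalize (locally'_and _ _ _ E N). apply locally'_imp.
  intros y _ [E1 N1]. apply N1. rewrite E1. ring.
Qed.

Lemma segment_rev a b t : segment a b t = segment b a (1 - t).
Proof. unfold segment. rewrite RtoC_minus. ring. Qed.

Lemma analytic_identity U c p f g : star c U -> U p ->
  (forall z, U z -> analytic_at f z /\ analytic_at g z) ->
  locally p (fun y => f y = g y) -> forall z, U z -> f z = g z.
Proof.
intros [Uc S] Up A E z Hz.
assert (M : forall x, U x -> meromorphic_at f x /\ meromorphic_at g x).
{ intros x Hx. destruct (A x Hx). split; now apply meromorphic_analytic. }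
assert (Ec : germ_eq c f g).
{ apply identity_segment with p; [|now apply germ_eq_locally].
  intros t Ht. apply M. rewrite segment_rev. apply S; auto. unfold unit_itv in *; lra. }
assert (Ez : germ_eq z f g).
{ apply identity_segment with c; auto. }
destruct (A z Hz) as [F G]. apply (locally_singleton _ _ (analytic_germ_locally f g z F G Ez)).
Qed.

Definition upper (z : C) : Prop := 0 < Im z.
Definition lower (z : C) : Prop := Im z < 0.
Definition neg_plane (z : C) : Prop := Im z <> 0 \/ Re z < 0.
Definition right_plane (z : C) : Prop := Im z <> 0 \/ 1 < Re z.

Lemma Im_segment a b t : Im (segment a b t) = (1 - t) * Im a + t * Im b.
Proof. unfold segment. rewrite im_plus, im_scal_r. unfold Cminus. rewrite im_plus, im_opp. ring. Qed.

Lemma Re_segment a b t : Re (segment a b t) = (1 - t) * Re a + t * Re b.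
Proof. unfold segment. rewrite re_plus, re_scal_r. unfold Cminus. rewrite re_plus, re_opp. ring. Qed.

Definition slitted (I : R -> Prop) (z : C) : Prop := Im z <> 0 \/ I (Re z).

Lemma slitted_star (I : R -> Prop) (c : R) : I c ->
  (forall x t, I x -> 0 <= t <= 1 -> I ((1 - t) * c + t * x)) -> star (RtoC c) (slitted I).
Proof.
intros Hc Hi. split. now right. intros z Hz t Ht. unfold slitted.
rewrite Im_segment, Re_segment, im_RtoC, re_RtoC.
destruct (Req_dec_T t 0) as [->|N].
- right. replace ((1 - 0) * c + 0 * Re z) with c by ring. exact Hc.
- destruct Hz as [Hz|Hz]. left. rewrite Rmult_0_r, Rplus_0_l. now apply Rmult_integral_contrapositive_currified.
  right. now apply Hi.
Qed.

Lemma cut_plane_star : star (RtoC (1 / 2)) cut_plane.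
Proof. apply (slitted_star (fun x => 0 < x < 1)). lra. intros x t Hx Ht. split; nra. Qed.

Lemma neg_plane_star : star (RtoC (- (1 / 2))) neg_plane.
Proof. apply (slitted_star (fun x => x < 0)). lra. intros x t Hx Ht. nra. Qed.

Lemma star_inter c U V : star c U -> star c V -> star c (fun z => U z /\ V z).
Proof. intros [A B] [A' B']. split; [now split|]. intros z [H1 H2] t Ht. split; auto. Qed.

Lemma unit_disc_star c : unit_disc c -> star c unit_disc.
Proof.
intros Hc. split; auto. intros z Hz t Ht. unfold unit_disc in *.
replace (segment c z t) with (segment c z t - 0)%C by ring. apply segment_ball; auto.
now replace (c - 0)%C with c by ring. now replace (z - 0)%C with z by ring.
Qed.

Lemma upper_star : star Ci upper.
Proof.
split. unfold upper; simpl; lra. intros z Hz t Ht. unfold upper in *. rewrite Im_segment.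
change (Im Ci) with 1. unfold unit_itv in Ht. destruct (Req_dec_T t 0) as [->|N]. lra. nra.
Qed.

Lemma lower_star : star (- Ci)%C lower.
Proof.
split. unfold lower; simpl; lra. intros z Hz t Ht. unfold lower in *. rewrite Im_segment.
change (Im (- Ci)) with (- (1)). unfold unit_itv in Ht. destruct (Req_dec_T t 0) as [->|N]. lra. nra.
Qed.

Lemma Im_near (z : C) (e : R) : 0 < e -> locally z (fun y => Rabs (Im y - Im z) < e).
Proof.
intros He. generalize (locally_Cball z e He). apply locally_imp. intros y Hy.
eapply Rle_lt_trans; [apply (im_le_Cmod (y - z)) | exact Hy].
Qed.

Lemma Re_near (z : C) (e : R) : 0 < e -> locally z (fun y => Rabs (Re y - Re z) < e).
Proof.
intros He. generalize (locally_Cball z e He). apply locally_imp. intros y Hy.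
eapply Rle_lt_trans; [apply (re_le_Cmod (y - z)) | exact Hy].
Qed.

Lemma upper_open z : upper z -> locally z upper.
Proof. intros H. generalize (Im_near z _ H). apply locally_imp. intros y Hy. apply Rabs_def2 in Hy. unfold upper in *. lra. Qed.

Lemma lower_open z : lower z -> locally z lower.
Proof.
intros H. generalize (Im_near z (- Im z) ltac:(unfold lower in H; lra)). apply locally_imp. intros y Hy. apply Rabs_def2 in Hy. unfold lower in *. lra.
Qed.

Lemma slitted_open (I : R -> Prop) z : (forall x, I x -> exists e, 0 < e /\ forall y, Rabs (y - x) < e -> I y) ->
  slitted I z -> locally z (slitted I).
Proof.
intros Hi [H|H].
- destruct (Rtotal_order (Im z) 0) as [L|[E|L]]; [|easy|].
  generalize (lower_open z L). apply locally_imp. intros y Hy. left. unfold lower in Hy. lra.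
  generalize (upper_open z L). apply locally_imp. intros y Hy. left. unfold upper in Hy. lra.
- destruct (Hi _ H) as [e [He K]]. generalize (Re_near z e He). apply locally_imp. intros y Hy. right. now apply K.
Qed.

Lemma cut_plane_open z : cut_plane z -> locally z cut_plane.
Proof.
apply (slitted_open (fun x => 0 < x < 1)). intros x Hx. exists (Rmin x (1 - x)). split. apply Rmin_pos; lra.
intros y Hy. assert (A := Rmin_l x (1 - x)). assert (B := Rmin_r x (1 - x)). apply Rabs_def2 in Hy. lra.
Qed.

Lemma neg_plane_open z : neg_plane z -> locally z neg_plane.
Proof.
apply (slitted_open (fun x => x < 0)). intros x Hx. exists (- x). split. lra.
intros y Hy. apply Rabs_def2 in Hy. lra.
Qed.

Lemma right_plane_open z : right_plane z -> locally z right_plane.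
Proof.
apply (slitted_open (fun x => 1 < x)). intros x Hx. exists (x - 1). split. lra.
intros y Hy. apply Rabs_def2 in Hy. lra.
Qed.

Lemma locally_inter (U V : C -> Prop) z : (U z -> locally z U) -> (V z -> locally z V) -> U z /\ V z ->
  locally z (fun y => U y /\ V y).
Proof. intros A B [H1 H2]. apply locally_and; auto. Qed.

Lemma upper_slit z : upper z -> slit z. Proof. unfold upper, slit. intros; left; lra. Qed.
Lemma upper_cut z : upper z -> cut_plane z. Proof. unfold upper, cut_plane. intros; left; lra. Qed.
Lemma lower_cut z : lower z -> cut_plane z. Proof. unfold lower, cut_plane. intros; left; lra. Qed.
Lemma upper_neg z : upper z -> neg_plane z. Proof. unfold upper, neg_plane. intros; left; lra. Qed.
Lemma lower_neg z : lower z -> neg_plane z. Proof. unfold lower, neg_plane. intros; left; lra. Qed.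
Lemma cut_slit z : cut_plane z -> slit z. Proof. unfold cut_plane, slit. intros [H|H]; [left | right]; lra. Qed.

Lemma cut_plane_nz z : cut_plane z -> z <> 0 /\ z <> 1.
Proof. intros H. split; intros ->; unfold cut_plane in H; simpl in H; lra. Qed.

Lemma neg_plane_nz z : neg_plane z -> z <> 0 /\ z <> 1.
Proof. intros H. split; intros ->; unfold neg_plane in H; simpl in H; lra. Qed.

Lemma neg_slit z : neg_plane z -> slit (- z)%C.
Proof. unfold neg_plane, slit. rewrite im_opp, re_opp. intros [H|H]; [left | right]; lra. Qed.

Lemma Clog_neg_cderiv z : neg_plane z -> cderiv (fun y => Clog (- y))%C z (/ z)%C.
Proof.
intros H. eapply cderiv_eq. apply (cderiv_comp Clog (fun y => - y)%C). apply Clog_cderiv, neg_slit, H.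
apply cderiv_opp, cderiv_id. field. apply neg_plane_nz, H.
Qed.

(** The two logarithms have the same derivative 1 / z on the upper half plane, so their difference
    is the constant found at i. *)
Lemma Clog_upper z : upper z -> Clog z = (Clog (- z) + Ci * RtoC PI)%C.
Proof.
intros Hz. assert (E : (Clog z - Clog (- z))%C = (Clog Ci - Clog (- Ci))%C).
{ apply (cderiv_zero_segment (fun y => Clog y - Clog (- y))%C). intros t Ht.
  assert (U := proj2 upper_star z Hz t Ht). eapply cderiv_eq. apply cderiv_minus. apply Clog_cderiv, upper_slit, U.
  apply Clog_neg_cderiv, upper_neg, U. ring. }
rewrite Clog_Ci in E. transitivity (Clog z - Clog (- z) + Clog (- z))%C. ring. rewrite E. ring.
Qed.

Lemma Clog_lower z : lower z -> Clog z = (Clog (- z) - Ci * RtoC PI)%C.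
Proof.
intros Hz. assert (U : upper (- z)%C) by (unfold upper, lower in *; rewrite im_opp; lra).
rewrite (Clog_upper _ U). replace (- - z)%C with z by ring. ring.
Qed.

(* Pfaff's transformation carries solutions on the cut plane to solutions on
   the plane slit along the positive axis. *)
Definition pfaff (w : C -> C) (x : C) : C := (cexp (- / 2 * Clog (1 - x)) * w (x / (x - 1)))%C.

Lemma pfaff_factor_cderiv x : neg_plane x ->
  cderiv (fun x => cexp (- / 2 * Clog (1 - x)))%C x (cexp (- / 2 * Clog (1 - x)) / (2 * (1 - x)))%C.
Proof.
intros Hx. destruct (neg_plane_nz x Hx) as [N0 N1].
assert (S : slit (1 - x)%C).
{ unfold slit, neg_plane in *. unfold Cminus. rewrite im_plus, im_opp, re_plus, re_opp. simpl. destruct Hx; [left | right]; lra. }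
eapply cderiv_eq.
- apply (cderiv_comp cexp (fun x => - / 2 * Clog (1 - x))%C). apply cexp_cderiv.
  apply (cderiv_mult (fun _ => - / 2)%C). apply cderiv_const.
  apply (cderiv_comp Clog (fun x => 1 - x)%C). apply Clog_cderiv, S. apply cderiv_minus. apply cderiv_const. apply cderiv_id.
- field. apply Cminus_eq_contra. auto.
Qed.

Lemma pfaff_map_cderiv (x : C) : x <> RtoC 1 -> cderiv (fun x => x / (x - 1))%C x (- (1) / ((x - 1) * (x - 1)))%C.
Proof.
intros N. assert (N' : (x - 1)%C <> 0) by now apply Cminus_eq_contra.
eapply cderiv_eq. apply cderiv_div. apply cderiv_id. apply cderiv_minus. apply cderiv_id. apply cderiv_const. exact N'.
cbv beta. field. auto.
Qed.

Lemma pfaff_map_cut x : neg_plane x -> cut_plane (x / (x - 1))%C.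
Proof.
intros H. destruct (neg_plane_nz x H) as [N0 N1]. destruct x as [a b].
assert (P : 0 < (a - 1) ^ 2 + b ^ 2).
{ assert (Q1 := pow2_ge_0 (a - 1)). assert (Q2 := pow2_ge_0 b).
  destruct H as [H|H]; change (b <> 0) in H || change (a < 0) in H.
  - assert (0 < b ^ 2) by (rewrite <- Rsqr_pow2; now apply Rsqr_pos_lt). lra.
  - assert (0 < (a - 1) ^ 2) by (apply pow2_gt_0; lra). lra. }
assert (E : ((a, b) / ((a, b) - 1))%C = ((a * (a - 1) + b * b) / ((a - 1) ^ 2 + b ^ 2), - b / ((a - 1) ^ 2 + b ^ 2))).
{ unfold Cdiv, Cinv, Cmult, Cminus, Cplus, Copp, RtoC; cbn [fst snd]. 
  replace (a + - (1)) with (a - 1) by ring. replace (b + - 0) with b by ring.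
  apply injective_projections; cbn [fst snd]; field; lra. }
rewrite E. unfold cut_plane. cbn [Re Im fst snd].
change (Im (?x, ?y)) with y. destruct (Req_dec_T b 0) as [->|N].
- right. unfold neg_plane in H. simpl in H.
  change (0 < (a * (a - 1) + 0 * 0) / ((a - 1) ^ 2 + 0 ^ 2) < 1).
  replace ((a * (a - 1) + 0 * 0) / ((a - 1) ^ 2 + 0 ^ 2)) with (1 - / (1 - a)) by (field; lra).
  assert (0 < / (1 - a)) by (apply Rinv_0_lt_compat; lra).
  assert (/ (1 - a) < 1). { rewrite <- Rinv_1. apply Rinv_lt_contravar; lra. } lra.
- left. change (- b / ((a - 1) ^ 2 + b ^ 2) <> 0). unfold Rdiv. apply Rmult_integral_contrapositive_currified. lra.
  apply Rinv_neq_0_compat. lra.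
Qed.

Lemma pfaff_factor_analytic x : neg_plane x -> analytic_at (fun x => cexp (- / 2 * Clog (1 - x)))%C x.
Proof.
intros Hx. apply analytic_intro with (fun x => cexp (- / 2 * Clog (1 - x)) / (2 * (1 - x)))%C.
generalize (neg_plane_open x Hx). apply locally_imp. intros y Hy. split. now apply pfaff_factor_cderiv.
apply ccont_mult. eapply cderiv_ccont, pfaff_factor_cderiv, Hy.
apply (ccont_inv (fun x => 2 * (1 - x))%C). apply ccont_mult. apply ccont_const.
apply ccont_plus. apply ccont_const. apply ccont_opp, ccont_id.
destruct (neg_plane_nz y Hy). apply Cmult_neq_0. intros E; apply RtoC_inj in E; lra. apply Cminus_eq_contra; auto.
Qed.

Lemma pfaff_analytic w x : (forall z, cut_plane z -> analytic_at w z) -> neg_plane x -> analytic_at (pfaff w) x.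
Proof.
intros A Hx. destruct (neg_plane_nz x Hx) as [N0 N1]. apply analytic_mult. now apply pfaff_factor_analytic.
apply (analytic_comp w (fun x => x / (x - 1))%C). now apply A, pfaff_map_cut.
apply analytic_div; auto using analytic_id. apply analytic_minus; auto using analytic_id, analytic_const. now apply Cminus_eq_contra.
Qed.

Lemma pfaff_cderiv w x : (forall z, cut_plane z -> analytic_at w z) -> neg_plane x ->
  cderiv (pfaff w) x (pfaff w x / (2 * (1 - x)) - pfaff (C_derive w) x / ((x - 1) * (x - 1)))%C.
Proof.
intros A Hx. destruct (neg_plane_nz x Hx) as [N0 N1].
assert (N1' : (x - 1)%C <> 0) by now apply Cminus_eq_contra.
assert (N1'' : (1 - x)%C <> 0) by (apply Cminus_eq_contra; auto).
eapply cderiv_eq. apply (cderiv_mult _ (fun x => w (x / (x - 1)))%C). now apply pfaff_factor_cderiv.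
apply (cderiv_comp w (fun x => x / (x - 1))%C). now apply analytic_cderiv, A, pfaff_map_cut. now apply pfaff_map_cderiv.
unfold pfaff. field. auto.
Qed.

(** For a = b = 1/2 and c = 1 the transformed parameters (a, c - b; c) are again (1/2, 1/2; 1), so
    that Pfaff's factor (1 - x)^(-1/2) maps the equation to itself. *)
Lemma pfaff_sol w : sol_on cut_plane w -> sol_on neg_plane (pfaff w).
Proof.
intros S x Hx. destruct (neg_plane_nz x Hx) as [N0 N1].
assert (N1' : (x - 1)%C <> 0) by now apply Cminus_eq_contra.
assert (N1'' : (1 - x)%C <> 0) by (apply Cminus_eq_contra; auto).
assert (A : forall z, cut_plane z -> analytic_at w z) by (intros z Hz; now apply S).
assert (A' : forall z, cut_plane z -> analytic_at (C_derive w) z) by (intros z Hz; now apply analytic_derive, A).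
split. now apply pfaff_analytic.
unfold hyp_ode. rewrite (C_derive_unique _ _ _ (pfaff_cderiv w x A Hx)).
assert (E2 : C_derive (C_derive (pfaff w)) x =
  (((pfaff w x / (2 * (1 - x)) - pfaff (C_derive w) x / ((x - 1) * (x - 1))) * (2 * (1 - x)) + 2 * pfaff w x) / ((2 * (1 - x)) * (2 * (1 - x)))
  - ((pfaff (C_derive w) x / (2 * (1 - x)) - pfaff (C_derive (C_derive w)) x / ((x - 1) * (x - 1))) * ((x - 1) * (x - 1)) - pfaff (C_derive w) x * (2 * (x - 1)))
     / ((x - 1) * (x - 1) * ((x - 1) * (x - 1))))%C).
{ apply C_derive_unique.
  apply cderiv_ext_loc with (fun x => pfaff w x / (2 * (1 - x)) - pfaff (C_derive w) x / ((x - 1) * (x - 1)))%C.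
  - generalize (neg_plane_open x Hx). apply locally_imp. intros y Hy. symmetry. apply C_derive_unique. now apply pfaff_cderiv.
  - eapply cderiv_eq. apply (cderiv_minus (fun x => pfaff w x / (2 * (1 - x)))%C (fun x => pfaff (C_derive w) x / ((x - 1) * (x - 1)))%C).
    + apply (cderiv_div (pfaff w) (fun x => 2 * (1 - x))%C). now apply pfaff_cderiv.
      apply (cderiv_mult (fun _ => RtoC 2)). apply cderiv_const. apply cderiv_minus. apply cderiv_const. apply cderiv_id.
      apply Cmult_neq_0; auto. intros E; apply RtoC_inj in E; lra.
    + apply (cderiv_div (pfaff (C_derive w)) (fun x => (x - 1) * (x - 1))%C). now apply pfaff_cderiv.
      apply (cderiv_mult (fun x => x - 1)%C (fun x => x - 1)%C); apply cderiv_minus; try apply cderiv_id; apply cderiv_const.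
      now apply Cmult_neq_0.
    + field. auto. }
rewrite E2. destruct (S _ (pfaff_map_cut x Hx)) as [_ O]. unfold hyp_ode in O. unfold pfaff.
set (s := cexp (- / 2 * Clog (1 - x))%C). set (y := (x / (x - 1))%C) in *.
set (w0 := w y) in *. set (w1 := C_derive w y) in *. set (w2 := C_derive (C_derive w) y) in *. clearbody w0 w1 w2.
(* The operator at x applied to the transform is s / (x - 1) times the operator at y = x / (x - 1)
   applied to w. *)
transitivity (s / (x - 1) * (y * (1 - y) * w2 + (1 - 2 * y) * w1 - w0 / 4))%C.
unfold y. cbv beta. field. auto.
rewrite O. ring.
Qed.

(** * Bases of solutions on three charts *)

Lemma Cinv_nz (z : C) : z <> 0 -> (/ z)%C <> 0.
Proof. intros H E. apply C1_nz. rewrite <- (Cinv_r z H), E. ring. Qed.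

Lemma pfaff_wron w1 w2 x : sol_on cut_plane w1 -> sol_on cut_plane w2 -> neg_plane x ->
  wron w1 w2 (x / (x - 1))%C <> 0 -> wron (pfaff w1) (pfaff w2) x <> 0.
Proof.
intros S1 S2 Hx N. destruct (neg_plane_nz x Hx) as [N0 N1].
assert (N1' : (x - 1)%C <> 0) by now apply Cminus_eq_contra.
assert (N1'' : (1 - x)%C <> 0) by (apply Cminus_eq_contra; auto).
assert (A1 : forall z, cut_plane z -> analytic_at w1 z) by (intros z Hz; now apply S1).
assert (A2 : forall z, cut_plane z -> analytic_at w2 z) by (intros z Hz; now apply S2).
unfold wron. rewrite (C_derive_unique _ _ _ (pfaff_cderiv w1 x A1 Hx)), (C_derive_unique _ _ _ (pfaff_cderiv w2 x A2 Hx)).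
set (s := cexp (- / 2 * Clog (1 - x))%C). assert (Hs : s <> 0) by apply cexp_nz.
unfold pfaff. fold s. unfold wron in N.
set (y := (x / (x - 1))%C) in *. clearbody s y.
match goal with |- ?e <> _ => replace e with ((- (1)) * (s * s / ((x - 1) * (x - 1))) *
   (w1 y * C_derive w2 y - C_derive w1 y * w2 y))%C end.
2:{ field. auto. }
apply Cmult_neq_0; auto. apply Cmult_neq_0.
- intros E. apply C1_nz. transitivity ((- (1)) * (- (1)))%C. ring. rewrite E. ring.
- unfold Cdiv. apply Cmult_neq_0. now apply Cmult_neq_0. now apply Cinv_nz, Cmult_neq_0.
Qed.

Definition fundamental (U : C -> Prop) (u1 u2 : C -> C) : Prop :=
  sol_on U u1 /\ sol_on U u2 /\ forall z, U z -> wron u1 u2 z <> 0.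

Lemma wron_lin p q r s u v z : analytic_at u z -> analytic_at v z ->
  wron (fun x => p * u x + q * v x)%C (fun x => r * u x + s * v x)%C z = ((p * s - q * r) * wron u v z)%C.
Proof. intros Hu Hv. unfold wron. rewrite !C_derive_lin by auto. ring. Qed.

Lemma wron_loc u1 u2 v1 v2 z : locally z (fun y => u1 y = v1 y) -> locally z (fun y => u2 y = v2 y) ->
  analytic_at u1 z -> analytic_at u2 z -> wron u1 u2 z = wron v1 v2 z.
Proof.
intros E1 E2 A1 A2. unfold wron. rewrite (C_derive_loc u1 v1), (C_derive_loc u2 v2) by auto.
now rewrite (locally_singleton _ _ E1), (locally_singleton _ _ E2).
Qed.

Lemma fundamental_star U c u1 u2 p : star c U -> (forall z, U z -> z <> 0 /\ z <> 1) ->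
  sol_on U u1 -> sol_on U u2 -> U p -> wron u1 u2 p <> 0 -> fundamental U u1 u2.
Proof.
intros S N S1 S2 Hp Hw. split; [|split]; auto. apply (wron_nz U c); auto.
intros E. assert (K := wron_const U c u1 u2 S S1 S2 p Hp). rewrite E, Cmult_0_r in K. revert K.
destruct (N p Hp). apply Cmult_neq_0; auto. apply Cmult_neq_0; auto. apply Cminus_eq_contra; auto.
Qed.

Lemma fundamental_span U c u1 u2 v : star c U -> (forall z, U z -> z <> 0 /\ z <> 1) ->
  fundamental U u1 u2 -> sol_on U v -> exists p q, forall z, U z -> v z = (p * u1 z + q * u2 z)%C.
Proof.
intros S N [S1 [S2 W]] Sv. eexists. eexists. apply (sol_span U c); auto. apply W, S.
Qed.

Lemma fundamental_sub (U V : C -> Prop) u1 u2 : (forall z, V z -> U z) -> fundamental U u1 u2 -> fundamental V u1 u2.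
Proof.
intros H [S1 [S2 W]]. split; [|split]. now apply sol_on_sub with U. now apply sol_on_sub with U. auto.
Qed.

Definition om1 (x : C) : C := (RtoC (PI / 2) * Fhyp x)%C.
(** The logarithm is left open so that one formula covers the slit disc of the cut plane and the one
    slit along the positive axis. *)
Definition om2 (l : C -> C) (x : C) : C := (- (Ci / 2) * (Fhyp x * l x + Hhyp x))%C.

Lemma om_fundamental (U : C -> Prop) (l : C -> C) : (forall z, U z -> locally z U) ->
  (forall z, U z -> unit_disc z /\ z <> 0 /\ cderiv l z (/ z)) -> fundamental U om1 (om2 l).
Proof.
intros Uo H. assert (SF : sol_on U Fhyp) by (apply sol_on_sub with unit_disc; [intros; now apply H | apply Fhyp_sol]).
assert (SG := frobenius_sol U l Uo H).
assert (E1 : forall x, om1 x = (RtoC (PI / 2) * Fhyp x + 0 * (Fhyp x * l x + Hhyp x))%C) by (intros; unfold om1; ring).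
assert (E2 : forall x, om2 l x = (0 * Fhyp x + - (Ci / 2) * (Fhyp x * l x + Hhyp x))%C) by (intros; unfold om2; ring).
split; [|split].
- apply sol_on_ext with (fun x => RtoC (PI / 2) * Fhyp x + 0 * (Fhyp x * l x + Hhyp x))%C; auto. now apply sol_on_lin.
- apply sol_on_ext with (fun x => 0 * Fhyp x + - (Ci / 2) * (Fhyp x * l x + Hhyp x))%C; auto. now apply sol_on_lin.
- intros z Hz. rewrite (wron_loc om1 (om2 l) (fun x => RtoC (PI / 2) * Fhyp x + 0 * (Fhyp x * l x + Hhyp x))%C (fun x => 0 * Fhyp x + - (Ci / 2) * (Fhyp x * l x + Hhyp x))%C).
  + rewrite (wron_lin (RtoC (PI / 2)) 0 0 (- (Ci / 2)) Fhyp (fun x => Fhyp x * l x + Hhyp x)%C) by (try apply SF; try apply SG; auto).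
    destruct (H z Hz) as [D [N L]]. assert (K := frobenius_wron l z D N L).
    apply Cmult_neq_0.
    * replace (RtoC (PI / 2) * - (Ci / 2) - 0 * 0)%C with (- (Ci * RtoC (PI / 4)))%C.
      2:{ rewrite !RtoC_div by lra. field. }
      intros E. assert (E' : (Ci * RtoC (PI / 4))%C = 0) by (transitivity (- - (Ci * RtoC (PI / 4)))%C; [ring | rewrite E; ring]).
      revert E'. apply Cmult_neq_0. apply Ci_nz. intros E'. apply RtoC_inj in E'. generalize PI_RGT_0; lra.
    * intros E. rewrite E, Cmult_0_r in K. symmetry in K. revert K. apply C1_nz.
  + apply locally_all; auto.
  + apply locally_all; auto.
  + apply analytic_mult. apply analytic_const. apply SF, Hz.
  + apply analytic_mult. apply analytic_const. apply SG, Hz.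
Qed.

(** The unit disc without (- 1, 0]: here the series of the normalised basis converge and [Clog] is
    analytic. *)
Definition half_disc_cut (z : C) : Prop := cut_plane z /\ unit_disc z.

Lemma half_disc_cut_open z : half_disc_cut z -> locally z half_disc_cut.
Proof. apply locally_inter; [apply cut_plane_open | apply unit_disc_open]. Qed.

Lemma half_disc_cut_star : star (RtoC (1 / 2)) half_disc_cut.
Proof.
apply star_inter. apply cut_plane_star. apply unit_disc_star. unfold unit_disc. rewrite Cmod_R, Rabs_pos_eq; lra.
Qed.

Lemma om_fundamental_cut : fundamental half_disc_cut om1 (om2 Clog).
Proof.
apply om_fundamental. apply half_disc_cut_open. intros z [H1 H2]. split; auto. split. now apply cut_plane_nz.
now apply Clog_cderiv, cut_slit.
Qed.

(** In the slit disc w1 and w2 are combinations of the normalised pair. Inverting the matrix of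
    coefficients yields combinations of w1 and w2, defined on the whole cut plane, that restrict to
    the normalised pair. *)
Lemma principal_basis w1 w2 : solution_basis w1 w2 -> exists u1 u2,
  fundamental cut_plane u1 u2 /\ forall z, half_disc_cut z -> u1 z = om1 z /\ u2 z = om2 Clog z.
Proof.
intros [A1 A2 O1 O2 I].
assert (S1 : sol_on cut_plane w1) by (intros z Hz; split; [now apply A1 | now apply O1]).
assert (S2 : sol_on cut_plane w2) by (intros z Hz; split; [now apply A2 | now apply O2]).
assert (N : forall z, half_disc_cut z -> z <> 0 /\ z <> 1) by (intros z [Hz _]; now apply cut_plane_nz).
assert (Sub : forall w, sol_on cut_plane w -> sol_on half_disc_cut w).
{ intros w. apply sol_on_sub. intros z [Hz _]; exact Hz. }
destruct (fundamental_span _ _ _ _ w1 half_disc_cut_star N om_fundamental_cut (Sub _ S1)) as [a [b E1]].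
destruct (fundamental_span _ _ _ _ w2 half_disc_cut_star N om_fundamental_cut (Sub _ S2)) as [c [d E2]].
assert (Hh := proj1 half_disc_cut_star).
(* A linear relation between the rows of coefficients is a relation between w1 and w2 in the disc,
   hence on the cut plane, hence trivial. This makes the determinant non-zero. *)
assert (Van : forall p q, (p * a + q * c)%C = 0 -> (p * b + q * d)%C = 0 -> p = 0 /\ q = 0).
{ intros p q K1 K2. apply I. intros z Hz.
  change ((fun x => p * w1 x + q * w2 x)%C z = (fun _ => RtoC 0) z).
  apply (analytic_identity cut_plane (RtoC (1 / 2)) (RtoC (1 / 2))); auto.
  - apply cut_plane_star.
  - apply cut_plane_star.
  - intros y Hy. split. apply analytic_lin; auto. apply analytic_const.
  - generalize (half_disc_cut_open _ Hh). apply locally_imp. intros y Hy. rewrite (E1 y Hy), (E2 y Hy).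
    transitivity ((p * a + q * c) * om1 y + (p * b + q * d) * om2 Clog y)%C. ring. rewrite K1, K2. ring. }
assert (D : (a * d - b * c)%C <> 0).
{ intros D. destruct (Van d (- b)%C) as [Z1 Z2]. rewrite <- D. ring. ring.
  destruct (Van c (- a)%C) as [Z3 Z4]. ring. transitivity (- (a * d - b * c))%C. ring. rewrite D. ring.
  assert (Hb : b = 0) by (transitivity (- - b)%C; [ring | rewrite Z2; ring]).
  assert (Ha : a = 0) by (transitivity (- - a)%C; [ring | rewrite Z4; ring]).
  destruct (Van 1 0) as [Z5 _]; [rewrite Ha; ring | rewrite Hb; ring |]. revert Z5. apply C1_nz. }
exists (fun z => d / (a * d - b * c) * w1 z + - b / (a * d - b * c) * w2 z)%C,
  (fun z => - c / (a * d - b * c) * w1 z + a / (a * d - b * c) * w2 z)%C.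
assert (Ex : forall z, half_disc_cut z -> (d / (a * d - b * c) * w1 z + - b / (a * d - b * c) * w2 z)%C = om1 z /\
   (- c / (a * d - b * c) * w1 z + a / (a * d - b * c) * w2 z)%C = om2 Clog z).
{ intros z Hz. rewrite (E1 z Hz), (E2 z Hz). split; field; auto. }
split; auto.
assert (Sl : forall p q, sol_on cut_plane (fun z => p * w1 z + q * w2 z)%C) by (intros; now apply sol_on_lin).
apply (fundamental_star cut_plane (RtoC (1 / 2)) _ _ (RtoC (1 / 2))); auto.
- apply cut_plane_star.
- intros z Hz; now apply cut_plane_nz.
- apply cut_plane_star.
- rewrite (wron_loc _ _ om1 (om2 Clog)); try (apply Sl; apply cut_plane_star).
  + now apply om_fundamental_cut.
  + generalize (half_disc_cut_open _ Hh). apply locally_imp. intros y Hy. now apply Ex.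
  + generalize (half_disc_cut_open _ Hh). apply locally_imp. intros y Hy. now apply Ex.
Qed.

Lemma upper_nz z : upper z -> z <> 0 /\ z <> 1.
Proof. intros H. apply cut_plane_nz. now apply upper_cut. Qed.

Lemma unit_disc_half_i : unit_disc (Ci / 2)%C /\ unit_disc (- (Ci / 2))%C.
Proof.
assert (H : Cmod (Ci / 2) < 1).
{ rewrite Cmod_div, Cmod_Ci, Cmod_R, Rabs_pos_eq by (try (intros E; apply RtoC_inj in E); lra). lra. }
split; auto. unfold unit_disc. now rewrite Cmod_opp.
Qed.

Lemma upper_half_i : upper (Ci / 2)%C.
Proof. unfold upper. replace (Ci / 2)%C with (RtoC (/ 2) * Ci)%C. rewrite im_scal_l. simpl. lra. rewrite RtoC_inv by lra. field. Qed.

Lemma lower_half_i : lower (- (Ci / 2))%C.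
Proof. unfold lower. rewrite im_opp. generalize upper_half_i. unfold upper. lra. Qed.

Lemma Ci_Ci : (Ci * Ci)%C = (- (1))%C.
Proof. unfold Ci, RtoC, Cmult, Copp; simpl. f_equal; ring. Qed.

(* Monodromy around [0]: crossing the negative axis adds [2 omega_1] to [omega_2]. *)
Lemma basis_across_negative_axis u1 u2 : fundamental cut_plane u1 u2 ->
  (forall z, half_disc_cut z -> u1 z = om1 z /\ u2 z = om2 Clog z) ->
  exists v1 v2, fundamental neg_plane v1 v2 /\
    (forall z, upper z -> v1 z = u1 z /\ v2 z = u2 z) /\
    (forall z, lower z -> v1 z = u1 z /\ v2 z = (2 * u1 z + u2 z)%C).
Proof.
intros [S1 [S2 W]] Ex.
assert (T1 := pfaff_sol u1 S1). assert (T2 := pfaff_sol u2 S2).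
assert (FT : fundamental neg_plane (pfaff u1) (pfaff u2)).
{ apply (fundamental_star _ _ _ _ (RtoC (- (1 / 2))) neg_plane_star neg_plane_nz T1 T2).
  apply neg_plane_star. apply pfaff_wron; auto. apply neg_plane_star. apply W, pfaff_map_cut, neg_plane_star. }
(* Pfaff's transforms are some basis on the second plane; the combinations that equal u1 and u2 on
   the upper half plane are the wanted one. *)
destruct (fundamental_span upper Ci _ _ u1 upper_star upper_nz (fundamental_sub _ _ _ _ upper_neg FT) (sol_on_sub _ _ _ upper_cut S1)) as [p [q E1]].
destruct (fundamental_span upper Ci _ _ u2 upper_star upper_nz (fundamental_sub _ _ _ _ upper_neg FT) (sol_on_sub _ _ _ upper_cut S2)) as [r [s E2]].
set (v1 := fun z => (p * pfaff u1 z + q * pfaff u2 z)%C). set (v2 := fun z => (r * pfaff u1 z + s * pfaff u2 z)%C).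
assert (V1 : sol_on neg_plane v1) by now apply sol_on_lin.
assert (V2 : sol_on neg_plane v2) by now apply sol_on_lin.
exists v1, v2. split; [|split].
- apply (fundamental_star _ _ _ _ Ci neg_plane_star neg_plane_nz V1 V2). apply upper_neg, upper_star.
  rewrite <- (wron_loc u1 u2 v1 v2).
  + apply W. apply upper_cut, upper_star.
  + generalize (upper_open _ (proj1 upper_star)). apply locally_imp. exact E1.
  + generalize (upper_open _ (proj1 upper_star)). apply locally_imp. exact E2.
  + apply S1, upper_cut, upper_star.
  + apply S2, upper_cut, upper_star.
- intros z Hz. split; symmetry; auto.
(* [l] continues [Clog] from the upper half plane across the negative axis. Below the axis it is
   Clog + 2 pi i, and - (i/2) (2 pi i) F = pi F = 2 omega_1. *)
- set (l := fun z => (Clog (- z) + Ci * RtoC PI)%C).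
  set (U := fun z => neg_plane z /\ unit_disc z).
  assert (Uo : forall z, U z -> locally z U) by (intros z; apply locally_inter; [apply neg_plane_open | apply unit_disc_open]).
  assert (Us : star (RtoC (- (1 / 2))) U).
  { apply star_inter. apply neg_plane_star. apply unit_disc_star. unfold unit_disc. rewrite Cmod_R, Rabs_left1; lra. }
  assert (FU : fundamental U om1 (om2 l)).
  { apply om_fundamental; auto. intros z [H1 H2]. split; auto. split. now apply neg_plane_nz.
    eapply cderiv_eq. apply cderiv_plus. now apply Clog_neg_cderiv. apply cderiv_const. ring. }
  destruct FU as [F1 [F2 _]].
  assert (Ui : U (Ci / 2)%C) by (split; [apply upper_neg, upper_half_i | apply unit_disc_half_i]).
  assert (Near : locally (Ci / 2)%C (fun y => upper y /\ half_disc_cut y)).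
  { apply locally_inter. apply upper_open. apply half_disc_cut_open. split. apply upper_half_i.
    split. apply upper_cut, upper_half_i. apply unit_disc_half_i. }
  assert (G1 : forall z, U z -> v1 z = om1 z).
  { apply (analytic_identity U _ (Ci / 2)%C v1 om1 Us Ui). intros z Hz. split. apply V1, Hz. apply F1, Hz.
    revert Near. apply locally_imp. intros y [Y1 Y2]. unfold v1. rewrite <- E1 by auto. now apply Ex. }
  assert (G2 : forall z, U z -> v2 z = om2 l z).
  { apply (analytic_identity U _ (Ci / 2)%C v2 (om2 l) Us Ui). intros z Hz. split. apply V2, Hz. apply F2, Hz.
    revert Near. apply locally_imp. intros y [Y1 Y2]. unfold v2. rewrite <- E2 by auto. rewrite (proj2 (Ex y Y2)).
    unfold om2, l. now rewrite <- Clog_upper. }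
  assert (Near2 : locally (- (Ci / 2))%C (fun y => lower y /\ half_disc_cut y)).
  { apply locally_inter. apply lower_open. apply half_disc_cut_open. split. apply lower_half_i.
    split. apply lower_cut, lower_half_i. apply unit_disc_half_i. }
  intros z Hz. split.
  + revert z Hz. apply (analytic_identity lower _ (- (Ci / 2))%C v1 u1 lower_star lower_half_i).
    intros z Hz. split. apply V1, lower_neg, Hz. apply S1, lower_cut, Hz.
    revert Near2. apply locally_imp. intros y [Y1 Y2]. rewrite G1. symmetry; now apply Ex.
    split. now apply lower_neg. apply Y2.
  + revert z Hz. apply (analytic_identity lower _ (- (Ci / 2))%C v2 (fun z => 2 * u1 z + u2 z)%C lower_star lower_half_i).
    intros z Hz. split. apply V2, lower_neg, Hz.
    apply analytic_plus. apply analytic_mult. apply analytic_const. apply S1, lower_cut, Hz. apply S2, lower_cut, Hz.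
    revert Near2. apply locally_imp. intros y [Y1 Y2]. rewrite G2. destruct (Ex y Y2) as [-> ->].
    unfold om1, om2, l. rewrite (Clog_lower y Y1), RtoC_div by lra.
    transitivity (- (Ci / 2) * (Fhyp y * (Clog (- y) - Ci * RtoC PI) + Hhyp y) + - (Ci * Ci) * RtoC PI * Fhyp y)%C. field.
    rewrite Ci_Ci. field.
    split. now apply lower_neg. apply Y2.
Qed.

Lemma cut_plane_reflect z : cut_plane z -> cut_plane (1 - z)%C.
Proof.
unfold cut_plane. unfold Cminus. rewrite im_plus, im_opp, re_plus, re_opp. simpl. intros [H|H]; [left | right]; lra.
Qed.

Lemma right_plane_reflect z : right_plane z -> neg_plane (1 - z)%C.
Proof.
unfold right_plane, neg_plane. unfold Cminus. rewrite im_plus, im_opp, re_plus, re_opp. simpl. intros [H|H]; [left | right]; lra.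
Qed.

Lemma upper_reflect z : upper z -> lower (1 - z)%C.
Proof. unfold upper, lower. unfold Cminus. rewrite im_plus, im_opp. simpl. lra. Qed.

Lemma lower_reflect z : lower z -> upper (1 - z)%C.
Proof. unfold upper, lower. unfold Cminus. rewrite im_plus, im_opp. simpl. lra. Qed.

(** The connection formula, valid in the lens, spreads over the cut plane by the identity theorem.
    The second relation is the first one at 1 - z. *)
Lemma reflection u1 u2 : fundamental cut_plane u1 u2 ->
  (forall z, half_disc_cut z -> u1 z = om1 z /\ u2 z = om2 Clog z) ->
  forall z, cut_plane z -> u1 (1 - z)%C = (- Ci * u2 z)%C /\ u2 (1 - z)%C = (Ci * u1 z)%C.
Proof.
intros [S1 [S2 W]] Ex.
assert (H1 : forall z, cut_plane z -> u1 (1 - z)%C = (- Ci * u2 z)%C).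
{ apply (analytic_identity cut_plane (RtoC (1 / 2)) (RtoC (1 / 2)) (fun z => u1 (1 - z)%C) (fun z => - Ci * u2 z)%C).
  - apply cut_plane_star.
  - apply cut_plane_star.
  - intros z Hz. split. apply (analytic_reflect u1). now apply S1, cut_plane_reflect.
    apply analytic_mult. apply analytic_const. now apply S2.
  - generalize (locally_inter lens cut_plane _ (lens_open _) (cut_plane_open _) (conj (proj1 lens_star) (proj1 cut_plane_star))).
    apply locally_imp. intros y [[L1 L2] Y].
    rewrite (proj1 (Ex (1 - y)%C (conj (cut_plane_reflect _ Y) L2))), (proj2 (Ex y (conj Y L1))).
    unfold om1, om2. rewrite (connection y (conj L1 L2)), RtoC_div by lra.
    assert (NP : RtoC PI <> 0) by (intros E; apply RtoC_inj in E; generalize PI_RGT_0; lra).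
    transitivity ((Ci * Ci) / 2 * (Fhyp y * Clog y + Hhyp y))%C. rewrite Ci_Ci. field. auto. field. }
intros z Hz. split; auto.
assert (K := H1 (1 - z)%C (cut_plane_reflect _ Hz)). replace (1 - (1 - z))%C with z in K by ring.
rewrite K. transitivity (- (Ci * Ci) * u2 (1 - z))%C. rewrite Ci_Ci. ring. ring.
Qed.

Lemma wron_reflect u v z : analytic_at u (1 - z)%C -> analytic_at v (1 - z)%C ->
  wron (fun y => u (1 - y)%C) (fun y => v (1 - y)%C) z = (- wron u v (1 - z))%C.
Proof. intros A B. unfold wron. rewrite !C_derive_reflect by auto. ring. Qed.

(* Monodromy around [1], obtained from the one around [0] by [x -> 1 - x]. *)
Lemma basis_across_right_axis u1 u2 v1 v2 :
  (forall z, cut_plane z -> u1 (1 - z)%C = (- Ci * u2 z)%C /\ u2 (1 - z)%C = (Ci * u1 z)%C) ->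
  fundamental neg_plane v1 v2 ->
  (forall z, upper z -> v1 z = u1 z /\ v2 z = u2 z) ->
  (forall z, lower z -> v1 z = u1 z /\ v2 z = (2 * u1 z + u2 z)%C) ->
  exists t1 t2, fundamental right_plane t1 t2 /\
    (forall z, lower z -> t1 z = u1 z /\ t2 z = u2 z) /\
    (forall z, upper z -> t1 z = (u1 z + - (2) * u2 z)%C /\ t2 z = u2 z).
Proof.
intros R [S1 [S2 W]] Up Lo.
set (r1 := fun z => v1 (1 - z)%C). set (r2 := fun z => v2 (1 - z)%C).
assert (Sr : forall v, sol_on neg_plane v -> sol_on right_plane (fun z => v (1 - z)%C)).
{ intros v Sv. apply sol_on_sub with (fun z => neg_plane (1 - z)%C). apply right_plane_reflect. now apply sol_on_reflect. }
assert (R1 := Sr _ S1). assert (R2 := Sr _ S2). fold r1 in R1. fold r2 in R2.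
(* The relations of [reflection] read backwards: u1 z = - i u2 (1 - z) and u2 z = i u1 (1 - z), with
   the continued pair v1, v2 in place of u1, u2. *)
exists (fun z => 0 * r1 z + - Ci * r2 z)%C, (fun z => Ci * r1 z + 0 * r2 z)%C. split; [|split].
- split; [|split]. now apply sol_on_lin. now apply sol_on_lin.
  intros z Hz. rewrite wron_lin by (try apply R1; try apply R2; auto).
  assert (Hz' := right_plane_reflect z Hz).
  unfold r1, r2. rewrite wron_reflect by (try apply S1; try apply S2; auto).
  replace ((0 * 0 - - Ci * Ci) * - wron v1 v2 (1 - z))%C with (wron v1 v2 (1 - z)). now apply W.
  transitivity (- (Ci * Ci) * wron v1 v2 (1 - z))%C. rewrite Ci_Ci. ring. ring.
- intros z Hz. unfold r1, r2. destruct (Up _ (lower_reflect z Hz)) as [-> ->].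
  destruct (R z (lower_cut z Hz)) as [-> ->]. split.
  transitivity (- (Ci * Ci) * u1 z)%C. ring. rewrite Ci_Ci. ring.
  transitivity (- (Ci * Ci) * u2 z)%C. ring. rewrite Ci_Ci. ring.
- intros z Hz. unfold r1, r2. destruct (Lo _ (upper_reflect z Hz)) as [-> ->].
  destruct (R z (upper_cut z Hz)) as [-> ->]. split.
  transitivity (- (Ci * Ci) * u1 z + 2 * (Ci * Ci) * u2 z)%C. ring. rewrite Ci_Ci. ring.
  transitivity (- (Ci * Ci) * u2 z)%C. ring. rewrite Ci_Ci. ring.
Qed.

(** * Generators of Gamma(2) *)

Record mat2 : Type := Mat { m11 : Z; m12 : Z; m21 : Z; m22 : Z }.

Definition mmul (M N : mat2) : mat2 :=
  Mat (m11 M * m11 N + m12 M * m21 N) (m11 M * m12 N + m12 M * m22 N)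
      (m21 M * m11 N + m22 M * m21 N) (m21 M * m12 N + m22 M * m22 N).

Definition mone : mat2 := Mat 1 0 0 1.
Definition mopp (M : mat2) : mat2 := Mat (- m11 M) (- m12 M) (- m21 M) (- m22 M).
Definition madj (M : mat2) : mat2 := Mat (m22 M) (- m12 M) (- m21 M) (m11 M).
Definition in_Gamma2 (M : mat2) : Prop := Gamma2 (m11 M) (m12 M) (m21 M) (m22 M).

Definition genA (k : Z) : mat2 := Mat 1 (2 * k) 0 1.
Definition genB (k : Z) : mat2 := Mat 1 0 (2 * k) 1.

Lemma mat2_eq M N : m11 M = m11 N -> m12 M = m12 N -> m21 M = m21 N -> m22 M = m22 N -> M = N.
Proof. destruct M, N; simpl; congruence. Qed.

Lemma in_Gamma2_mmul M N : in_Gamma2 M -> in_Gamma2 N -> in_Gamma2 (mmul M N).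
Proof.
destruct M as [a b c d], N as [a' b' c' d']. unfold in_Gamma2, Gamma2; simpl.
intros [D [[x X] [[y Y] [[z Z0] [t T]]]]] [D' [[x' X'] [[y' Y'] [[z' Z0'] [t' T']]]]].
assert (a = 2 * x + 1)%Z by lia. assert (d = 2 * t + 1)%Z by lia. assert (a' = 2 * x' + 1)%Z by lia. assert (d' = 2 * t' + 1)%Z by lia.
split; [|split; [|split; [|split]]].
- transitivity ((a * d - b * c) * (a' * d' - b' * c'))%Z. ring. rewrite D, D'. ring.
- exists (2 * x * x' + x + x' + 2 * y * z')%Z. subst. ring.
- exists ((2 * x + 1) * y' + y * (2 * t' + 1))%Z. subst. ring.
- exists (z * (2 * x' + 1) + (2 * t + 1) * z')%Z. subst. ring.
- exists (2 * z * y' + 2 * t * t' + t + t')%Z. subst. ring.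
Qed.

Lemma in_Gamma2_madj M : in_Gamma2 M -> in_Gamma2 (madj M).
Proof.
destruct M as [a b c d]. unfold in_Gamma2, Gamma2; simpl. intros [D [A [[y Y] [[z Z0] T]]]].
split; [lia | split; [auto | split; [exists (- y)%Z; lia | split; [exists (- z)%Z; lia | auto]]]].
Qed.

Lemma in_Gamma2_genA k : in_Gamma2 (genA k).
Proof. unfold in_Gamma2, Gamma2, genA, genB; cbn [m11 m12 m21 m22]. split; [lia|]. split; [exists 0%Z|split; [exists k|split; exists 0%Z]]; lia. Qed.

Lemma in_Gamma2_genB k : in_Gamma2 (genB k).
Proof. unfold in_Gamma2, Gamma2, genA, genB; cbn [m11 m12 m21 m22]. split; [lia|]. split; [exists 0%Z|split; [exists 0%Z|split; [exists k|exists 0%Z]]]; lia. Qed.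

Lemma in_Gamma2_mone : in_Gamma2 mone.
Proof. exact (in_Gamma2_genA 0). Qed.

Lemma mmul_gen_cancel M G H : mmul G H = mone -> M = mmul (mmul M G) H.
Proof.
destruct M as [a b c d], G as [e f g h], H as [e' f' g' h']. unfold mmul, mone; simpl. intros E. injection E. intros E4 E3 E2 E1.
apply mat2_eq; simpl.
- transitivity (a * (e * e' + f * g') + b * (g * e' + h * g'))%Z; [rewrite E1, E3|]; ring.
- transitivity (a * (e * f' + f * h') + b * (g * f' + h * h'))%Z; [rewrite E2, E4|]; ring.
- transitivity (c * (e * e' + f * g') + d * (g * e' + h * g'))%Z; [rewrite E1, E3|]; ring.
- transitivity (c * (e * f' + f * h') + d * (g * f' + h * h'))%Z; [rewrite E2, E4|]; ring.
Qed.

Lemma genA_cancel k : mmul (genA k) (genA (- k)) = mone.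
Proof. apply mat2_eq; unfold mmul, genA, genB, mone; cbn [m11 m12 m21 m22]; ring. Qed.

Lemma genB_cancel k : mmul (genB k) (genB (- k)) = mone.
Proof. apply mat2_eq; unfold mmul, genA, genB, mone; cbn [m11 m12 m21 m22]; ring. Qed.

(* Euclid's algorithm with even quotients on the first row [(odd, even)]: the
   two entries never have equal modulus, so one step always decreases the sum. *)
Lemma Gamma2_generated (P : mat2 -> Prop) : P mone -> P (mopp mone) ->
  (forall M, P M -> P (mmul M (genA 1))) -> (forall M, P M -> P (mmul M (genA (-1)))) ->
  (forall M, P M -> P (mmul M (genB 1))) -> (forall M, P M -> P (mmul M (genB (-1)))) ->
  forall M, in_Gamma2 M -> P M.
Proof.
intros P1 Pm A1 A2 B1 B2.
(* A first row (e, 0) with e = 1 or - 1 forces the second row to be (2k, e); powers of [genB] reach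
   it from e times the identity. *)
assert (Base : forall e k, P (Mat e 0 0 e) -> (e = 1 \/ e = -1)%Z -> P (Mat e 0 (2 * k) e)).
{ intros e k Pe He. revert k. apply Z.bi_induction.
  - intros ? ? ->. reflexivity.
  - exact Pe.
  - intros k. split; intros H.
    + destruct He as [-> | ->].
      * replace (Mat 1 0 (2 * Z.succ k) 1) with (mmul (Mat 1 0 (2 * k) 1) (genB 1)) by (apply mat2_eq; unfold mmul, genB; cbn [m11 m12 m21 m22]; lia). auto.
      * replace (Mat (-1) 0 (2 * Z.succ k) (-1)) with (mmul (Mat (-1) 0 (2 * k) (-1)) (genB (-1))) by (apply mat2_eq; unfold mmul, genB; cbn [m11 m12 m21 m22]; lia). auto.
    + destruct He as [-> | ->].
      * replace (Mat 1 0 (2 * k) 1) with (mmul (Mat 1 0 (2 * Z.succ k) 1) (genB (-1))) by (apply mat2_eq; unfold mmul, genB; cbn [m11 m12 m21 m22]; lia). auto.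
      * replace (Mat (-1) 0 (2 * k) (-1)) with (mmul (Mat (-1) 0 (2 * Z.succ k) (-1)) (genB 1)) by (apply mat2_eq; unfold mmul, genB; cbn [m11 m12 m21 m22]; lia). auto. }
assert (Ind : forall n M, in_Gamma2 M -> (Z.abs (m11 M) + Z.abs (m12 M) <= Z.of_nat n)%Z -> P M).
{ induction n as [|n IH]; intros M G L.
  - exfalso. destruct G as [D [[x X] _]]. lia.
  - assert (G' := G). destruct M as [a b c d]. unfold in_Gamma2, Gamma2 in G'; simpl in G', L.
    destruct G' as [D [[x X] [[y Y] [[z Z0] _]]]].
    destruct (Z.eq_dec b 0) as [Hb|Hb].
    + subst b. rewrite Hb in D. assert (a * d = 1)%Z by lia.
      assert (E : (a = 1 /\ d = 1 \/ a = -1 /\ d = -1)%Z).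
      { destruct (Z.eq_mul_1 a d H) as [Ha|Ha]; subst a; [left | right]; lia. }
      rewrite Hb, Z0, Z.mul_comm. destruct E as [[-> ->] | [-> ->]]; apply Base; auto.
    + assert (St : forall G H, mmul G H = mone -> in_Gamma2 G -> (forall M, P M -> P (mmul M H)) ->
         (Z.abs (m11 (mmul (Mat a b c d) G)) + Z.abs (m12 (mmul (Mat a b c d) G)) <= Z.of_nat n)%Z -> P (Mat a b c d)).
      { intros G0 H0 E0 I0 C0 L0. rewrite (mmul_gen_cancel (Mat a b c d) G0 H0 E0). apply C0, IH; auto. now apply in_Gamma2_mmul. }
      (* The entry of larger modulus changes by twice the smaller one, with the sign that makes them
         compensate; its modulus drops because the smaller entry is non-zero. *)
      destruct (Z_lt_le_dec (Z.abs b) (Z.abs a)) as [L1|L1].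
      * destruct (Z_lt_le_dec (a * b) 0) as [L2|L2].
        -- apply (St (genB 1) (genB (-1)) (genB_cancel 1)); [apply in_Gamma2_genB | auto | simpl; nia].
        -- apply (St (genB (-1)) (genB 1) (genB_cancel (-1))); [apply in_Gamma2_genB | auto | simpl; nia].
      * assert (a <> 0)%Z by lia. assert (Z.abs a <> Z.abs b)%Z by lia.
        destruct (Z_lt_le_dec (a * b) 0) as [L2|L2].
        -- apply (St (genA 1) (genA (-1)) (genA_cancel 1)); [apply in_Gamma2_genA | auto | simpl; nia].
        -- apply (St (genA (-1)) (genA 1) (genA_cancel (-1))); [apply in_Gamma2_genA | auto | simpl; nia]. }
intros M G. apply (Ind (Z.to_nat (Z.abs (m11 M) + Z.abs (m12 M))) M G). lia.
Qed.

(** * Monodromy along arbitrary loops *)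

(* The row [(p, q)] stands for [p u1 + q u2], so matrices act on the right. *)
Definition row : Type := (C * C)%type.

Definition rmul (s : row) (M : mat2) : row :=
  (fst s * RtoC (IZR (m11 M)) + snd s * RtoC (IZR (m21 M)), fst s * RtoC (IZR (m12 M)) + snd s * RtoC (IZR (m22 M)))%C.

Definition comb (s : row) (u1 u2 : C -> C) (x : C) : C := (fst s * u1 x + snd s * u2 x)%C.

Definition row_nz (s : row) : Prop := ~ (fst s = 0 /\ snd s = 0).

Lemma rmul_mmul s M N : rmul (rmul s M) N = rmul s (mmul M N).
Proof.
destruct M as [a b c d], N as [e f g h]; unfold rmul, mmul; cbn [fst snd m11 m12 m21 m22].
rewrite !plus_IZR, !mult_IZR, !RtoC_plus, !RtoC_mult. f_equal; ring.
Qed.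

Lemma rmul_mone s : rmul s mone = s.
Proof. unfold rmul, mone; cbn [m11 m12 m21 m22]. destruct s; cbn [fst snd]. f_equal; ring. Qed.

Lemma mmul_madj M : in_Gamma2 M -> mmul M (madj M) = mone /\ mmul (madj M) M = mone.
Proof.
destruct M as [a b c d]. unfold in_Gamma2, Gamma2; simpl. intros [D _].
split; apply mat2_eq; unfold mmul, madj, mone; cbn [m11 m12 m21 m22]; try ring; rewrite <- D; ring.
Qed.

Lemma mmul_assoc A B D : mmul (mmul A B) D = mmul A (mmul B D).
Proof. destruct A as [a b c d], B as [e f g h], D as [i j k l]; apply mat2_eq; unfold mmul; cbn [m11 m12 m21 m22]; ring. Qed.

Lemma mmul_mone_r M : mmul M mone = M.
Proof. destruct M as [a b c d]; apply mat2_eq; unfold mmul, mone; cbn [m11 m12 m21 m22]; ring. Qed.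

Lemma rmul_nz s M : in_Gamma2 M -> row_nz s -> row_nz (rmul s M).
Proof.
intros G N [E1 E2]. apply N.
assert (E : rmul (rmul s M) (madj M) = s) by (rewrite rmul_mmul, (proj1 (mmul_madj M G)); apply rmul_mone).
rewrite <- E. set (r := rmul s M) in *. unfold rmul; cbn [fst snd]. rewrite E1, E2. split; ring.
Qed.

Lemma comb_sol U s u1 u2 : sol_on U u1 -> sol_on U u2 -> sol_on U (comb s u1 u2).
Proof. intros. now apply sol_on_lin. Qed.

(** If the combination vanished near z, its value and derivative at z would give two linear
    equations for the row, with the Wronskian as determinant. *)
Lemma comb_nz U s u1 u2 z : fundamental U u1 u2 -> U z -> row_nz s -> ~ locally z (fun y => comb s u1 u2 y = 0).
Proof.
intros [S1 [S2 W]] Hz N L. apply N.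
assert (V0 := locally_singleton _ _ L). assert (V1 := locally_singleton _ _ (locally_zero_derive _ _ L)).
unfold comb in V0, V1. rewrite C_derive_lin in V1 by (try apply S1; try apply S2; auto).
specialize (W z Hz). set (p := fst s) in *. set (q := snd s) in *.
assert (P : (p * wron u1 u2 z)%C = 0).
{ unfold wron. transitivity (C_derive u2 z * (p * u1 z + q * u2 z) - u2 z * (p * C_derive u1 z + q * C_derive u2 z))%C. ring. rewrite V0, V1. ring. }
assert (Q : (q * wron u1 u2 z)%C = 0).
{ unfold wron. transitivity (u1 z * (p * C_derive u1 z + q * C_derive u2 z) - C_derive u1 z * (p * u1 z + q * u2 z))%C. ring. rewrite V0, V1. ring. }
split; apply NNPP; intros K; [revert P | revert Q]; now apply Cmult_neq_0.
Qed.

Lemma chazy_comb_meromorphic U s u1 u2 z : (forall z, U z -> locally z U) -> fundamental U u1 u2 -> U z -> row_nz s ->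
  meromorphic_at (chazy_formula (comb s u1 u2)) z.
Proof.
intros Uo F Hz N. apply (chazy_formula_meromorphic U); auto. apply comb_sol; apply F. now apply (comb_nz U).
Qed.

Inductive chart : Type := Cut | Neg | Right.

Definition chart_dom (i : chart) : C -> Prop :=
  match i with Cut => cut_plane | Neg => neg_plane | Right => right_plane end.

(* Expression of the basis of a chart in the basis of [Cut], on each half plane. *)
Definition chart_upper (i : chart) : mat2 := match i with Right => genA (-1) | _ => mone end.
Definition chart_lower (i : chart) : mat2 := match i with Neg => genB 1 | _ => mone end.

Definition chart_system (b1 b2 : chart -> C -> C) : Prop :=
  (forall i, fundamental (chart_dom i) (b1 i) (b2 i)) /\
  (forall i s z, upper z -> comb s (b1 i) (b2 i) z = comb (rmul s (chart_upper i)) (b1 Cut) (b2 Cut) z) /\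
  (forall i s z, lower z -> comb s (b1 i) (b2 i) z = comb (rmul s (chart_lower i)) (b1 Cut) (b2 Cut) z).

Lemma chart_dom_open i z : chart_dom i z -> locally z (chart_dom i).
Proof. destruct i; [apply cut_plane_open | apply neg_plane_open | apply right_plane_open]. Qed.

Lemma chart_cover (z : C) : z <> 0 -> z <> 1 -> exists i, chart_dom i z.
Proof.
intros N0 N1. destruct (Req_dec_T (Im z) 0) as [E|E]; [|exists Cut; now left].
assert (Ez : z = RtoC (Re z)) by (apply injective_projections; [reflexivity | exact E]).
destruct (Rtotal_order (Re z) 0) as [L|[L|L]].
- exists Neg. now right.
- rewrite Ez, L in N0. easy.
- destruct (Rtotal_order (Re z) 1) as [L1|[L1|L1]].
  + exists Cut. right. lra.
  + rewrite Ez, L1 in N1. easy.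
  + exists Right. now right.
Qed.

Lemma chart_system_exists w1 w2 : solution_basis w1 w2 -> exists b1 b2, chart_system b1 b2 /\
  forall z, half_disc_cut z -> b1 Cut z = om1 z /\ b2 Cut z = om2 Clog z.
Proof.
intros B. destruct (principal_basis w1 w2 B) as [u1 [u2 [F Ex]]].
destruct (basis_across_negative_axis u1 u2 F Ex) as [v1 [v2 [Fv [Vu Vl]]]].
destruct (basis_across_right_axis u1 u2 v1 v2 (reflection u1 u2 F Ex) Fv Vu Vl) as [t1 [t2 [Ft [Tl Tu]]]].
exists (fun i => match i with Cut => u1 | Neg => v1 | Right => t1 end), (fun i => match i with Cut => u2 | Neg => v2 | Right => t2 end).
split; auto. split; [|split].
- intros [| |]; auto.
- intros [| |] s z Hz; cbn [chart_upper]; rewrite ?rmul_mone; auto; unfold comb.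
  + now destruct (Vu z Hz) as [-> ->].
  + destruct (Tu z Hz) as [-> ->]. unfold rmul, genA; cbn [fst snd m11 m12 m21 m22]. rewrite mult_IZR, RtoC_mult. 
    replace (RtoC (IZR (-1))) with (- (1))%C by (rewrite <- RtoC_opp; reflexivity). ring.
- intros [| |] s z Hz; cbn [chart_lower]; rewrite ?rmul_mone; auto; unfold comb.
  + destruct (Vl z Hz) as [-> ->]. unfold rmul, genB; cbn [fst snd m11 m12 m21 m22]. rewrite mult_IZR, RtoC_mult. ring.
  + now destruct (Tl z Hz) as [-> ->].
Qed.

Lemma chart_overlap i i' z : chart_dom i z -> chart_dom i' z -> i = i' \/ upper z \/ lower z.
Proof.
intros H H'. destruct (Rtotal_order (Im z) 0) as [L|[L|L]]; [right; right; exact L | | right; left; exact L].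
left. destruct i, i'; auto; simpl in H, H'; unfold cut_plane, neg_plane, right_plane in *; exfalso; lra.
Qed.

Lemma chart_matrices_Gamma2 i : in_Gamma2 (chart_upper i) /\ in_Gamma2 (chart_lower i).
Proof. destruct i; split; simpl; auto using in_Gamma2_mone, in_Gamma2_genA, in_Gamma2_genB. Qed.

(** N' is N times the matrix of the first chart times the inverse of that of the second, on the half
    plane containing z. It does not depend on the row, so two functions continued together keep a
    common matrix. *)
Lemma chart_transition b1 b2 : chart_system b1 b2 -> forall i i' N z, in_Gamma2 N -> chart_dom i z -> chart_dom i' z ->
  exists N', in_Gamma2 N' /\ forall r, locally z (fun y => comb (rmul r N) (b1 i) (b2 i) y = comb (rmul r N') (b1 i') (b2 i') y).
Proof.
intros [F [Hu Hl]] i i' N z G Hi Hi'.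
destruct (chart_overlap i i' z Hi Hi') as [->|[Hz|Hz]].
- exists N. split; auto. intros r. now apply locally_all.
- destruct (chart_matrices_Gamma2 i) as [G1 _]. destruct (chart_matrices_Gamma2 i') as [G2 _].
  exists (mmul (mmul N (chart_upper i)) (madj (chart_upper i'))). split; [now repeat apply in_Gamma2_mmul; auto; apply in_Gamma2_madj|].
  intros r. generalize (upper_open z Hz). apply locally_imp. intros y Hy. rewrite (Hu i), (Hu i') by auto.
  rewrite !rmul_mmul, mmul_assoc, (proj2 (mmul_madj _ G2)), mmul_mone_r. reflexivity.
- destruct (chart_matrices_Gamma2 i) as [_ G1]. destruct (chart_matrices_Gamma2 i') as [_ G2].
  exists (mmul (mmul N (chart_lower i)) (madj (chart_lower i'))). split; [now repeat apply in_Gamma2_mmul; auto; apply in_Gamma2_madj|].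
  intros r. generalize (lower_open z Hz). apply locally_imp. intros y Hy. rewrite (Hl i), (Hl i') by auto.
  rewrite !rmul_mmul, mmul_assoc, (proj2 (mmul_madj _ G2)), mmul_mone_r. reflexivity.
Qed.

(* [T] turns a solution into the function that is continued: the identity for
   the basis itself, [chazy_formula] for the Chazy solutions. *)
Lemma monodromy_in_Gamma2 b1 b2 (T : (C -> C) -> C -> C) (r : bool -> row) x0 gamma f N :
  chart_system b1 b2 ->
  (forall i M k z, in_Gamma2 M -> chart_dom i z -> meromorphic_at (T (comb (rmul (r k) M) (b1 i) (b2 i))) z) ->
  (forall u v z, analytic_at u z -> locally z (fun y => u y = v y) -> germ_eq z (T u) (T v)) ->
  loop x0 gamma -> (forall k, continuation gamma (f k)) -> in_Gamma2 N -> cut_plane x0 ->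
  (forall k, germ_eq x0 (f k 0) (T (comb (rmul (r k) N) (b1 Cut) (b2 Cut)))) ->
  exists N', in_Gamma2 N' /\ forall k, germ_eq x0 (f k 1) (T (comb (rmul (r k) N') (b1 Cut) (b2 Cut))).
Proof.
intros CS Mer Ext [Lc [Ln [L0 L1]]] Cont G Hx Init.
assert (Tr := chart_transition b1 b2 CS).
assert (An : forall i s z, chart_dom i z -> analytic_at (comb s (b1 i) (b2 i)) z).
{ intros i s z Hz. destruct CS as [F _]. destruct (F i) as [S1 [S2 _]]. now apply (comb_sol (chart_dom i)). }
assert (TrG : forall i i' M z, in_Gamma2 M -> chart_dom i z -> chart_dom i' z -> exists M', in_Gamma2 M' /\
   forall k, germ_eq z (T (comb (rmul (r k) M) (b1 i) (b2 i))) (T (comb (rmul (r k) M') (b1 i') (b2 i')))).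
{ intros i i' M z GM Hi Hi'. destruct (Tr i i' M z GM Hi Hi') as [M' [GM' E]]. exists M'. split; auto. }
destruct (chart_propagation chart {M | in_Gamma2 M} chart_dom (fun i j k => T (comb (rmul (r k) (proj1_sig j)) (b1 i) (b2 i))) gamma f) with (t := 1) as [i [j [Ui E]]]; auto.
- apply chart_dom_open.
- intros i [M GM] k z Hz. now apply Mer.
- intros i i' [M GM] z Hi Hi'. destruct (TrG i i' M z GM Hi Hi') as [M' [GM' EM]]. now exists (exist _ M' GM').
- intros t Ht. destruct (Ln t Ht). now apply chart_cover.
- exists Cut, (exist _ N G). rewrite L0. split; auto.
- unfold unit_itv; lra.
- rewrite L1 in Ui, E. destruct j as [M GM]. simpl in E.
  destruct (TrG i Cut M x0 GM Ui Hx) as [M' [GM' EM]]. exists M'. split; auto.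
  intros k. apply germ_eq_trans with (2 := EM k). apply E.
Qed.

Lemma omega_om x : cut_plane x -> Cmod x < 1 -> germ_eq x omega1_0 om1 /\ germ_eq x omega2_0 (om2 Clog).
Proof.
intros Hx Hd. assert (L := unit_disc_open x Hd). split; apply germ_eq_locally; revert L; apply locally_imp; intros y Hy.
- unfold omega1_0, om1. now rewrite hyperF_Fhyp.
- unfold omega2_0, om2. now rewrite hyperg_Fhyp_Hhyp.
Qed.

Definition unit_row (k : bool) : row := if k then (RtoC 1, RtoC 0) else (RtoC 0, RtoC 1).

(** Both functions are continued along one loop, so a single matrix M serves for both. Equality of
    germs at x0 becomes equality on the cut plane because both sides are analytic there. *)
Lemma standard_branch_Gamma2 w1 w2 b1 b2 : solution_basis w1 w2 -> standard_branch w1 w2 -> chart_system b1 b2 ->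
  (forall z, half_disc_cut z -> b1 Cut z = om1 z /\ b2 Cut z = om2 Clog z) ->
  exists M, in_Gamma2 M /\ forall z, cut_plane z ->
    w1 z = comb (rmul (unit_row true) M) (b1 Cut) (b2 Cut) z /\ w2 z = comb (rmul (unit_row false) M) (b1 Cut) (b2 Cut) z.
Proof.
intros B [x0 [gamma [f1 [f2 [Hx [Hd [L [C1 [C2 [I1 [I2 [E1 E2]]]]]]]]]]]] CS Ex.
assert (An : forall i s z, chart_dom i z -> analytic_at (comb s (b1 i) (b2 i)) z).
{ intros i s z Hz. destruct CS as [F _]. destruct (F i) as [S1 [S2 _]]. now apply (comb_sol (chart_dom i)). }
destruct (omega_om x0 Hx Hd) as [O1 O2].
assert (Hh := half_disc_cut_open x0 (conj Hx Hd)).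
destruct (monodromy_in_Gamma2 b1 b2 (fun u => u) unit_row x0 gamma (fun k => if k then f1 else f2) mone) as [M [GM E]]; auto.
- intros i M k z GM Hz. now apply meromorphic_analytic, An.
- intros u v z _. apply germ_eq_locally.
- intros [|]; auto.
- apply in_Gamma2_mone.
- intros [|]; rewrite rmul_mone.
  + apply germ_eq_trans with omega1_0; auto. apply germ_eq_trans with om1; auto.
    apply germ_eq_locally. revert Hh. apply locally_imp. intros y Hy. unfold comb; simpl. destruct (Ex y Hy) as [-> ->]. ring.
  + apply germ_eq_trans with omega2_0; auto. apply germ_eq_trans with (om2 Clog); auto.
    apply germ_eq_locally. revert Hh. apply locally_imp. intros y Hy. unfold comb; simpl. destruct (Ex y Hy) as [-> ->]. ring.
- exists M. split; auto. intros z Hz. split.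
  + apply (analytic_identity cut_plane (RtoC (1 / 2)) x0 w1 _ cut_plane_star Hx); auto.
    intros y Hy. split. now apply (basis_analytic1 _ _ B). now apply An.
    apply analytic_germ_locally. now apply (basis_analytic1 _ _ B). now apply An.
    apply germ_eq_trans with (f1 1). now apply germ_eq_sym. apply (E true).
  + apply (analytic_identity cut_plane (RtoC (1 / 2)) x0 w2 _ cut_plane_star Hx); auto.
    intros y Hy. split. now apply (basis_analytic2 _ _ B). now apply An.
    apply analytic_germ_locally. now apply (basis_analytic2 _ _ B). now apply An.
    apply germ_eq_trans with (f2 1). now apply germ_eq_sym. apply (E false).
Qed.

(** * Realisation of the generators by loops *)

Lemma path_continuous_eps gamma : (forall t, unit_itv t -> forall e, 0 < e -> exists d, 0 < d /\
   forall s, unit_itv s -> Rabs (s - t) < d -> Cmod (gamma s - gamma t) < e) -> path_continuous gamma.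
Proof.
intros H t Ht P HP. apply locally_Cmod in HP. destruct HP as [r [Hr HP]].
destruct (H t Ht r Hr) as [d [Hd K]]. exists (mkposreal d Hd). intros s Hs Us. apply HP, K; auto.
Qed.

Lemma path_eps gamma t e : path_continuous gamma -> unit_itv t -> 0 < e -> exists d, 0 < d /\
   forall s, unit_itv s -> Rabs (s - t) < d -> Cmod (gamma s - gamma t) < e.
Proof. intros H Ht He. exact (path_near gamma t _ H Ht (locally_Cball (gamma t) e He)). Qed.

Lemma continuation_eps gamma f : (forall t, unit_itv t -> meromorphic_at (f t) (gamma t) /\ exists d, 0 < d /\
   forall s, unit_itv s -> Rabs (s - t) < d -> germ_eq (gamma s) (f s) (f t)) -> continuation gamma f.
Proof.
intros H t Ht. destruct (H t Ht) as [M [d [Hd K]]]. split; auto.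
exists (mkposreal d Hd). intros s Hs Us. apply K; auto.
Qed.

Lemma continuation_near gamma f t : continuation gamma f -> unit_itv t -> exists d, 0 < d /\
   forall s, unit_itv s -> Rabs (s - t) < d -> germ_eq (gamma s) (f s) (f t).
Proof.
intros H Ht. destruct (H t Ht) as [_ [d K]]. exists d. split. apply cond_pos. intros s Us Hs. now apply K.
Qed.

(** An equivalence between meromorphic germs at a fixed base point; this reduces the realisation of
    Gamma(2) to its generators, with inverses supplied by reversed loops. *)
Definition branch_rel (x : C) (E1 E2 : C -> C) : Prop :=
  exists gamma f, loop x gamma /\ continuation gamma f /\ germ_eq x (f 0) E1 /\ germ_eq x (f 1) E2.

Lemma branch_rel_refl (x : C) E E' : x <> 0 -> x <> 1 -> meromorphic_at E x -> germ_eq x E E' -> branch_rel x E E'.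
Proof.
intros N0 N1 M H. exists (fun _ => x), (fun _ => E). split; [|split; [|split]]; auto using germ_eq_refl.
- split; [|split; [|split]]; auto. apply path_continuous_eps. intros t _ e He. exists 1. split. lra.
  intros s _ _. now rewrite Cmod_sub_0.
- apply continuation_eps. intros t _. split; auto. exists 1. split. lra. intros; apply germ_eq_refl.
Qed.

Lemma branch_rel_sym x E1 E2 : branch_rel x E1 E2 -> branch_rel x E2 E1.
Proof.
intros [g [f [[Lc [Ln [L0 L1]]] [Ct [I1 I2]]]]].
assert (U : forall t, unit_itv t -> unit_itv (1 - t)) by (unfold unit_itv; intros; lra).
assert (D : forall s t, Rabs (1 - s - (1 - t)) = Rabs (s - t)).
{ intros. rewrite <- Rabs_Ropp. f_equal. ring. }
exists (fun t => g (1 - t)), (fun t => f (1 - t)). split; [|split; [|split]].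
- split; [|split; [|split]].
  + apply path_continuous_eps. intros t Ht e He. destruct (path_eps g (1 - t) e Lc (U t Ht) He) as [d [Hd K]].
    exists d. split; auto. intros s Us Hs. apply K; auto. now rewrite D.
  + intros t Ht. apply Ln; auto.
  + now rewrite Rminus_0_r.
  + now rewrite Rminus_diag.
- apply continuation_eps. intros t Ht. split. apply Ct; auto.
  destruct (continuation_near g f (1 - t) Ct (U t Ht)) as [d [Hd K]].
  exists d. split; auto. intros s Us Hs. apply K; auto. now rewrite D.
- now rewrite Rminus_0_r.
- now rewrite Rminus_diag.
Qed.

(** Concatenation of loops. At the junction the two continuations agree as germs but not as
    functions, since each represents the germ of E2 by a function of its own. *)
Lemma branch_rel_trans x E1 E2 E3 : branch_rel x E1 E2 -> branch_rel x E2 E3 -> branch_rel x E1 E3.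
Proof.
intros [g [f [[Lc [Ln [L0 L1]]] [Ct [I1 I2]]]]] [g' [f' [[Lc' [Ln' [L0' L1']]] [Ct' [I1' I2']]]]].
set (G := fun t => if Rle_dec t (1 / 2) then g (2 * t) else g' (2 * t - 1)).
set (F := fun t => if Rle_dec t (1 / 2) then f (2 * t) else f' (2 * t - 1)).
assert (GL : forall t, t <= 1 / 2 -> G t = g (2 * t) /\ F t = f (2 * t)).
{ intros t Ht. unfold G, F. destruct (Rle_dec t (1 / 2)); auto. lra. }
assert (GR : forall t, 1 / 2 < t -> G t = g' (2 * t - 1) /\ F t = f' (2 * t - 1)).
{ intros t Ht. unfold G, F. destruct (Rle_dec t (1 / 2)); auto. lra. }
assert (UL : forall t, unit_itv t -> t <= 1 / 2 -> unit_itv (2 * t)) by (unfold unit_itv; intros; lra).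
assert (UR : forall t, unit_itv t -> 1 / 2 <= t -> unit_itv (2 * t - 1)) by (unfold unit_itv; intros; lra).
assert (Habs : forall s t c, Rabs (2 * s - c - (2 * t - c)) = 2 * Rabs (s - t)).
{ intros. replace (2 * s - c - (2 * t - c)) with (2 * (s - t)) by ring. rewrite Rabs_mult, (Rabs_pos_eq 2); lra. }
assert (Habs0 : forall s t, Rabs (2 * s - 2 * t) = 2 * Rabs (s - t)).
{ intros. replace (2 * s - 2 * t) with (2 * (s - t)) by ring. rewrite Rabs_mult, (Rabs_pos_eq 2); lra. }
assert (Ghalf : G (1 / 2) = x /\ F (1 / 2) = f 1).
{ destruct (GL (1 / 2)) as [-> ->]. lra. replace (2 * (1 / 2)) with 1 by field. auto. }
assert (E21 : germ_eq x (f' 0) (f 1)).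
{ apply germ_eq_trans with E2; auto. now apply germ_eq_sym. }
(* Local statements may be checked on each half separately; only at t = 1/2 are two one-sided
   neighbourhoods combined. *)
assert (Side : forall t (Q : R -> Prop), unit_itv t ->
  (t <= 1 / 2 -> exists d, 0 < d /\ forall s, unit_itv s -> s <= 1 / 2 -> Rabs (s - t) < d -> Q s) ->
  (1 / 2 <= t -> exists d, 0 < d /\ forall s, unit_itv s -> 1 / 2 < s -> Rabs (s - t) < d -> Q s) ->
  exists d, 0 < d /\ forall s, unit_itv s -> Rabs (s - t) < d -> Q s).
{ intros t Q Ht HL HR. destruct (Rtotal_order t (1 / 2)) as [L|[L|L]].
  - destruct (HL ltac:(lra)) as [d [Hd K]]. exists (Rmin d (1 / 2 - t)). split. apply Rmin_pos; lra.
    intros s Us Hs. assert (A := Rmin_l d (1 / 2 - t)). assert (B := Rmin_r d (1 / 2 - t)).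
    apply K; auto; [|lra]. assert (X : Rabs (s - t) < 1 / 2 - t) by lra. apply Rabs_def2 in X. lra.
  - destruct (HL ltac:(lra)) as [d [Hd K]]. destruct (HR ltac:(lra)) as [d' [Hd' K']].
    exists (Rmin d d'). split. apply Rmin_pos; lra.
    intros s Us Hs. assert (A := Rmin_l d d'). assert (B := Rmin_r d d').
    destruct (Rle_lt_dec s (1 / 2)); [apply K | apply K']; auto; lra.
  - destruct (HR ltac:(lra)) as [d [Hd K]]. exists (Rmin d (t - 1 / 2)). split. apply Rmin_pos; lra.
    intros s Us Hs. assert (A := Rmin_l d (t - 1 / 2)). assert (B := Rmin_r d (t - 1 / 2)).
    apply K; auto; [|lra]. assert (X : Rabs (s - t) < t - 1 / 2) by lra. apply Rabs_def2 in X. lra. }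
exists G, F. split; [|split; [|split]].
- split; [|split; [|split]].
  + apply path_continuous_eps. intros t Ht e He. apply Side; auto; intros Hh.
    * destruct (path_eps g (2 * t) e Lc (UL t Ht Hh) He) as [d [Hd K]]. exists (d / 2). split. lra.
      intros s Us Hs Hd'. rewrite (proj1 (GL s Hs)), (proj1 (GL t Hh)). apply K; auto. rewrite Habs0. lra.
    * destruct (path_eps g' (2 * t - 1) e Lc' (UR t Ht Hh) He) as [d [Hd K]]. exists (d / 2). split. lra.
      intros s Us Hs Hd'. rewrite (proj1 (GR s Hs)).
      assert (Gt : G t = g' (2 * t - 1)).
      { destruct (Req_dec_T t (1 / 2)) as [->|N]. rewrite (proj1 Ghalf). replace (2 * (1 / 2) - 1) with 0 by field. auto. apply GR. lra. }
      rewrite Gt. apply K. apply UR; auto. lra. rewrite Habs. lra.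
  + intros t Ht. destruct (Rle_lt_dec t (1 / 2)) as [Hh|Hh].
    rewrite (proj1 (GL t Hh)). apply Ln; auto. rewrite (proj1 (GR t Hh)). apply Ln', UR; auto. lra.
  + rewrite (proj1 (GL 0 ltac:(lra))), Rmult_0_r. exact L0.
  + rewrite (proj1 (GR 1 ltac:(lra))). replace (2 * 1 - 1) with 1 by ring. exact L1'.
- apply continuation_eps. intros t Ht. split.
  { destruct (Rle_lt_dec t (1 / 2)) as [Hh|Hh].
    destruct (GL t Hh) as [-> ->]. apply Ct; auto. destruct (GR t Hh) as [-> ->]. apply Ct', UR; auto. lra. }
  apply Side; auto; intros Hh.
  * destruct (continuation_near g f (2 * t) Ct (UL t Ht Hh)) as [d [Hd K]]. exists (d / 2). split. lra.
    intros s Us Hs Hd'. destruct (GL s Hs) as [-> ->]. rewrite (proj2 (GL t Hh)). apply K; auto. rewrite Habs0. lra.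
  * assert (Ut := UR t Ht Hh). destruct (continuation_near g' f' (2 * t - 1) Ct' Ut) as [d [Hd K]].
    destruct (Req_dec_T t (1 / 2)) as [Et|N].
    (* Just after the junction the germ is compared with [f 1], the representative chosen at t =
       1/2, through [f' 0]; their equality at x extends to nearby points. *)
    -- assert (Z : 2 * t - 1 = 0) by (rewrite Et; field). rewrite Z in K, Ut.
       assert (O := germ_eq_open _ _ _ E21). rewrite <- L0' in O.
       destruct (path_near g' 0 _ Lc' Ut O) as [d' [Hd' K']].
       exists (Rmin (d / 2) (d' / 2)). split. apply Rmin_pos; lra.
       intros s Us Hs Hds. assert (A := Rmin_l (d / 2) (d' / 2)). assert (B := Rmin_r (d / 2) (d' / 2)).
       destruct (GR s Hs) as [-> ->]. rewrite Et, (proj2 Ghalf).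
       assert (X : Rabs (2 * s - 1 - 0) = 2 * Rabs (s - t)) by (rewrite <- (Habs s t 1), Z; reflexivity).
       apply germ_eq_trans with (f' 0). apply K. apply UR; auto; lra. rewrite X. lra.
       apply K'. apply UR; auto; lra. rewrite X. lra.
    -- exists (d / 2). split. lra. intros s Us Hs Hd'. destruct (GR s Hs) as [-> ->].
       rewrite (proj2 (GR t ltac:(lra))). apply K. apply UR; auto; lra. rewrite Habs. lra.
- rewrite (proj2 (GL 0 ltac:(lra))), Rmult_0_r. exact I1.
- rewrite (proj2 (GR 1 ltac:(lra))). replace (2 * 1 - 1) with 1 by ring. exact I2'.
Qed.

(** The continuation is represented by E1, then E, then E2. The representative changes at 1/4 and
    3/4, inside the open half turns on which neighbouring representatives agree, so every time has a
    neighbourhood where all of them coincide as germs. *)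
Lemma three_piece_loop x gamma E1 E E2 : loop x gamma ->
  (forall t, 0 <= t < 1 / 4 -> meromorphic_at E1 (gamma t)) ->
  (forall t, 1 / 4 <= t < 3 / 4 -> meromorphic_at E (gamma t)) ->
  (forall t, 3 / 4 <= t <= 1 -> meromorphic_at E2 (gamma t)) ->
  (forall t, 0 < t < 1 / 2 -> germ_eq (gamma t) E1 E) ->
  (forall t, 1 / 2 < t < 1 -> germ_eq (gamma t) E E2) -> branch_rel x E1 E2.
Proof.
intros L M1 M M2 J1 J2.
set (f := fun t => if Rlt_dec t (1 / 4) then E1 else if Rlt_dec t (3 / 4) then E else E2).
assert (F1 : forall t, t < 1 / 4 -> f t = E1).
{ intros t Ht. unfold f. destruct (Rlt_dec t (1 / 4)); auto; lra. }
assert (F2 : forall t, 1 / 4 <= t < 3 / 4 -> f t = E).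
{ intros t Ht. unfold f. destruct (Rlt_dec t (1 / 4)); try lra. destruct (Rlt_dec t (3 / 4)); auto; lra. }
assert (F3 : forall t, 3 / 4 <= t -> f t = E2).
{ intros t Ht. unfold f. destruct (Rlt_dec t (1 / 4)); try lra. destruct (Rlt_dec t (3 / 4)); auto; lra. }
assert (Fu : forall s t, 0 < s < 1 / 2 -> 0 < t < 1 / 2 -> germ_eq (gamma s) (f s) (f t)).
{ intros s t Hs Ht. assert (J := J1 s Hs).
  destruct (Rlt_le_dec s (1 / 4)), (Rlt_le_dec t (1 / 4)); rewrite ?(F1 s), ?(F1 t), ?(F2 s), ?(F2 t) by lra; auto using germ_eq_refl, germ_eq_sym. }
assert (Fl : forall s t, 1 / 2 < s < 1 -> 1 / 2 < t < 1 -> germ_eq (gamma s) (f s) (f t)).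
{ intros s t Hs Ht. assert (J := J2 s Hs).
  destruct (Rlt_le_dec s (3 / 4)), (Rlt_le_dec t (3 / 4)); rewrite ?(F3 s), ?(F3 t), ?(F2 s), ?(F2 t) by lra; auto using germ_eq_refl, germ_eq_sym. }
exists gamma, f. split; auto. split.
- apply continuation_eps. intros t [T0 T1]. split.
  + destruct (Rlt_le_dec t (1 / 4)). rewrite F1; auto. destruct (Rlt_le_dec t (3 / 4)). rewrite F2; auto. rewrite F3; auto.
  + destruct (Rlt_le_dec t (1 / 4)) as [A|A]; [|destruct (Rle_lt_dec t (1 / 4)) as [B|B]; [|destruct (Rlt_le_dec t (3 / 4)) as [D|D]; [|destruct (Rle_lt_dec t (3 / 4)) as [G|G]]]].
    * exists (1 / 4 - t). split. lra. intros s [S0 S1] Hs. apply Rabs_def2 in Hs. rewrite !F1 by lra. apply germ_eq_refl.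
    * exists (1 / 4). split. lra. intros s [S0 S1] Hs. apply Rabs_def2 in Hs. apply Fu; lra.
    * exists (Rmin (t - 1 / 4) (3 / 4 - t)). split. apply Rmin_pos; lra. intros s [S0 S1] Hs.
      assert (X := Rmin_l (t - 1 / 4) (3 / 4 - t)). assert (Y := Rmin_r (t - 1 / 4) (3 / 4 - t)). apply Rabs_def2 in Hs.
      rewrite !F2 by lra. apply germ_eq_refl.
    * exists (1 / 4). split. lra. intros s [S0 S1] Hs. apply Rabs_def2 in Hs. apply Fl; lra.
    * exists (t - 3 / 4). split. lra. intros s [S0 S1] Hs. apply Rabs_def2 in Hs. rewrite !F3 by lra. apply germ_eq_refl.
- rewrite F1, F3 by lra. split; apply germ_eq_refl.
Qed.

(** * Circles about 0 and 1 and the generators they realise *)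

(** Fixed by x -> 1 - x, so that the circle about 0 and its reflection about 1 start at the same
    point. *)
Definition base : C := RtoC (1 / 2).

Definition circle0 (t : R) : C := (0 + RtoC (1 / 2) * cis (2 * PI * t))%C.
Definition circle1 (t : R) : C := (1 - circle0 t)%C.

Lemma circle0_coords t : Re (circle0 t) = / 2 * cos (2 * PI * t) /\ Im (circle0 t) = / 2 * sin (2 * PI * t).
Proof. unfold circle0, cis. rewrite Cplus_0_l, re_scal_l, im_scal_l. simpl. split; field. Qed.

Lemma circle0_upper t : 0 < t < 1 / 2 -> upper (circle0 t).
Proof.
intros Ht. unfold upper. rewrite (proj2 (circle0_coords t)). assert (PP := PI_RGT_0).
assert (0 < sin (2 * PI * t)) by (apply sin_gt_0; nra). lra.
Qed.

Lemma circle0_lower t : 1 / 2 < t < 1 -> lower (circle0 t).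
Proof.
intros Ht. unfold lower. rewrite (proj2 (circle0_coords t)). assert (PP := PI_RGT_0).
assert (sin (2 * PI * t) < 0) by (apply sin_lt_0; nra). lra.
Qed.

Lemma circle0_0 : circle0 0 = base.
Proof. unfold circle0. rewrite Rmult_0_r. unfold cis. rewrite cos_0, sin_0. fold (RtoC 1). unfold base. ring. Qed.

Lemma circle0_1 : circle0 1 = base.
Proof. unfold circle0. rewrite Rmult_1_r, <- cis_2PI. unfold cis. rewrite cos_0, sin_0. fold (RtoC 1). unfold base. ring. Qed.

Lemma circle0_half : circle0 (1 / 2) = RtoC (- (1 / 2)).
Proof.
unfold circle0. replace (2 * PI * (1 / 2)) with PI by field. unfold cis. rewrite cos_PI, sin_PI. 
change (-1, 0) with (RtoC (-1)). rewrite RtoC_opp. replace (RtoC (-1)) with (- (1))%C by (rewrite <- RtoC_opp; reflexivity). ring.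
Qed.

Lemma base_cut : cut_plane base.
Proof. apply cut_plane_star. Qed.

Lemma circle0_cut t : 0 <= t < 1 / 2 \/ 1 / 2 < t <= 1 -> cut_plane (circle0 t).
Proof.
intros H. destruct (Req_dec_T t 0) as [->|N0]. rewrite circle0_0. apply base_cut.
destruct (Req_dec_T t 1) as [->|N1]. rewrite circle0_1. apply base_cut.
destruct H as [H|H]. apply upper_cut, circle0_upper; lra. apply lower_cut, circle0_lower; lra.
Qed.

Lemma circle0_neg t : 0 < t < 1 -> neg_plane (circle0 t).
Proof.
intros H. destruct (Rtotal_order t (1 / 2)) as [L|[->|L]]. apply upper_neg, circle0_upper; lra.
rewrite circle0_half. right. rewrite re_RtoC. lra. apply lower_neg, circle0_lower; lra.
Qed.

Lemma circle0_avoids t : unit_itv t -> circle0 t <> 0 /\ circle0 t <> 1.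
Proof.
intros [H0 H1]. destruct (Req_dec_T t (1 / 2)) as [->|N]. apply neg_plane_nz, circle0_neg. lra.
apply cut_plane_nz, circle0_cut. lra.
Qed.

Lemma circle0_continuous : path_continuous circle0.
Proof.
intros t _. apply filterlim_within_ext with circle0. reflexivity.
eapply filterlim_filter_le_1; [apply filter_le_within|].
unfold circle0. apply (continuous_Cplus (T := R_UniformSpace)). apply continuous_const.
apply (continuous_Cmult (T := R_UniformSpace)). apply continuous_const.
apply (continuous_comp (fun t => 2 * PI * t) cis); [|apply cis_continuous].
apply (ex_derive_continuous (K := R_AbsRing) (V := R_NormedModule)). auto_derive. auto.
Qed.

Lemma circle0_loop : loop base circle0.
Proof. split; [exact circle0_continuous|]. split. apply circle0_avoids. split. apply circle0_0. apply circle0_1. Qed.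

Lemma circle1_loop : loop base circle1.
Proof.
assert (B : (1 - base)%C = base).
{ unfold base. rewrite <- RtoC_minus. f_equal. field. }
split; [|split; [|split]].
- apply path_continuous_eps. intros t Ht e He. destruct (path_eps circle0 t e circle0_continuous Ht He) as [d [Hd K]].
  exists d. split; auto. intros s Us Hs. unfold circle1. replace (1 - circle0 s - (1 - circle0 t))%C with (circle0 t - circle0 s)%C by ring.
  rewrite Cmod_sub_sym. auto.
- intros t Ht. destruct (circle0_avoids t Ht) as [N0 N1]. unfold circle1. split; intros E; [apply N1 | apply N0].
  transitivity (1 - (1 - circle0 t))%C. ring. rewrite E. ring.
  transitivity (1 - (1 - circle0 t))%C. ring. rewrite E. ring.
- unfold circle1. now rewrite circle0_0.
- unfold circle1. now rewrite circle0_1.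
Qed.

Definition row_chazy (b1 b2 : chart -> C -> C) (s : row) : C -> C := chazy_formula (comb s (b1 Cut) (b2 Cut)).

Lemma chazy_comb_germ b1 b2 i j s r z : chart_system b1 b2 -> chart_dom i z ->
  locally z (fun y => comb s (b1 i) (b2 i) y = comb r (b1 j) (b2 j) y) ->
  germ_eq z (chazy_formula (comb s (b1 i) (b2 i))) (chazy_formula (comb r (b1 j) (b2 j))).
Proof.
intros [F _] Hz E. apply chazy_formula_loc; auto. apply (comb_sol (chart_dom i)); auto; apply (F i).
Qed.

Lemma chart_chazy_meromorphic b1 b2 i s z : chart_system b1 b2 -> row_nz s -> chart_dom i z ->
  meromorphic_at (chazy_formula (comb s (b1 i) (b2 i))) z.
Proof.
intros [F _] N Hz. apply (chazy_comb_meromorphic (chart_dom i)); auto. apply chart_dom_open.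
Qed.

Lemma germ_eq_upper b1 b2 i s z : chart_system b1 b2 -> chart_dom i z -> upper z ->
  germ_eq z (chazy_formula (comb s (b1 i) (b2 i))) (row_chazy b1 b2 (rmul s (chart_upper i))).
Proof.
intros CS Hi Hz. apply chazy_comb_germ; auto. generalize (upper_open z Hz). apply locally_imp. intros y Hy. now apply CS.
Qed.

Lemma germ_eq_lower b1 b2 i s z : chart_system b1 b2 -> chart_dom i z -> lower z ->
  germ_eq z (chazy_formula (comb s (b1 i) (b2 i))) (row_chazy b1 b2 (rmul s (chart_lower i))).
Proof.
intros CS Hi Hz. apply chazy_comb_germ; auto. generalize (lower_open z Hz). apply locally_imp. intros y Hy. now apply CS.
Qed.

(** The circle about 0 leaves through the upper half plane, where the change from [Cut] to [Neg] is
    the identity, and returns through the lower one, where it is [genB 1]. *)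
Lemma branch_rel_genB b1 b2 s : chart_system b1 b2 -> row_nz s ->
  branch_rel base (row_chazy b1 b2 s) (row_chazy b1 b2 (rmul s (genB 1))).
Proof.
intros CS N. apply (three_piece_loop base circle0 _ (chazy_formula (comb s (b1 Neg) (b2 Neg)))); [apply circle0_loop| | | | |].
- intros t Ht. apply (chart_chazy_meromorphic b1 b2 Cut); auto. apply circle0_cut. lra.
- intros t Ht. apply (chart_chazy_meromorphic b1 b2 Neg); auto. apply circle0_neg. lra.
- intros t Ht. apply (chart_chazy_meromorphic b1 b2 Cut); auto. apply rmul_nz; auto using in_Gamma2_genB. apply circle0_cut. lra.
- intros t Ht. apply germ_eq_sym. assert (K := germ_eq_upper b1 b2 Neg s (circle0 t) CS). simpl chart_upper in K.
  rewrite rmul_mone in K. apply K. apply circle0_neg; lra. now apply circle0_upper.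
- intros t Ht. apply (germ_eq_lower b1 b2 Neg); auto. apply circle0_neg; lra. now apply circle0_lower.
Qed.

(** The reflected circle leaves through the lower half plane, where the change from [Cut] to [Right]
    is the identity, and returns through the upper one, where it is [genA (-1)]. *)
Lemma branch_rel_genA b1 b2 s : chart_system b1 b2 -> row_nz s ->
  branch_rel base (row_chazy b1 b2 s) (row_chazy b1 b2 (rmul s (genA (-1)))).
Proof.
intros CS N.
assert (C1 : forall t, 0 <= t < 1 / 2 \/ 1 / 2 < t <= 1 -> cut_plane (circle1 t)) by (intros; now apply cut_plane_reflect, circle0_cut).
assert (R1 : forall t, 0 < t < 1 -> right_plane (circle1 t)).
{ intros t Ht. assert (K := circle0_neg t Ht). unfold circle1, right_plane, neg_plane in *.
  unfold Cminus. rewrite im_plus, im_opp, re_plus, re_opp. rewrite im_RtoC, re_RtoC. destruct K; [left | right]; lra. }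
assert (Lo : forall t, 0 < t < 1 / 2 -> lower (circle1 t)) by (intros; now apply upper_reflect, circle0_upper).
assert (Up : forall t, 1 / 2 < t < 1 -> upper (circle1 t)) by (intros; now apply lower_reflect, circle0_lower).
apply (three_piece_loop base circle1 _ (chazy_formula (comb s (b1 Right) (b2 Right)))); [apply circle1_loop| | | | |].
- intros t Ht. apply (chart_chazy_meromorphic b1 b2 Cut); auto. apply C1. lra.
- intros t Ht. apply (chart_chazy_meromorphic b1 b2 Right); auto. apply R1. lra.
- intros t Ht. apply (chart_chazy_meromorphic b1 b2 Cut); auto. apply rmul_nz; auto using in_Gamma2_genA. apply C1. lra.
- intros t Ht. apply germ_eq_sym. assert (K := germ_eq_lower b1 b2 Right s (circle1 t) CS). simpl chart_lower in K.
  rewrite rmul_mone in K. apply K. apply R1; lra. now apply Lo.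
- intros t Ht. apply (germ_eq_upper b1 b2 Right); auto. apply R1; lra.
Qed.

(** The generators act on arbitrary non-zero rows, so a loop appended at the end multiplies the
    matrix reached so far on the right, as [Gamma2_generated] requires. The matrix - 1 needs only a
    constant loop. *)
Lemma branch_rel_Gamma2 b1 b2 s : chart_system b1 b2 -> row_nz s -> forall G, in_Gamma2 G ->
  branch_rel base (row_chazy b1 b2 s) (row_chazy b1 b2 (rmul s G)).
Proof.
intros CS N G HG. destruct (cut_plane_nz base base_cut) as [N0 N1].
assert (Ms : forall r, row_nz r -> meromorphic_at (row_chazy b1 b2 r) base).
{ intros r Hr. apply (chart_chazy_meromorphic b1 b2 Cut); auto. apply base_cut. }
(* Reversing the loop that realises g, started from the row r g', leads from r to r g' when g' g =
   1. *)
assert (Step : forall g g', mmul g' g = mone -> in_Gamma2 g' -> (forall r, row_nz r -> branch_rel base (row_chazy b1 b2 r) (row_chazy b1 b2 (rmul r g))) ->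
  forall r, row_nz r -> branch_rel base (row_chazy b1 b2 r) (row_chazy b1 b2 (rmul r g'))).
{ intros g g' E Hg H r Hr. apply branch_rel_sym. assert (K := H (rmul r g') (rmul_nz _ _ Hg Hr)).
  now rewrite rmul_mmul, E, rmul_mone in K. }
assert (B1 : forall r, row_nz r -> branch_rel base (row_chazy b1 b2 r) (row_chazy b1 b2 (rmul r (genB 1)))) by (intros; now apply branch_rel_genB).
assert (A2 : forall r, row_nz r -> branch_rel base (row_chazy b1 b2 r) (row_chazy b1 b2 (rmul r (genA (-1))))) by (intros; now apply branch_rel_genA).
assert (B2 := Step (genB 1) (genB (-1)) (genB_cancel (-1)) (in_Gamma2_genB _) B1).
assert (A1 := Step (genA (-1)) (genA 1) (genA_cancel 1) (in_Gamma2_genA _) A2).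
apply (Gamma2_generated (fun M => row_nz (rmul s M) /\ branch_rel base (row_chazy b1 b2 s) (row_chazy b1 b2 (rmul s M)))); auto.
- rewrite rmul_mone. split; auto. apply branch_rel_refl; auto using germ_eq_refl.
- assert (E : rmul s (mopp mone) = ((- (1)) * fst s, (- (1)) * snd s)%C).
  { unfold rmul, mopp, mone; cbn [m11 m12 m21 m22]. simpl (- (1))%Z. simpl (- 0)%Z.
    replace (RtoC (IZR (-1))) with (- (1))%C by (rewrite <- RtoC_opp; reflexivity). f_equal; ring. }
  split.
  + rewrite E. intros [E1 E2]. apply N. cbn [fst snd] in E1, E2. split.
    transitivity ((- (1)) * (- (1) * fst s))%C. ring. rewrite E1. ring.
    transitivity ((- (1)) * (- (1) * snd s))%C. ring. rewrite E2. ring.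
  + apply branch_rel_refl; auto. rewrite E. apply germ_eq_sym.
    assert (An : analytic_at (comb s (b1 Cut) (b2 Cut)) base).
    { destruct CS as [F _]. destruct (F Cut) as [S1 [S2 _]]. apply (comb_sol (chart_dom Cut)); auto. apply base_cut. }
    apply germ_eq_trans with (chazy_formula (fun x => (- (1)) * comb s (b1 Cut) (b2 Cut) x)%C).
    * apply germ_eq_sym. apply chazy_formula_loc. apply analytic_mult; auto. apply analytic_const.
      apply locally_all. intros y. unfold comb; cbn [fst snd]. ring.
    * apply chazy_formula_scal; auto. intros E1. apply C1_nz. transitivity ((- (1)) * (- (1)))%C. ring. rewrite E1. ring.
- intros M [HM K]. split. rewrite <- rmul_mmul. apply rmul_nz; auto using in_Gamma2_genA. rewrite <- rmul_mmul. apply branch_rel_trans with (1 := K). now apply A1.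
- intros M [HM K]. split. rewrite <- rmul_mmul. apply rmul_nz; auto using in_Gamma2_genA. rewrite <- rmul_mmul. apply branch_rel_trans with (1 := K). now apply A2.
- intros M [HM K]. split. rewrite <- rmul_mmul. apply rmul_nz; auto using in_Gamma2_genB. rewrite <- rmul_mmul. apply branch_rel_trans with (1 := K). now apply B1.
- intros M [HM K]. split. rewrite <- rmul_mmul. apply rmul_nz; auto using in_Gamma2_genB. rewrite <- rmul_mmul. apply branch_rel_trans with (1 := K). now apply B2.
Qed.

(** * The theorem *)

Lemma meromorphic_identity U c p f g : star c U -> U p ->
  (forall z, U z -> meromorphic_at f z /\ meromorphic_at g z) ->
  germ_eq p f g -> forall z, U z -> germ_eq z f g.
Proof.
intros [Uc S] Up M E z Hz. apply identity_segment with c; auto.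
apply identity_segment with p; auto.
intros t Ht. apply M. rewrite segment_rev. apply S; auto. unfold unit_itv in *; lra.
Qed.

(** The product of (1, nu) with (d b; c a) is (c nu + d, a nu + b), the Moebius image in homogeneous
    coordinates. Dividing by the first coordinate, or by the second when the first is zero, does not
    change the Chazy function. *)
Lemma chazy_moebius_germ w1 w2 a b c d nu z : analytic_at w1 z -> analytic_at w2 z -> Gamma2 a b c d ->
  germ_eq z (chazy w1 w2 (moebius a b c d nu)) (chazy_formula (comb (rmul (RtoC 1, nu) (Mat d b c a)) w1 w2)).
Proof.
intros A1 A2 G. unfold moebius. 
assert (N : row_nz (rmul (RtoC 1, nu) (Mat d b c a))).
{ apply rmul_nz. unfold in_Gamma2, Gamma2 in *; cbn [m11 m12 m21 m22]. intuition lia. intros [E _]. cbn [fst] in E. revert E. apply C1_nz. }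
set (r := rmul (RtoC 1, nu) (Mat d b c a)) in *.
assert (R1 : fst r = (RtoC (IZR c) * nu + RtoC (IZR d))%C) by (unfold r, rmul; cbn [fst snd m11 m12 m21 m22]; ring).
assert (R2 : snd r = (RtoC (IZR a) * nu + RtoC (IZR b))%C) by (unfold r, rmul; cbn [fst snd m11 m12 m21 m22]; ring).
rewrite <- R1, <- R2. clearbody r.
destruct (Ceq_dec (fst r) (RtoC 0)) as [E|E].
- apply germ_eq_sym. apply germ_eq_trans with (chazy_formula (fun x => snd r * w2 x)%C).
  + apply chazy_formula_loc. now apply analytic_lin. apply locally_all. intros y. unfold comb. rewrite E. ring.
  + apply (chazy_formula_scal (snd r) w2); auto.
- apply germ_eq_sym. apply germ_eq_trans with (chazy_formula (fun x => fst r * (w1 x + snd r / fst r * w2 x))%C).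
  + apply chazy_formula_loc. now apply analytic_lin. apply locally_all. intros y. unfold comb. field. auto.
  + apply (chazy_formula_scal (fst r) (fun x => w1 x + snd r / fst r * w2 x)%C); auto.
    apply analytic_plus; auto. apply analytic_mult; auto. apply analytic_const.
Qed.

Theorem theorem3 :
  forall (w1 w2 : C -> C),
    solution_basis w1 w2 -> standard_branch w1 w2 ->
  forall (nu : C) (h : C -> C),
    is_branch (chazy w1 w2 (Fin nu)) h <->
    (meromorphic_on_cut_plane h /\
     exists a b c d : Z,
       Gamma2 a b c d /\
       eq_on_cut_plane h (chazy w1 w2 (moebius a b c d nu))).
Proof.
intros w1 w2 B SB nu h.
destruct (chart_system_exists w1 w2 B) as [b1 [b2 [CS Ex]]].
destruct (standard_branch_Gamma2 w1 w2 b1 b2 B SB CS Ex) as [M [GM Ew]].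
assert (A1 : forall z, cut_plane z -> analytic_at w1 z) by apply (basis_analytic1 _ _ B).
assert (A2 : forall z, cut_plane z -> analytic_at w2 z) by apply (basis_analytic2 _ _ B).
assert (Nr : row_nz (RtoC 1, nu)) by (intros [E _]; cbn [fst] in E; revert E; apply C1_nz).
assert (Cw : forall r z, cut_plane z -> germ_eq z (chazy_formula (comb r w1 w2)) (row_chazy b1 b2 (rmul r M))).
{ intros r z Hz. apply chazy_formula_loc. apply analytic_lin; auto.
  generalize (cut_plane_open z Hz). apply locally_imp. intros y Hy. unfold comb at 1. destruct (Ew y Hy) as [-> ->].
  unfold comb, rmul, unit_row; cbn [fst snd]. ring. }
assert (Cnu : forall z, cut_plane z -> germ_eq z (chazy w1 w2 (Fin nu)) (row_chazy b1 b2 (rmul (RtoC 1, nu) M))).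
{ intros z Hz. apply germ_eq_trans with (2 := Cw (RtoC 1, nu) z Hz). apply germ_eq_sym, chazy_formula_loc.
  apply analytic_lin; auto. apply locally_all. intros y. unfold comb; cbn [fst snd]. unfold chazy_W. ring. }
assert (Mer : forall r z, row_nz r -> cut_plane z -> meromorphic_at (row_chazy b1 b2 r) z).
{ intros r z Hr Hz. now apply (chart_chazy_meromorphic b1 b2 Cut). }
split.
- intros [Hm [x0 [gamma [f [Hx [L [Ct [I0 I1]]]]]]]]. split; auto.
  destruct (monodromy_in_Gamma2 b1 b2 chazy_formula (fun _ => (RtoC 1, nu)) x0 gamma (fun _ => f) M) as [N [GN E]]; auto.
  + intros i N _ z GN Hz. apply chart_chazy_meromorphic; auto. now apply rmul_nz.
  + intros u v z. apply chazy_formula_loc.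
  + intros _. apply germ_eq_trans with (1 := I0). now apply Cnu.
  (* In the chart basis the row (1, nu) M is continued to (1, nu) N. Read back in the basis w1, w2
     this is (1, nu) K with K M = N, and exchanging the diagonal entries of K gives the Moebius
     matrix. *)
  + set (K := mmul N (madj M)).
    assert (GK : in_Gamma2 K) by (apply in_Gamma2_mmul; auto; now apply in_Gamma2_madj).
    assert (EK : mmul K M = N) by (unfold K; rewrite mmul_assoc, (proj2 (mmul_madj M GM)); apply mmul_mone_r).
    assert (G' : Gamma2 (m22 K) (m12 K) (m21 K) (m11 K)).
    { unfold in_Gamma2, Gamma2 in *. intuition lia. }
    exists (m22 K), (m12 K), (m21 K), (m11 K). split; auto.
    assert (EM : Mat (m11 K) (m12 K) (m21 K) (m22 K) = K) by (destruct K; reflexivity).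
    assert (Tz : forall z, cut_plane z -> germ_eq z (chazy w1 w2 (moebius (m22 K) (m12 K) (m21 K) (m11 K) nu)) (row_chazy b1 b2 (rmul (RtoC 1, nu) N))).
    { intros z Hz. apply germ_eq_trans with (chazy_formula (comb (rmul (RtoC 1, nu) K) w1 w2)).
      - assert (T := chazy_moebius_germ w1 w2 _ _ _ _ nu z (A1 z Hz) (A2 z Hz) G'). now rewrite EM in T.
      - assert (T := Cw (rmul (RtoC 1, nu) K) z Hz). now rewrite rmul_mmul, EK in T. }
    intros z Hz. apply germ_eq_trans with (row_chazy b1 b2 (rmul (RtoC 1, nu) N)); [|now apply germ_eq_sym, Tz].
    (* The loop gives equality at x0 only; h is meromorphic on the star-shaped cut plane, so the
       identity theorem gives the rest. *)
    apply (meromorphic_identity cut_plane (RtoC (1 / 2)) x0); auto using cut_plane_star.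
    * intros y Hy. split. now apply Hm. apply Mer; auto. now apply rmul_nz.
    * apply germ_eq_trans with (f 1). now apply germ_eq_sym. apply (E true).
- intros [Hm [a [b [c [d [G Eh]]]]]]. split; auto.
  set (K := Mat d b c a).
  assert (GK : in_Gamma2 K) by (unfold in_Gamma2, Gamma2 in *; cbn [K m11 m12 m21 m22]; intuition lia).
  (* The matrix K acts on rows for w1, w2; in the chart basis it becomes its conjugate by M, again
     in Gamma(2), which some loop realises. *)
  set (Q := mmul (mmul (madj M) K) M).
  assert (GQ : in_Gamma2 Q) by (apply in_Gamma2_mmul; auto; apply in_Gamma2_mmul; auto; now apply in_Gamma2_madj).
  assert (EQ : mmul M Q = mmul K M).
  { unfold Q. rewrite <- !mmul_assoc, (proj1 (mmul_madj M GM)). f_equal. clearbody K; destruct K as [k11 k12 k21 k22]; apply mat2_eq; unfold mmul, mone; cbn [m11 m12 m21 m22]; ring. }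
  destruct (branch_rel_Gamma2 b1 b2 (rmul (RtoC 1, nu) M) CS (rmul_nz _ _ GM Nr) Q GQ) as [gamma [f [L [Ct [I0 I1]]]]].
  exists base, gamma, f. split; [apply base_cut|]. split; auto. split; auto. split.
  + apply germ_eq_trans with (1 := I0). apply germ_eq_sym, Cnu, base_cut.
  + apply germ_eq_trans with (1 := I1). apply germ_eq_sym. apply germ_eq_trans with (1 := Eh base base_cut).
    apply germ_eq_trans with (1 := chazy_moebius_germ w1 w2 a b c d nu base (A1 _ base_cut) (A2 _ base_cut) G).
    rewrite rmul_mmul, EQ, <- rmul_mmul. apply Cw, base_cut.
Qed.
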